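(* Let $\Sigma^2$ be a biconservative surface in $\mathbb{S}^2\times\mathbb{R}$ with mean curvature function $f>0$ and $\nabla f\neq 0$ at each point of the surface, such that $\nabla f$ is a principal direction. Then, locally, $\Sigma^2\subset\mathbb{R}^4$ can be parametrized as $$ \Phi(u,v)=\left(\frac{\cos v}{\sqrt{a^2+1}}C_1+\frac{\sin v}{\sqrt{a^2+1}}C_2+\frac{a}{\sqrt{a^2+1}}(C_1\times C_2),\ \int_{u_0}^u\cos\theta(t)\,dt\right), $$ where $C_1,C_2\in\mathbb{R}^3$ are two constant orthonormal vectors, $\times$ is the Euclidean cross product of $\mathbb{R}^3$, and $a=a(u)$ and $\theta=\theta(u)$ are two real valued functions such that $$ \sin\theta\neq 0,\quad \cos\theta\neq 0,\quad a'+(a^2+1)\sin\theta=0, $$ and $$ \left(\theta'-a\cos\theta\right)\left(\theta'-a\cos\theta\right)'+(a^2+1)\left(\frac{(\theta')^2-a^2\cos^2\theta}{a^2+1}\right)'=0, $$ where $'$ denotes the derivative with respect to $u$.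
   Context: $\mathbb{S}^2$ is the unit sphere in $\mathbb{R}^3$, and $\mathbb{S}^2\times\mathbb{R}$ is viewed as a submanifold of $\mathbb{R}^3\times\mathbb{R}=\mathbb{R}^4$ with the induced (product) metric. Surfaces are oriented (immersed, smooth), with unit normal vector field $\eta$ and shape operator $A$ given by $\bar\nabla_X\eta=-AX$ for $X$ tangent to the surface, where $\bar\nabla$ is the Levi-Civita connection of the ambient three-manifold. The mean curvature function is $f=\frac12\operatorname{trace}A$ (so the mean curvature vector field is $H=f\eta$), and $\nabla f$ is its gradient on $\Sigma^2$. ''$\nabla f$ is a principal direction'' means that $\nabla f$ is an eigenvector of $A$ at each point. The curvature tensor convention is $\bar R(X,Y)Z=\bar\nabla_X\bar\nabla_YZ-\bar\nabla_Y\bar\nabla_XZ-\bar\nabla_{[X,Y]}Z$. A surface in a Riemannian three-manifold is called biconservative if the tangent part of its bitension field $\tau_2(\phi)=\Delta\tau(\phi)-\operatorname{trace}\bar R(d\phi(\cdot),\tau(\phi))d\phi(\cdot)$ vanishes, where $\phi$ is the immersion, $\tau(\phi)=\operatorname{trace}\nabla d\phi$ and $\Delta=\operatorname{trace}(\nabla\nabla-\nabla_\nabla)$; equivalently, $$A(\nabla f)+f\nabla f+f\left(\operatorname{trace}\bar R(\cdot,\eta)\cdot\right)^{\top}=0,$$ where the trace is taken over the tangent space of the surface and $\top$ denotes the tangent part.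
   Formalization: A constant h is added to the last coordinate of Φ: with u_0 in the u-interval, the printed formula has height 0 at u = u_0 and so fails for vertically translated surfaces; the parametrization is therefore stated up to a vertical translation of S²×R. *)

(* Defs.v *)
From HB Require Import structures.
From mathcomp Require Import all_boot all_order all_algebra.
From mathcomp Require Import all_classical all_reals all_analysis.

Set Implicit Arguments.
Unset Strict Implicit.
Unset Printing Implicit Defensive.

Import Order.TTheory GRing.Theory Num.Theory.
Import numFieldNormedType.Exports.

Local Open Scope classical_set_scope.
Local Open Scope ring_scope.

Section Calculus.
Variable R : realType.

(* The derivatives of mathcomp-analysis are total functions, so smoothness says
   that every iterated partial derivative is Fréchet differentiable on D; for
   open D this is C^infinity. *)
Definition smooth_on (W : normedModType R) n (D : set 'rV[R]_n)
    (f : 'rV[R]_n -> W) :=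
  forall (s : seq 'I_n) (w : 'rV[R]_n), D w ->
    differentiable (foldr (fun i g => 'D_(delta_mx 0 i) g) f s) w.

Definition smooth_on_line (D : set R) (f : R -> R) :=
  forall (k : nat) (u : R), D u -> derivable (derive1n k f) u 1.

(* \int_a^b f, with the usual sign when b < a. *)
Definition oriented_integral (f : R -> R) (a b : R) : R :=
  if a <= b then Rintegral lebesgue_measure `[a, b] f
  else - Rintegral lebesgue_measure `[b, a] f.

End Calculus.

Section Surface.
Variable R : realType.

Record chart (T : topologicalType) := Chart {
  chart_dom : set T ;
  chart_img : set 'rV[R]_2 ;
  coord : T -> 'rV[R]_2 ;
  param : 'rV[R]_2 -> T ;
  chart_dom_open : open chart_dom ;
  chart_img_open : open chart_img ;
  coord_img : forall p, chart_dom p -> chart_img (coord p) ;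
  param_dom : forall w, chart_img w -> chart_dom (param w) ;
  coordK : forall p, chart_dom p -> param (coord p) = p ;
  paramK : forall w, chart_img w -> coord (param w) = w ;
  coord_continuous : forall p, chart_dom p -> {for p, continuous coord} ;
  param_continuous : forall w, chart_img w -> {for w, continuous param}
}.

Definition smooth_transition (T : topologicalType) (c d : chart T) :=
  smooth_on (chart_img c `&` param c @^-1` chart_dom d) (coord d \o param c).

Record surface := Surface {
  carrier :> topologicalType ;
  atlas : set (chart carrier) ;
  surface_hausdorff : hausdorff_space carrier ;
  surface_second_countable : @second_countable carrier ;
  atlas_cover : forall p : carrier, exists2 c, atlas c & chart_dom c p ;
  atlas_smooth : forall c d, atlas c -> atlas d -> smooth_transition c d
}.

Definition maximal_atlas (S : surface) : set (chart S) :=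
  [set c | forall d, atlas d -> smooth_transition c d /\ smooth_transition d c].

(* P holds at every point of S, in every chart of the atlas; P receives the
   parametrization of the chart and the coordinates of the point. *)
Definition everywhere (S : surface) (P : ('rV[R]_2 -> S) -> 'rV[R]_2 -> Prop) :=
  forall c : chart S, atlas c -> forall w, chart_img c w -> P (param c) w.

End Surface.

Section Ambient.
Variable R : realType.

Definition dot n (x y : 'rV[R]_n) : R := \sum_i x 0 i * y 0 i.

(* The indices k, k + 1, k + 2 : 'I_3 are taken modulo 3. *)
Definition cross (x y : 'rV[R]_3) : 'rV[R]_3 :=
  \row_k (x 0 (k + 1) * y 0 (k + 2%:R) - x 0 (k + 2%:R) * y 0 (k + 1)).

Definition R4 : normedModType R := ('rV[R]_3 * R^o)%type.

Definition dot4 (p q : R4) : R := dot p.1 q.1 + p.2 * q.2.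

Definition S2xR : set R4 := [set q | dot q.1 q.1 = 1].

(* For q in S2xR, the orthogonal projection of R4 onto T_q S2xR. *)
Definition projS2xR (q w : R4) : R4 := (w.1 - dot w.1 q.1 *: q.1, w.2).

(* Vector fields on S2xR are handled through extensions to R4.  The connection
   is the tangential part of the flat one; its values on S2xR only depend on
   the restrictions of the fields to S2xR. *)
Definition nablaS2xR (X Y : R4 -> R4) : R4 -> R4 :=
  fun q => projS2xR q ('D_(X q) Y q).

Definition lie_bracket (X Y : R4 -> R4) : R4 -> R4 :=
  fun q => 'D_(X q) Y q - 'D_(Y q) X q.

Definition curvature_field (X Y Z : R4 -> R4) : R4 -> R4 := fun q =>
  nablaS2xR X (nablaS2xR Y Z) q - nablaS2xR Y (nablaS2xR X Z) q
  - nablaS2xR (lie_bracket X Y) Z q.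

(* The curvature at q on vectors x, y, z of T_q S2xR, each extended to the
   tangent vector field q' |-> projS2xR q' x. *)
Definition curvature (q x y z : R4) : R4 :=
  curvature_field (projS2xR^~ x) (projS2xR^~ y) (projS2xR^~ z) q.

End Ambient.

(* Geometry of a surface in S2xR in local coordinates: x is the immersion and
   n the unit normal, both read in a chart. *)
Section LocalGeometry.
Variable R : realType.
Implicit Types (x n V : 'rV[R]_2 -> R4 R) (w b : 'rV[R]_2).

Local Notation e i := (delta_mx 0 i : 'rV[R]_2).

Definition gram x w : 'M[R]_2 :=
  \matrix_(i, j) dot4 ('D_(e i) x w) ('D_(e j) x w).

Definition gram_inv x w : 'M[R]_2 := invmx (gram x w).

Definition christoffel x (k i j : 'I_2) w : R :=
  2^-1 * \sum_l gram_inv x w k l *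
    ('D_(e i) (fun w' => gram x w' j l : R^o) w
     + 'D_(e j) (fun w' => gram x w' i l : R^o) w
     - 'D_(e l) (fun w' => gram x w' i j : R^o) w).

(* The ambient connection along x, in the direction of the tangent vector with
   coordinates b. *)
Definition nabla_along x b V : 'rV[R]_2 -> R4 R :=
  fun w => projS2xR (x w) ('D_b V w).

Definition hessian_map x (i j : 'I_2) w : R4 R :=
  nabla_along x (e i) ('D_(e j) x) w
  - \sum_k christoffel x k i j w *: 'D_(e k) x w.

Definition tension x w : R4 R :=
  \sum_i \sum_j gram_inv x w i j *: hessian_map x i j w.

Definition rough_laplacian x V w : R4 R :=
  \sum_i \sum_j gram_inv x w i j *:
    (nabla_along x (e i) (nabla_along x (e j) V) w
     - \sum_k christoffel x k i j w *: nabla_along x (e k) V w).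

Definition bitension x w : R4 R :=
  rough_laplacian x (tension x) w
  - \sum_i \sum_j gram_inv x w i j *:
      curvature (x w) ('D_(e i) x w) (tension x w) ('D_(e j) x w).

Definition tangent_part x w (y : R4 R) : R4 R :=
  \sum_i \sum_j (gram_inv x w i j * dot4 y ('D_(e i) x w)) *: 'D_(e j) x w.

Definition shape x n w b : R4 R := - nabla_along x b n w.

Definition mean_curvature x n w : R :=
  2^-1 * \sum_i \sum_j gram_inv x w i j *
    dot4 (shape x n w (e i)) ('D_(e j) x w).

(* Coordinates of the gradient for the induced metric. *)
Definition gradient x (f : 'rV[R]_2 -> R^o) w : 'rV[R]_2 :=
  \row_i \sum_j gram_inv x w i j * 'D_(e j) f w.

Definition principal_direction x n w b :=
  b != 0 /\ exists lambda : R, shape x n w b = lambda *: 'D_b x w.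

End LocalGeometry.

Section SurfacesInS2xR.
Variables (R : realType) (S : surface R).
Implicit Types (phi eta : S -> R4 R).

Definition immersion_in_S2xR phi :=
  [/\ forall p, S2xR (phi p),
      forall c : chart R S, atlas c -> smooth_on (chart_img c) (phi \o param c)
    & everywhere (fun (x : 'rV[R]_2 -> S) w => forall b, b != 0 ->
        'D_b (phi \o x) w != 0)].

Definition unit_normal_field phi eta :=
  [/\ forall c : chart R S, atlas c -> smooth_on (chart_img c) (eta \o param c),
      forall p, dot4 (eta p) (eta p) = 1,
      forall p, dot (eta p).1 (phi p).1 = 0
    & everywhere (fun (x : 'rV[R]_2 -> S) w => forall b,
        dot4 (eta (x w)) ('D_b (phi \o x) w) = 0)].

Definition biconservative phi :=
  everywhere (fun (x : 'rV[R]_2 -> S) w =>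
    tangent_part (phi \o x) w (bitension (phi \o x) w) = 0).

End SurfacesInS2xR.

Section Model.
Variable R : realType.

Definition Phi (C1 C2 : 'rV[R]_3) (a theta : R -> R) (u0 u v : R) : R4 R :=
  ((cos v / Num.sqrt (a u ^+ 2 + 1)) *: C1
   + (sin v / Num.sqrt (a u ^+ 2 + 1)) *: C2
   + (a u / Num.sqrt (a u ^+ 2 + 1)) *: cross C1 C2,
   oriented_integral (fun t => cos (theta t)) u0 u).

(* An isometry of S2xR.  The last coordinate of Phi vanishes at u = u0, so a
   surface can only be parametrized by Phi up to such a translation. *)
Definition vertical_translation (h : R) (q : R4 R) : R4 R := (q.1, q.2 + h).

End Model.

(* Main.v *)
(* Let X1 = grad f / |grad f| and complete it to an orthonormal tangent frame
   X1, X2; let xi be the horizontal part of the position vector (the unit normal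
   of S^2 x R in R^4), vt the vertical direction, N = <eta, vt> and
   s = <X1, vt>.  As X1 and X2 are principal directions, the X2-component of the
   biconservative equation is f N <X2, vt> = 0, and differentiating this forces
   X2 to be horizontal.  The structure equations then become explicit: with
   principal curvatures l and a s,
     X1 N = - l s,  X1 s = l N,  X1 a = - N (1 + a^2),
   while X2 kills N, s and a.  For nu = N X1 - s eta, the vector
   C = (a xi - nu) / sqrt (a^2 + 1) is constant and r = (xi + a nu) / sqrt (a^2 + 1)
   satisfies X1 r = 0 and X2 r = sqrt (a^2 + 1) X2.  So r runs on the great circle
   orthogonal to C, and xi = (r + a C) / sqrt (a^2 + 1) is the horizontal part of
   the parametrization, v being the angle of r.  With cos theta = s and
   sin theta = N one has X1 theta = - l and l = 2 f - a s, hence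
   theta' - a cos theta = - 2 f, and the second differential equation is the
   X1-component of the biconservative equation.  The coordinate u, with X1 u = 1
   and X2 u = 0, is a primitive of 1 / s in terms of the height. *)

Require Import Defs.
From HB Require Import structures.
From mathcomp Require Import all_boot all_order all_algebra ring lra.
From mathcomp Require Import all_classical all_reals all_analysis.

Set Implicit Arguments.
Unset Strict Implicit.
Unset Printing Implicit Defensive.
Import Order.TTheory GRing.Theory Num.Theory.
Import numFieldNormedType.Exports.
Local Open Scope classical_set_scope.
Local Open Scope ring_scope.

(** * Directional derivatives *)

(** The frame [X1], [X2] does not commute: its bracket is [- a N X2], so coordinates along the frame
    have to be produced as functions. Two functions [u], [v] with [X1 v = X2 u = 0] and with [X1 u],
    [X2 v] nonzero suffice, since their Jacobian is diagonal in the frame and the inverse function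
    theorem makes them a chart. The angle of [r] is such a [v]. For [u], the height [t] satisfies
    [X1 t = s], which suggests integrating [1 / s]; this requires [s] to be a function of [t] alone,
    which is read off in the auxiliary chart [(t, v)].

    The bracket also carries the integrability conditions: applied to [nu] it yields [X1 a], and
    applied to [N] it yields [X2 l = 0], whence [X2 a = 0].

    Biconservativity is given by the bitension field in a chart, so its tangential part must first
    be computed there; the Codazzi equation enters as the symmetry of the third derivatives of the
    immersion.

    Dividing by [s] and the condition on [sin theta] require [s] and [N] not to vanish; a zero of
    either contradicts the positivity of [f] and of [rho], the norm of its gradient. *)

Lemma open_preimage_on (T U : topologicalType) (A : set T) (f : T -> U) (B : set U) :
  open A -> (forall p, A p -> {for p, continuous f}) -> open B -> open (A `&` f @^-1` B).
Proof.
move=> oA cf oB; rewrite openE => p [Ap Bp]; rewrite /interior.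
have h1 : \forall q \near p, A q by exact: (open_nbhs_nbhs (conj oA Ap)).
have h2 : \forall q \near p, B (f q).
  by apply: (cf p Ap); exact: (open_nbhs_nbhs (conj oB Bp)).
by apply: filterS2 h1 h2.
Qed.

Section DirectionalDerivative.
Variable R : realType.
Implicit Types U V W : normedModType R.

(** The first-order expansion of [f] at [w] is one of [g], and uniqueness of the expansion
    identifies ['d g w] with ['d f w]. *)
Lemma near_eq_differentiable V W (f g : V -> W) (w : V) :
  (\near w, f w = g w) -> differentiable f w -> differentiable g w.
Proof.
move=> fg df.
have fgw : f w = g w by exact: (nbhs_singleton fg).
have gE : g \o shift w = cst (g w) + 'd f w +o_ 0 id.
  apply/eqaddoP => _/posnumP[e].
  have /eqaddoP /(_ e%:num) /(_ [gt0 of e%:num]) := diff_locally df.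
  have : \forall h \near (0 : V), f (h + w) = g (h + w).
    by rewrite (near_shift w) /= ; near do rewrite /= sub0r addrNK.
  apply: filterS2 => h /= fgh.
  by rewrite /= -fgw -[X in _ -> `|X| <= _]/(g (h + w) - _) -fgh.
have dgf : 'd g w = 'd f w :> (V -> W).
  by apply: diff_unique => //; exact: (diff_continuous df).
apply/diff_locallyP; rewrite dgf; split => //; exact: (diff_continuous df).
Unshelve. all: by end_near. Qed.

(** ['D_v f w] is total, so an equation on its value alone does not imply that the derivative
    exists. Carrying Fréchet differentiability along with the value lets the calculus rules compose,
    and gives linearity in [v]. *)
Definition dderiv V W (f : V -> W) (w v : V) (d : W) :=
  differentiable f w /\ 'D_v f w = d.

Lemma dderiv_diff V W (f : V -> W) w v : differentiable f w ->
  dderiv f w v ('D_v f w).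
Proof. by []. Qed.

Lemma dderiv_val V W (f : V -> W) w v d : dderiv f w v d -> 'D_v f w = d.
Proof. by case. Qed.

Lemma dderiv_eq V W (f : V -> W) w v d d' :
  dderiv f w v d -> d = d' -> dderiv f w v d'.
Proof. by move=> ? <-. Qed.

Lemma dderiv_uniq V W (f : V -> W) w v d d' :
  dderiv f w v d -> dderiv f w v d' -> d = d'.
Proof. by move=> [_ <-] [_ <-]. Qed.

Lemma dderiv_near V W (f g : V -> W) w v d : (\near w, f w = g w) ->
  dderiv f w v d -> dderiv g w v d.
Proof.
move=> fg [df <-]; split; first exact: near_eq_differentiable df.
by apply/esym/near_eq_derive.
Qed.

Lemma dderiv_on V W (D : set V) (f g : V -> W) w v d : open D -> D w ->
  (forall w, D w -> f w = g w) -> dderiv f w v d -> dderiv g w v d.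
Proof.
move=> oD Dw fg; apply: dderiv_near.
by apply: filterS (open_nbhs_nbhs (conj oD Dw)).
Qed.

Lemma dderiv_cst V W (c : W) (w v : V) : dderiv (fun=> c) w v 0.
Proof. by split; [exact: differentiable_cst|exact: derive_cst]. Qed.

(** The way in which relations between frame components arise: an identity valid on an open set is
    differentiated. *)
Lemma dderiv_const_on V W (D : set V) (f : V -> W) c w v d : open D -> D w ->
  (forall w, D w -> f w = c) -> dderiv f w v d -> d = 0.
Proof.
move=> oD Dw fc fd; have := dderiv_on oD Dw fc fd.
by move/dderiv_uniq; apply; exact: dderiv_cst.
Qed.

Lemma dderivD V W (f g : V -> W) w v df dg : dderiv f w v df ->
  dderiv g w v dg -> dderiv (fun w => f w + g w) w v (df + dg).
Proof.
move=> [? <-] [? <-]; split; first exact: differentiableD.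
by rewrite deriveD//; exact: diff_derivable.
Qed.

Lemma dderivN V W (f : V -> W) w v df : dderiv f w v df ->
  dderiv (fun w => - f w) w v (- df).
Proof.
move=> [? <-]; split; first exact: differentiableN.
by rewrite deriveN//; exact: diff_derivable.
Qed.

Lemma dderivB V W (f g : V -> W) w v df dg : dderiv f w v df ->
  dderiv g w v dg -> dderiv (fun w => f w - g w) w v (df - dg).
Proof. by move=> ? ?; apply: dderivD => //; exact: dderivN. Qed.

(** The common source of the product rules for [dot4], for scaling and for real products. *)
Lemma dderiv_bilin U V W V' (B : {bilinear U -> V -> W})
  (Bc : continuous (fun p => B p.1 p.2)) (f : V' -> U) (g : V' -> V) w v df dg :
  dderiv f w v df -> dderiv g w v dg ->
  dderiv (fun w => B (f w) (g w)) w v (B df (g w) + B (f w) dg).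
Proof.
move=> [f' <-] [g' <-].
pose b p := B p.1 p.2; pose h y := (f y, g y).
have dh : differentiable h w by exact: differentiable_pair.
have db : differentiable b (h w) by exact: differentiable_bilin.
have dbh : differentiable (b \o h) w by exact: differentiable_comp.
split=> //; rewrite -[LHS]/('D_v (b \o h) w) deriveE// diff_comp//=.
by rewrite diff_pair// diff_bilin//= addrC !deriveE.
Qed.

Lemma dderiv_comp U V W (g : U -> V) (f : V -> W) w v dg df :
  dderiv g w v dg -> dderiv f (g w) dg df -> dderiv (f \o g) w v df.
Proof.
move=> [g' <-] [f' <-]; have fg' := differentiable_comp g' f'.
by split=> //; rewrite !deriveE// diff_comp.
Qed.

Lemma dderiv_lin V W V' (L : {linear V -> W}) (Lc : continuous L) (f : V' -> V)
   w v df : dderiv f w v df -> dderiv (fun w => L (f w)) w v (L df).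
Proof.
move=> df_; apply: (@dderiv_comp _ _ _ _ L) df_ _.
have dL : differentiable L (f w) by exact: linear_differentiable.
by split=> //; rewrite deriveE// diff_lin.
Qed.

End DirectionalDerivative.

(** * Bilinear operations and their product rules *)

Section Bilinear.
Variable R : realType.

Lemma dotC n (x y : 'rV[R]_n) : dot x y = dot y x.
Proof. by apply: eq_bigr => i _; rewrite mulrC. Qed.

Lemma dotPl n a (x y z : 'rV[R]_n) : dot (a *: x + y) z = a * dot x z + dot y z.
Proof.
rewrite /dot mulr_sumr -big_split /=; apply: eq_bigr => i _.
by rewrite !mxE mulrDl mulrA.
Qed.

Lemma dot4C (p q : R4 R) : dot4 p q = dot4 q p.
Proof. by rewrite /dot4 dotC mulrC. Qed.

Lemma dot4Pl a (p q r : R4 R) : dot4 (a *: p + q) r = a * dot4 p r + dot4 q r.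
Proof.
rewrite /dot4 -[(a *: p + q).1]/(a *: p.1 + q.1) dotPl.
rewrite -[X in _ + X * _]/(a * p.2 + q.2); ring.
Qed.

Lemma dot4_is_bilinear :
  bilinear_for
    (GRing.Scale.Law.clone _ _ *:%R _) (GRing.Scale.Law.clone _ _ *:%R _)
    (@dot4 R : R4 R -> R4 R -> R^o).
Proof.
split=> [u'|u] a x y /=; first by rewrite dot4Pl.
by rewrite dot4C dot4Pl !(dot4C u).
Qed.
HB.instance Definition _ := bilinear_isBilinear.Build R (R4 R) (R4 R) R^o _ _
  (@dot4 R : R4 R -> R4 R -> R^o) dot4_is_bilinear.

Lemma dot4_continuous : continuous (fun p : R4 R * R4 R => dot4 p.1 p.2 : R^o).
Proof.
move=> p.
have f1 : {for p, continuous (fst : R4 R * R4 R -> R4 R)} by exact: cvg_fst.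
have f2 : {for p, continuous (snd : R4 R * R4 R -> R4 R)} by exact: cvg_snd.
have g1 q : {for q, continuous (fst : R4 R -> 'rV[R]_3)} by exact: cvg_fst.
have g2 q : {for q, continuous (snd : R4 R -> R^o)} by exact: cvg_snd.
have c i (q : 'rV[R]_3) : {for q, continuous (fun y : 'rV[R]_3 => y 0 i : R^o)}.
  exact: coord_continuous.
rewrite /dot4 /dot /continuous_at.
under eq_fun do rewrite !big_ord_recl big_ord0 addr0.
have cM (f g : R4 R * R4 R -> R^o) : {for p, continuous f} ->
    {for p, continuous g} -> {for p, continuous (fun q => f q * g q : R^o)}.
  by move=> hf hg; apply: cvgM.
have cD (f g : R4 R * R4 R -> R^o) : {for p, continuous f} ->
    {for p, continuous g} -> {for p, continuous (fun q => f q + g q : R^o)}.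
  by move=> hf hg; apply: cvgD.
have cc i : {for p, continuous (fun q : R4 R * R4 R => q.1.1 0 i * q.2.1 0 i : R^o)}.
  apply: cM.
    exact: (continuous_comp (continuous_comp f1 (g1 _)) (c i _)).
  exact: (continuous_comp (continuous_comp f2 (g1 _)) (c i _)).
have c4 : {for p, continuous (fun q : R4 R * R4 R => q.1.2 * q.2.2 : R^o)}.
  apply: cM; first exact: (continuous_comp f1 (g2 _)).
  exact: (continuous_comp f2 (g2 _)).
have := cD _ _ (cD _ _ (cc ord0) (cD _ _ (cc (lift ord0 ord0)) (cc (lift ord0 (lift ord0 ord0))))) c4.
by rewrite /prop_for /continuous_at /= !big_ord_recl big_ord0 addr0.
Qed.

(** Scaling, with the scalars viewed as the normed module [R^o], so that it is a bilinear map to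
    which [dderiv_bilin] applies. *)
Definition scl (W : normedModType R) (k : R^o) (v : W) : W := k *: v.

Lemma scl_is_bilinear (W : normedModType R) :
  bilinear_for
    (GRing.Scale.Law.clone _ _ *:%R _) (GRing.Scale.Law.clone _ _ *:%R _)
    (@scl W).
Proof.
split=> [u'|u] a x y /=; rewrite /scl.
  by rewrite scalerDl scalerA.
by rewrite scalerDr !scalerA mulrC.
Qed.
HB.instance Definition _ (W : normedModType R) :=
  bilinear_isBilinear.Build R R^o W W _ _ (@scl W) (@scl_is_bilinear W).

Lemma scl_continuous (W : normedModType R) :
  continuous (fun p : R^o * W => scl p.1 p.2).
Proof. exact: scale_continuous. Qed.

Variable V : normedModType R.
Implicit Types (w v : V).

Lemma dderiv_dot4 (f g : V -> R4 R) w v df dg :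
  dderiv f w v df -> dderiv g w v dg ->
  dderiv (fun w => dot4 (f w) (g w) : R^o) w v (dot4 df (g w) + dot4 (f w) dg).
Proof. by move=> hf hg; exact: dderiv_bilin dot4_continuous _ _ _ _ _ _ hf hg. Qed.

Lemma dderivZ (W : normedModType R) (k : V -> R^o) (g : V -> W) w v dk dg :
  dderiv k w v dk -> dderiv g w v dg ->
  dderiv (fun w => k w *: g w) w v (dk *: g w + k w *: dg).
Proof.
by move=> hf hg; exact: dderiv_bilin (@scl_continuous W) _ _ _ _ _ _ hf hg.
Qed.

Lemma dderivM (k g : V -> R^o) w v (dk dg : R^o) :
  dderiv k w v dk -> dderiv g w v dg ->
  dderiv (fun w => k w * g w : R^o) w v (dk * g w + k w * dg).
Proof. exact: dderivZ. Qed.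

Lemma dderiv_real (phi : R -> R) (f : V -> R^o) w v (df c : R^o) :
  is_derive (f w) 1 (phi : R^o -> R^o) c -> dderiv f w v df ->
  dderiv (fun w => phi (f w) : R^o) w v (df * c).
Proof.
move=> [phi' <-] hf; apply: (@dderiv_comp _ _ _ _ f (phi : R^o -> R^o)) hf _.
have dphi : differentiable (phi : R^o -> R^o) (f w) by exact/derivable1_diffP.
split=> //; rewrite !deriveE// -[X in 'd _ _ X]mulr1.
by rewrite -[df * 1]/(df *: (1:R^o)) linearZ.
Qed.

Lemma dderivV (f : V -> R^o) w v (df : R^o) : f w != 0 ->
  dderiv f w v df ->
  dderiv (fun w => (f w)^-1 : R^o) w v (- df / f w ^+ 2).
Proof.
move=> f0 hf; apply: dderiv_eq.
  apply: (dderiv_real (phi := fun x => x^-1) (c := - (f w) ^- 2)) hf.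
  have := @is_deriveV _ id (f w) 1 1 f0 (is_derive_id _ _).
  by rewrite /GRing.scale /= mulr1.
by rewrite mulrN mulNr.
Qed.

Lemma dderiv_sqrt (f : V -> R^o) w v (df : R^o) : 0 < f w ->
  dderiv f w v df ->
  dderiv (fun w => Num.sqrt (f w) : R^o) w v (df / (2 * Num.sqrt (f w))).
Proof.
move=> f0 hf; apply: dderiv_real hf.
exact: is_derive1_sqrt.
Qed.

Lemma dderiv_atan (f : V -> R^o) w v (df : R^o) :
  dderiv f w v df ->
  dderiv (fun w => atan (f w) : R^o) w v (df / (1 + f w ^+ 2)).
Proof. by move=> hf; apply: dderiv_real hf; exact: is_derive1_atan. Qed.

End Bilinear.

(** * Smooth functions *)

Section Ck.
Variable R : realType.
Implicit Types U V W : normedModType R.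

Lemma derive_rV n W (f : 'rV[R]_n -> W) w v : differentiable f w ->
  'D_v f w = \sum_i v 0 i *: 'D_(delta_mx 0 i) f w.
Proof.
move=> df; rewrite deriveE// {1}[v]row_sum_delta linear_sum.
by apply: eq_bigr => i _; rewrite linearZ/= deriveE.
Qed.

(** Finite order makes induction possible: the partial derivatives of a product or a composite are
    again built from products and composites, of order one less. The recursion peels the derivative
    applied first, which is the last letter of the word in [smooth_on]. *)
Fixpoint Ck n W (D : set 'rV[R]_n) k (f : 'rV[R]_n -> W) : Prop :=
  (forall w, D w -> differentiable f w) /\
  (if k is k'.+1 then forall i, Ck D k' ('D_(delta_mx 0 i) f) else True).

Lemma Ck_diff n W (D : set 'rV[R]_n) k (f : 'rV[R]_n -> W) w :
  Ck D k f -> D w -> differentiable f w.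
Proof. by case: k => [|k] [+ _]; apply. Qed.

Lemma smooth_onP n W (D : set 'rV[R]_n) (f : 'rV[R]_n -> W) :
  smooth_on D f <-> forall k, Ck D k f.
Proof.
split.
  move=> sf k; elim: k f sf => [|k IH] f sf; split=> //; try exact: (sf [::]).
  move=> i; apply: IH => s w Dw; have := sf (rcons s i) w Dw.
  by rewrite foldr_rcons.
move=> Cf s; elim/last_ind: s f Cf => [|s i IH] f Cf w Dw.
  exact: (Ck_diff (Cf 0%N)).
by rewrite foldr_rcons; apply: IH => // k; have [_] := Cf k.+1; apply.
Qed.

Variable n : nat.
Variable D : set 'rV[R]_n.
Hypothesis oD : open D.

Lemma eq_on_derive W (f g : 'rV[R]_n -> W) w v :
  (forall w, D w -> f w = g w) -> D w -> 'D_v f w = 'D_v g w.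
Proof.
move=> fg Dw; apply: near_eq_derive.
by apply: filterS (open_nbhs_nbhs (conj oD Dw)).
Qed.

Lemma Ck_ext W k (f g : 'rV[R]_n -> W) : (forall w, D w -> f w = g w) ->
  Ck D k f -> Ck D k g.
Proof.
elim: k f g => [|k IH] f g fg [df Cf]; split=> //; try by
  move=> w Dw; apply: near_eq_differentiable (df w Dw);
  apply: filterS (open_nbhs_nbhs (conj oD Dw)).
by move=> i; apply: IH (Cf i) => w Dw; exact: eq_on_derive.
Qed.

Lemma CkW W k (f : 'rV[R]_n -> W) : Ck D k.+1 f -> Ck D k f.
Proof.
elim: k f => [|k IH] f [df Cf]; split=> //.
by move=> i; apply: IH.
Qed.

Lemma Ck_intro W k (f : 'rV[R]_n -> W) df : 
  (forall w, D w -> differentiable f w) ->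
  (forall w i, D w -> 'D_(delta_mx 0 i) f w = df i w) ->
  (forall i, Ck D k (df i)) -> Ck D k.+1 f.
Proof.
move=> f' fE Cdf; split=> // i; apply: Ck_ext (Cdf i) => w Dw.
by rewrite fE.
Qed.

Lemma Ck_cst W k (c : W) : Ck D k (fun=> c).
Proof.
elim: k c => [|k IH] c; first by split=> // w _; exact: differentiable_cst.
apply: (@Ck_intro _ _ _ (fun _ _ => 0)) => // w i _.
exact: derive_cst.
Qed.

Lemma CkD W k (f g : 'rV[R]_n -> W) : Ck D k f -> Ck D k g ->
  Ck D k (fun w => f w + g w).
Proof.
elim: k f g => [|k IH] f g Cf Cg.
  split=> // w Dw.
  exact: differentiableD (Ck_diff Cf Dw) (Ck_diff Cg Dw).
apply: (@Ck_intro _ _ _ (fun i w => 'D_(delta_mx 0 i) f w + 'D_(delta_mx 0 i) g w)).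
- by move=> w Dw; exact: differentiableD (Ck_diff Cf Dw) (Ck_diff Cg Dw).
- move=> w i Dw; apply: dderiv_val.
  by apply: dderivD; apply: dderiv_diff; [apply: Ck_diff Cf Dw|apply: Ck_diff Cg Dw].
- by move=> i; apply: IH; [case: Cf => _; apply|case: Cg => _; apply].
Qed.

Lemma Ck_sum W k m (f : 'I_m -> 'rV[R]_n -> W) : (forall j, Ck D k (f j)) ->
  Ck D k (fun w => \sum_j f j w).
Proof.
elim: m f => [|m IH] f Cf.
  by apply: Ck_ext (Ck_cst k 0) => w _; rewrite big_ord0.
apply: (@Ck_ext _ _ (fun w => f ord0 w + \sum_j f (lift ord0 j) w)).
  by move=> w _; rewrite big_ord_recl.
by apply: CkD => //; apply: IH.
Qed.

Lemma Ck_bilin U V W k (B : {bilinear U -> V -> W})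
  (Bc : continuous (fun p => B p.1 p.2)) (f : 'rV[R]_n -> U) (g : 'rV[R]_n -> V) :
  Ck D k f -> Ck D k g -> Ck D k (fun w => B (f w) (g w)).
Proof.
have dB (f' : 'rV[R]_n -> U) (g' : 'rV[R]_n -> V) w v :
    differentiable f' w -> differentiable g' w ->
    dderiv (fun w => B (f' w) (g' w)) w v (B ('D_v f' w) (g' w) + B (f' w) ('D_v g' w)).
  by move=> df dg; apply: dderiv_bilin.
elim: k f g => [|k IH] f g Cf Cg.
  by split=> // w Dw; apply: (dB _ _ w 0 (Ck_diff Cf Dw) (Ck_diff Cg Dw)).1.
apply: (@Ck_intro _ _ _ (fun i w => B ('D_(delta_mx 0 i) f w) (g w) + B (f w) ('D_(delta_mx 0 i) g w))).
- by move=> w Dw; apply: (dB _ _ w 0 (Ck_diff Cf Dw) (Ck_diff Cg Dw)).1.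
- by move=> w i Dw; apply: (dB _ _ w _ (Ck_diff Cf Dw) (Ck_diff Cg Dw)).2.
- move=> i; apply: CkD; apply: IH; try exact: CkW.
    by case: Cf => _; apply.
  by case: Cg => _; apply.
Qed.

Lemma Ck_lin V W k (L : {linear V -> W}) (Lc : continuous L) (f : 'rV[R]_n -> V) :
  Ck D k f -> Ck D k (fun w => L (f w)).
Proof.
have dL (f' : 'rV[R]_n -> V) w v : differentiable f' w ->
    dderiv (fun w => L (f' w)) w v (L ('D_v f' w)).
  by move=> df; apply: dderiv_lin.
elim: k f => [|k IH] f Cf.
  by split=> // w Dw; apply: (dL _ w 0 (Ck_diff Cf Dw)).1.
apply: (@Ck_intro _ _ _ (fun i w => L ('D_(delta_mx 0 i) f w))).
- by move=> w Dw; apply: (dL _ w 0 (Ck_diff Cf Dw)).1.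
- by move=> w i Dw; apply: (dL _ w _ (Ck_diff Cf Dw)).2.
- by move=> i; apply: IH; case: Cf => _; apply.
Qed.

Lemma Ck_coord m k (g : 'rV[R]_n -> 'rV[R]_m) :
  Ck D k g <-> forall j, Ck D k (fun w => g w 0 j : R^o).
Proof.
split=> [Cg j|Cg].
  have lin : linear (fun y : 'rV[R]_m => y 0 j : R^o).
    by move=> a x y; rewrite !mxE.
  pose lM := GRing.isLinear.Build _ _ _ _ _ lin.
  pose L : {linear _ -> _} := HB.pack (fun y : 'rV[R]_m => y 0 j : R^o) lM.
  by apply: (@Ck_lin _ _ _ L) Cg => y; exact: coord_continuous.
apply: (@Ck_ext _ _ (fun w => \sum_j scl (g w 0 j) (delta_mx 0 j : 'rV[R]_m))).
  by move=> w _; rewrite [in RHS](row_sum_delta (g w)).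
apply: Ck_sum => j.
by apply: (Ck_bilin (@scl_continuous _ _)) => //; exact: Ck_cst.
Qed.

End Ck.

Section CkComp.
Variable R : realType.
Variables (n m : nat) (D : set 'rV[R]_n) (E : set 'rV[R]_m).
Hypotheses (oD : open D) (oE : open E).

Lemma Ck_comp (W : normedModType R) k (f : 'rV[R]_n -> W) (g : 'rV[R]_m -> 'rV[R]_n) :
  (forall w, E w -> D (g w)) -> Ck E k g -> Ck D k f -> Ck E k (f \o g).
Proof.
move=> ED.
have dfg j (f' : 'rV[R]_n -> W) w v : Ck E j g -> Ck D j f' -> E w -> dderiv (f' \o g) w v
    (\sum_i 'D_v g w 0 i *: ('D_(delta_mx 0 i) f' (g w))).
  move=> Cg Cf Ew; have dg := Ck_diff Cg Ew; have df := Ck_diff Cf (ED _ Ew).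
  apply: dderiv_comp (dderiv_diff v dg) _; split=> //.
  exact: derive_rV.
elim: k f => [|k IH] f Cg Cf.
  by split=> // w Ew; apply: (dfg _ _ w 0 Cg Cf Ew).1.
have [_ Cg'] := Cg; have [_ Cf'] := Cf.
apply: (Ck_intro oE (df := fun j w =>
  \sum_i 'D_(delta_mx 0 j) g w 0 i *: ('D_(delta_mx 0 i) f (g w)))).
- by move=> w Ew; apply: (dfg _ _ w 0 Cg Cf Ew).1.
- by move=> w j Ew; apply: (dfg _ _ w _ Cg Cf Ew).2.
move=> j; apply: (Ck_sum oE) => i.
apply: (Ck_bilin oE (@scl_continuous R W)).
  by have /(Ck_coord oE) := Cg' j; apply.
apply: IH (Cf' i); exact: CkW Cg.
Qed.

End CkComp.

Section Smooth.
Variable R : realType.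
Variables (n : nat) (D : set 'rV[R]_n).
Hypothesis oD : open D.
Implicit Types W : normedModType R.

Lemma smooth_diff W (f : 'rV[R]_n -> W) w : smooth_on D f -> D w ->
  differentiable f w.
Proof. by move=> sf Dw; exact: (sf [::]). Qed.

Lemma smooth_derive W (f : 'rV[R]_n -> W) i : smooth_on D f ->
  smooth_on D ('D_(delta_mx 0 i) f).
Proof. by move=> /smooth_onP Cf; apply/smooth_onP => k; case: (Cf k.+1) => _; apply. Qed.

Lemma smooth_ext W (f g : 'rV[R]_n -> W) : (forall w, D w -> f w = g w) ->
  smooth_on D f -> smooth_on D g.
Proof. by move=> fg /smooth_onP Cf; apply/smooth_onP => k; apply: Ck_ext (Cf k). Qed.

Lemma smooth_cst W (c : W) : smooth_on D (fun=> c).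
Proof. by apply/smooth_onP => k; exact: Ck_cst. Qed.

Lemma smoothD W (f g : 'rV[R]_n -> W) : smooth_on D f -> smooth_on D g ->
  smooth_on D (fun w => f w + g w).
Proof.
by move=> /smooth_onP Cf /smooth_onP Cg; apply/smooth_onP => k; exact: CkD.
Qed.

Lemma smooth_sum W m (f : 'I_m -> 'rV[R]_n -> W) :
  (forall j, smooth_on D (f j)) -> smooth_on D (fun w => \sum_j f j w).
Proof.
move=> sf; apply/smooth_onP => k; apply: Ck_sum => // j.
by have /smooth_onP := sf j; apply.
Qed.

Lemma smoothZ W (k : 'rV[R]_n -> R^o) (g : 'rV[R]_n -> W) :
  smooth_on D k -> smooth_on D g -> smooth_on D (fun w => k w *: g w).
Proof.
move=> /smooth_onP Cf /smooth_onP Cg; apply/smooth_onP => j.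
exact: (Ck_bilin oD (@scl_continuous R W)).
Qed.

Lemma smoothM (f g : 'rV[R]_n -> R^o) :
  smooth_on D f -> smooth_on D g -> smooth_on D (fun w => f w * g w : R^o).
Proof. exact: smoothZ. Qed.

Lemma smoothN W (f : 'rV[R]_n -> W) :
  smooth_on D f -> smooth_on D (fun w => - f w).
Proof.
move=> sf; apply: (@smooth_ext _ (fun w => (-1 : R^o) *: f w)).
  by move=> w _; rewrite scaleN1r.
by apply: smoothZ => //; exact: smooth_cst.
Qed.

Lemma smoothB W (f g : 'rV[R]_n -> W) : smooth_on D f -> smooth_on D g ->
  smooth_on D (fun w => f w - g w).
Proof. by move=> sf sg; apply: smoothD => //; exact: smoothN. Qed.

Lemma smooth_dot4 (f g : 'rV[R]_n -> R4 R) : smooth_on D f -> smooth_on D g ->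
  smooth_on D (fun w => dot4 (f w) (g w) : R^o).
Proof.
move=> /smooth_onP Cf /smooth_onP Cg; apply/smooth_onP => j.
exact: (Ck_bilin oD (@dot4_continuous R)).
Qed.

Lemma smooth_coord m (g : 'rV[R]_n -> 'rV[R]_m) :
  smooth_on D g <-> forall j, smooth_on D (fun w => g w 0 j : R^o).
Proof.
split=> [/smooth_onP Cg j|Cg].
  by apply/smooth_onP => k; have /(Ck_coord oD) := Cg k; apply.
apply/smooth_onP => k; apply/(Ck_coord oD) => j.
by have /smooth_onP := Cg j; apply.
Qed.

Lemma smooth_dir W (f : 'rV[R]_n -> W) (b : 'rV[R]_n -> 'rV[R]_n) :
  smooth_on D f -> smooth_on D b -> smooth_on D (fun w => 'D_(b w) f w).
Proof.
move=> sf sb.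
apply: (@smooth_ext _ (fun w => \sum_i (b w 0 i : R^o) *: 'D_(delta_mx 0 i) f w)).
  by move=> w Dw; rewrite derive_rV//; exact: smooth_diff.
apply: smooth_sum => i; apply: smoothZ; last exact: smooth_derive.
by have /smooth_coord := sb; apply.
Qed.

(* The hypothesis on [psi \o f] lets the derivative of [phi] involve [phi]. *)
Lemma smooth_real (phi psi : R -> R) (f : 'rV[R]_n -> R^o) :
  (forall w, D w -> is_derive (f w) 1 (phi : R^o -> R^o) (psi (f w))) ->
  (forall k, Ck D k (fun w => phi (f w) : R^o) -> Ck D k (fun w => psi (f w) : R^o)) ->
  smooth_on D f -> smooth_on D (fun w => phi (f w) : R^o).
Proof.
move=> dphi Cpsi /smooth_onP Cf; apply/smooth_onP.
have d w v : D w -> dderiv (fun w => phi (f w) : R^o) w v ('D_v f w * psi (f w)).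
  move=> Dw; apply: dderiv_real; first exact: dphi.
  exact: (dderiv_diff _ (Ck_diff (Cf 0%N) Dw)).
elim=> [|k IH]; first by split=> // w Dw; apply: (d w 0 Dw).1.
apply: (Ck_intro oD (df := fun i w => 'D_(delta_mx 0 i) f w * psi (f w))).
- by move=> w Dw; apply: (d w 0 Dw).1.
- by move=> w i Dw; apply: (d w _ Dw).2.
move=> i; apply: (Ck_bilin oD (@scl_continuous R R^o)); last exact: Cpsi.
by have [_] := Cf k.+1; apply.
Qed.

Lemma smoothV (f : 'rV[R]_n -> R^o) : (forall w, D w -> f w != 0) ->
  smooth_on D f -> smooth_on D (fun w => (f w)^-1 : R^o).
Proof.
move=> f0; apply: (@smooth_real (fun x => x^-1) (fun x => - x ^- 2)).
  move=> w Dw; have := @is_deriveV _ id (f w) 1 1 (f0 w Dw) (is_derive_id _ _).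
  by rewrite /GRing.scale /= mulr1.
move=> k Ck1; apply: (Ck_ext oD (f := fun w => scl (scl (-1) (f w)^-1) ((f w)^-1 : R^o))).
  by move=> w _; rewrite /scl /GRing.scale /= mulN1r mulNr -expr2 exprVn.
apply: (Ck_bilin oD (@scl_continuous R R^o)) => //.
by apply: (Ck_bilin oD (@scl_continuous R R^o)) => //; exact: Ck_cst.
Qed.

Lemma smooth_div (f g : 'rV[R]_n -> R^o) : (forall w, D w -> g w != 0) ->
  smooth_on D f -> smooth_on D g -> smooth_on D (fun w => f w / g w : R^o).
Proof. by move=> g0 sf sg; apply: smoothM => //; exact: smoothV. Qed.

(** The derivative of [1 / sqrt] is a multiple of its own cube, so [smooth_real] applies to it; the
    square root is then [f] times this inverse. *)
Lemma smooth_sqrt (f : 'rV[R]_n -> R^o) : (forall w, D w -> 0 < f w) ->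
  smooth_on D f -> smooth_on D (fun w => Num.sqrt (f w) : R^o).
Proof.
move=> f0 sf; pose q w : R^o := Num.sqrt (f w).
have : smooth_on D (fun w => (Num.sqrt (f w))^-1 : R^o).
  apply: (@smooth_real (fun x => (Num.sqrt x)^-1)
    (fun x => - (1/2) * (Num.sqrt x)^-1 ^+ 3)) => //.
    move=> w Dw; have s0 : Num.sqrt (f w) != 0 by rewrite gt_eqF// sqrtr_gt0 f0.
    have := is_deriveV s0 (is_derive1_sqrt (f0 w Dw)).
    move=> h; apply: is_derive_eq h _.
    by rewrite /GRing.scale /=; field.
  move=> k C1; apply: (Ck_ext oD (f := fun w => scl (- (1/2) : R^o) (scl ((Num.sqrt (f w))^-1)
    (scl (Num.sqrt (f w))^-1 ((Num.sqrt (f w))^-1 : R^o))))).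
    by move=> w _; rewrite /scl /GRing.scale /= !exprS expr0 mulr1.
  do 3! (apply: (Ck_bilin oD (@scl_continuous R R^o)) => //; try exact: Ck_cst).
move=> s1; apply: (@smooth_ext _ (fun w => f w * (Num.sqrt (f w))^-1 : R^o)).
  move=> w Dw; rewrite -{1}(sqr_sqrtr (ltW (f0 w Dw))) expr2 mulfK//.
  by rewrite gt_eqF// sqrtr_gt0 f0.
exact: smoothM.
Qed.

Lemma smooth_atan (f : 'rV[R]_n -> R^o) :
  smooth_on D f -> smooth_on D (fun w => atan (f w) : R^o).
Proof.
move=> sf; apply: (@smooth_real atan (fun x => (1 + x ^+ 2)^-1)) => //.
move=> k _; have : smooth_on D (fun w => (1 + f w ^+ 2)^-1 : R^o).
  apply: smoothV; first by move=> w _; rewrite gt_eqF// ltr_pwDl// sqr_ge0.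
  apply: smoothD; first exact: smooth_cst.
  by apply: smoothM.
by move=> /smooth_onP.
Qed.

Lemma smooth_sub W (E : set 'rV[R]_n) (f : 'rV[R]_n -> W) : E `<=` D ->
  smooth_on D f -> smooth_on E f.
Proof. by move=> ED sf s w Ew; apply: sf; exact: ED. Qed.

Lemma smooth_comp W m (E : set 'rV[R]_m) (f : 'rV[R]_n -> W)
    (g : 'rV[R]_m -> 'rV[R]_n) : open E -> (forall w, E w -> D (g w)) ->
  smooth_on E g -> smooth_on D f -> smooth_on E (f \o g).
Proof.
move=> oE ED /smooth_onP Cg /smooth_onP Cf; apply/smooth_onP => k.
by apply: (Ck_comp oE ED).
Qed.

Lemma smooth_id : smooth_on D (@id 'rV[R]_n).
Proof.
apply/smooth_onP; case=> [|k].
  by split=> // w _; exact: (@ex_diff _ _ _ _ _ _ _ (is_diff_id w)).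
apply: (Ck_intro oD (df := fun i _ => delta_mx 0 i)).
- by move=> w _; exact: (@ex_diff _ _ _ _ _ _ _ (is_diff_id w)).
- by move=> w i _; exact: derive_id.
- by move=> i; exact: Ck_cst.
Qed.

End Smooth.

(** * Symmetry of second derivatives *)

Section MeanValue.
Variable R : realType.

Lemma dderiv_line (V : normedModType R) (x v : V) (t : R^o) :
  dderiv (fun t : R^o => x + t *: v) t 1 v.
Proof.
apply: dderiv_eq.
  apply: dderivD (dderiv_cst _ _ _) _.
  apply: (dderivZ (k := id) (g := fun=> v)) (dderiv_cst _ _ _).
  by split; [exact: (@ex_diff _ _ _ _ _ _ _ (is_diff_id t))|exact: derive_id].
by rewrite scale1r scaler0 addr0 add0r.
Qed.

Lemma dderiv_is_derive (f : R^o -> R^o) (t d : R^o) :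
  dderiv f t 1 d -> is_derive t 1 (f : R -> R) d.
Proof. by move=> [df dfE]; split => //; exact/diff_derivable. Qed.

Lemma mean_value (V : normedModType R) (f : V -> R^o) (x v : V) (h : R) : 0 <= h ->
  (forall t, 0 <= t <= h -> differentiable f (x + t *: v)) ->
  exists2 t, 0 <= t <= h & f (x + h *: v) - f x = h * 'D_v f (x + t *: v).
Proof.
move=> h0 df.
have d t : 0 <= t <= h ->
    is_derive t 1 (fun t : R => f (x + t *: v) : R) ('D_v f (x + t *: v)).
  move=> th; apply: dderiv_is_derive.
  by apply: (dderiv_comp (dderiv_line x v t)); apply: dderiv_diff; exact: df.
have [||c] := @MVT_segment R (fun t => f (x + t *: v)) (fun t => 'D_v f (x + t *: v)) 0 h h0.
- by move=> t; rewrite in_itv /= => /andP[t0 th]; apply: d; rewrite !ltW.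
- apply: derivable_within_continuous => t; rewrite in_itv /= => th.
  by have [] := d t th.
rewrite in_itv /= => ch; rewrite scale0r addr0 subr0 => E.
by exists c => //; rewrite E mulrC.
Qed.

Variables (n : nat) (D : set 'rV[R]_n).
Hypothesis oD : open D.

(** Mean value theorem twice: along [u] for the increment [g] of [f] in the direction [v], then
    along [v] for ['D_u f]. *)
Lemma double_difference (f : 'rV[R]_n -> R^o) (w u v : 'rV[R]_n) (h : R) : 0 <= h ->
  (forall s t, 0 <= s <= h -> 0 <= t <= h -> D (w + s *: u + t *: v)) ->
  (forall w, D w -> differentiable f w) ->
  (forall w, D w -> differentiable ('D_u f) w) ->
  exists s t, [/\ 0 <= s <= h, 0 <= t <= h &
    f (w + h *: u + h *: v) - f (w + h *: u) - (f (w + h *: v) - f w) =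
    h * (h * 'D_v ('D_u f) (w + s *: u + t *: v))].
Proof.
move=> h0 wD df dduf.
have hh : 0 <= h <= h by rewrite h0 lexx.
have h00 : 0 <= (0 : R) <= h by rewrite lexx h0.
pose g w : R^o := f (w + h *: v) - f w.
have dadd (f' : 'rV[R]_n -> R^o) y z c : differentiable f' (y + c) -> dderiv (fun y => f' (y + c)) y z ('D_z f' (y + c)).
  move=> df'; apply: (dderiv_comp (g := fun y => y + c) (dg := z)).
    apply: dderiv_eq (dderivD _ (dderiv_cst _ _ _)) _; last exact: addr0.
    by split; [exact: (@ex_diff _ _ _ _ _ _ _ (is_diff_id _))|exact: derive_id].
  exact: dderiv_diff.
have dg s z : 0 <= s <= h -> dderiv g (w + s *: u) z
    ('D_z f (w + s *: u + h *: v) - 'D_z f (w + s *: u)).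
  move=> sh; apply: dderivB.
    by apply: dadd; apply: df; exact: wD.
  by apply: dderiv_diff; apply: df; have := wD s 0 sh h00; rewrite scale0r addr0.
have [t th|s sh E] := @mean_value _ g w u h h0; first exact: (dg t 0 th).1.
have [t th|t th E2] := @mean_value _ ('D_u f) (w + s *: u) v h h0.
  by apply: dduf; exact: wD.
exists s, t; split=> //.
have -> : f (w + h *: u + h *: v) - f (w + h *: u) - (f (w + h *: v) - f w) =
  g (w + h *: u) - g w by [].
by rewrite E (dg s u sh).2 E2.
Qed.

(** The second difference is symmetric in [u] and [v], so the two mixed derivatives agree at two
    nearby points; continuity brings both points to [w]. *)
Lemma schwarz_scalar (f : 'rV[R]_n -> R^o) (w u v : 'rV[R]_n) : D w ->
  (forall w, D w -> differentiable f w) ->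
  (forall w, D w -> differentiable ('D_u f) w) ->
  (forall w, D w -> differentiable ('D_v f) w) ->
  {for w, continuous ('D_v ('D_u f))} -> {for w, continuous ('D_u ('D_v f))} ->
  'D_v ('D_u f) w = 'D_u ('D_v f) w.
Proof.
move=> Dw df du dv cvu cuv; apply/eqP; rewrite -subr_eq0 -normr_le0.
apply/ler_addgt0Pl => e e0; rewrite addr0.
have e2 : 0 < e / 2 by rewrite divr_gt0.
have : \forall y \near w, [/\ D y, `|'D_v ('D_u f) w - 'D_v ('D_u f) y| < e / 2
   & `|'D_u ('D_v f) w - 'D_u ('D_v f) y| < e / 2].
  have hA : \forall y \near w, D y by exact: (open_nbhs_nbhs (conj oD Dw)).
  have hB : \forall y \near w, `|'D_v ('D_u f) w - 'D_v ('D_u f) y| < e / 2.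
    by move/cvgrPdist_lt : cvu; apply.
  have hC : \forall y \near w, `|'D_u ('D_v f) w - 'D_u ('D_v f) y| < e / 2.
    by move/cvgrPdist_lt : cuv; apply.
  by apply: filterS3 hA hB hC.
move=> /nbhs_ballP[r /= r0]; rewrite -ball_normE => rP.
(* Small enough for the parallelogram with sides [h *: u] and [h *: v] to stay in the ball of radius
   [r]; the summand 1 covers [u = v = 0]. *)
pose h := r / (2 * (`|u| + `|v| + 1)).
have c0 : 0 < `|u| + `|v| + 1 by rewrite ltr_wpDl// addr_ge0.
have h0 : 0 < h by rewrite divr_gt0// mulr_gt0.
have ball_uv (u' v' : 'rV[R]_n) : `|u'| + `|v'| = `|u| + `|v| ->
    forall s t, 0 <= s <= h -> 0 <= t <= h -> ball_ Num.norm w r (w + s *: u' + t *: v').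
  move=> uv s t /andP[s0 sh] /andP[t0 th].
  rewrite /ball_ /= opprD opprD !addrA subrr sub0r -opprD normrN.
  apply: (le_lt_trans (ler_normD _ _)); rewrite !normrZ !ger0_norm//.
  apply: (@le_lt_trans _ _ (h * (`|u'| + `|v'|))).
    by rewrite mulrDr lerD// ler_wpM2r.
  by rewrite uv /h mulrAC ltr_pdivrMr ?mulr_gt0// ltr_pM2l//; lra.
have [s [t [sh th E]]] : exists s t, [/\ 0 <= s <= h, 0 <= t <= h &
    f (w + h *: u + h *: v) - f (w + h *: u) - (f (w + h *: v) - f w) =
    h * (h * 'D_v ('D_u f) (w + s *: u + t *: v))].
  apply: double_difference => //; first exact: ltW.
  by move=> s t sh th; have [] := rP _ (ball_uv u v erefl s t sh th).
have [s' [t' [sh' th' E']]] : exists s t, [/\ 0 <= s <= h, 0 <= t <= h &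
    f (w + h *: v + h *: u) - f (w + h *: v) - (f (w + h *: u) - f w) =
    h * (h * 'D_u ('D_v f) (w + s *: v + t *: u))].
  apply: double_difference => //; first exact: ltW.
  by move=> s' t' sh' th'; have [] := rP _ (ball_uv v u (addrC _ _) s' t' sh' th').
have [_ dP _] := rP _ (ball_uv u v erefl s t sh th).
have [_ _ dQ] := rP _ (ball_uv v u (addrC _ _) s' t' sh' th').
move: E E' dP dQ.
move: ('D_v ('D_u f) (w + _ + _)) ('D_u ('D_v f) (w + _ + _)) => P Q E E'.
have -> : P = Q.
  apply: (mulfI (lt0r_neq0 h0)); apply: (mulfI (lt0r_neq0 h0)).
  have sw (p q r' s0 : R) : p - q - (r' - s0) = p - r' - (q - s0) by ring.
  by rewrite -E -E' (addrAC w (h *: v)); exact: sw.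
move: ('D_v _ w) ('D_u _ w) => A B dP dQ.
rewrite -(subrKA Q) (le_trans (ler_normD _ _))// -(distrC B).
by apply: ltW; rewrite (splitr e); exact: ltrD.
Qed.

Lemma schwarz (f : 'rV[R]_n -> R^o) i j w : smooth_on D f -> D w ->
  'D_(delta_mx 0 i) ('D_(delta_mx 0 j) f) w = 'D_(delta_mx 0 j) ('D_(delta_mx 0 i) f) w.
Proof.
move=> sf Dw; apply: schwarz_scalar => //.
- by move=> y Dy; exact: smooth_diff sf Dy.
- by move=> y Dy; exact: smooth_diff (smooth_derive j sf) Dy.
- by move=> y Dy; exact: smooth_diff (smooth_derive i sf) Dy.
- apply: differentiable_continuous.
  exact: smooth_diff (smooth_derive i (smooth_derive j sf)) Dw.
- apply: differentiable_continuous.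
  exact: smooth_diff (smooth_derive j (smooth_derive i sf)) Dw.
Qed.

Lemma dot4_eq0 (p : R4 R) : dot4 p p = 0 -> p = 0.
Proof.
case: p => p s; rewrite /dot4 /= => /eqP.
have p0 : 0 <= dot p p by apply: sumr_ge0 => i _; rewrite -expr2 sqr_ge0.
rewrite paddr_eq0 -?expr2 ?sqr_ge0// sqrf_eq0 psumr_eq0; last first.
  by move=> i _; rewrite -expr2 sqr_ge0.
move=> /andP[/allP pi0 /eqP ->]; congr (_, _); apply/rowP => i.
have := pi0 i (mem_index_enum i); rewrite /= -expr2 sqrf_eq0 => /eqP ->.
by rewrite mxE.
Qed.

Lemma dot4_ge0 (p : R4 R) : 0 <= dot4 p p.
Proof.
rewrite /dot4 -expr2 addr_ge0 ?sqr_ge0//.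
by apply: sumr_ge0 => i _; rewrite -expr2 sqr_ge0.
Qed.

Lemma dot4_gt0 (p : R4 R) : p != 0 -> 0 < dot4 p p.
Proof.
move=> p0; rewrite lt_def dot4_ge0 andbT; apply: contra p0 => /eqP p0.
by apply/eqP; exact: dot4_eq0.
Qed.

Lemma dot4_ext (p q : R4 R) : (forall c, dot4 p c = dot4 q c) -> p = q.
Proof.
move=> pq; apply/eqP; rewrite -subr_eq0; apply/eqP/dot4_eq0.
have := dot4Pl (-1) q p (p - q); rewrite scaleN1r (addrC _ p) => ->.
by rewrite pq mulN1r addNr.
Qed.

Lemma dderiv_dot4r (V : normedModType R) (f : V -> R4 R) (c : R4 R) w v :
  differentiable f w -> dderiv (fun w => dot4 (f w) c : R^o) w v (dot4 ('D_v f w) c).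
Proof.
move=> df; apply: dderiv_eq.
  exact: (dderiv_dot4 (dderiv_diff v df) (dderiv_cst c w v)).
by rewrite -[dot4 (f w) 0]/((@dot4 R : R4 R -> R4 R -> R^o) (f w) 0) linear0r addr0.
Qed.

(** Pairing with constant vectors commutes with differentiation and separates points, which reduces
    the claim to scalar functions. *)
Lemma schwarz4 (f : 'rV[R]_n -> R4 R) i j w : smooth_on D f -> D w ->
  'D_(delta_mx 0 i) ('D_(delta_mx 0 j) f) w = 'D_(delta_mx 0 j) ('D_(delta_mx 0 i) f) w.
Proof.
move=> sf Dw; apply: dot4_ext => c.
have E k l : dot4 ('D_(delta_mx 0 k) ('D_(delta_mx 0 l) f) w) c =
     'D_(delta_mx 0 k) ('D_(delta_mx 0 l) (fun w => dot4 (f w) c : R^o)) w.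
    rewrite -(dderiv_dot4r c (delta_mx 0 k) (smooth_diff (smooth_derive l sf) Dw)).2.
    apply: (eq_on_derive oD) => // y Dy.
    by rewrite -(dderiv_dot4r c (delta_mx 0 l) (smooth_diff sf Dy)).2.
have sc : smooth_on D (fun w => dot4 (f w) c : R^o).
    by apply: (smooth_dot4 oD sf); exact: smooth_cst.
exact: (etrans (E i j) (etrans (schwarz i j sc Dw) (esym (E j i)))).
Qed.

End MeanValue.

(** * The inverse function theorem *)

Section RowVectors.
Variable R : realType.

Lemma rV_norm_le n (x : 'rV[R]_n) c : 0 <= c -> (forall i, `|x 0 i| <= c) -> `|x| <= c.
Proof.
move=> c0 xc; rewrite /Num.Def.normr /= mx_normrE; apply: bigmax_le => //= -[i j] _ /=.
by rewrite ord1.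
Qed.

Lemma rV_norm_coord n (x : 'rV[R]_n) i : `|x 0 i| <= `|x|.
Proof. by rewrite {2}/Num.Def.normr /= mx_normrE; exact: (le_bigmax _ _ (0, i)). Qed.

(* A minimizer of [`|T x - x|] is a fixed point. *)
Lemma contraction_fixed n (A : set 'rV[R]_n) (T : 'rV[R]_n -> 'rV[R]_n) :
  compact A -> A !=set0 -> (forall x, A x -> A (T x)) ->
  (forall x, A x -> {for x, continuous T}) ->
  (forall x y, A x -> A y -> `|T x - T y| <= 2^-1 * `|x - y|) ->
  exists2 x, A x & T x = x.
Proof.
move=> cA A0 TA Tc TL.
have cT : {within A, continuous (fun x => `|T x - x| : R)}.
  apply/subspace_continuousP => x Ax; apply: cvg_within_filter.
  by apply: cvg_norm; apply: cvgB; [exact: Tc|exact: cvg_id].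
have [x /set_mem Ax xmin] := EVT_min_rV A0 cA cT.
exists x => //; apply/eqP; rewrite -subr_eq0 -normr_eq0; apply/negPn/negP => Tx0.
have := xmin (T x) (mem_set (TA x Ax)).
apply/negP; rewrite -ltNge (le_lt_trans (TL _ _ (TA x Ax) Ax))//.
have : 0 < `|T x - x| by rewrite lt_def Tx0 normr_ge0.
lra.
Qed.

Lemma compact_closed_ball_rV n (w : 'rV[R]_n) r : compact (closed_ball_ Num.norm w r).
Proof.
apply: bounded_closed_compact; last exact: closed_closed_ball_.
exists (`|w| + `|r|); split=> // M wrM y /= wy.
rewrite (le_trans _ (ltW wrM))// -[y](subKr w) (le_trans (ler_normB _ _))//.
by rewrite lerD2l (le_trans wy)// ler_norm.
Qed.

End RowVectors.

Section Expansion.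
Variables (R : realType) (V W : normedModType R).

Lemma differentiable_expansion (f : V -> W) (x : V) (e : R) : differentiable f x -> 0 < e ->
  \forall h \near (0 : V), `|f (h + x) - (f x + 'D_h f x)| <= e * `|h|.
Proof.
move=> df e0; have := diff_locally df => /eqaddoP /(_ e e0).
by apply: filterS => h; rewrite deriveE.
Qed.

Lemma expansion_differentiable (f : V -> W) (df : {linear V -> W}) (x : V) :
  continuous df ->
  (forall e : R, 0 < e -> \forall h \near (0 : V), `|f (h + x) - (f x + df h)| <= e * `|h|) ->
  differentiable f x /\ forall v, 'D_v f x = df v.
Proof.
move=> dfc H.
have fE : f \o shift x = cst (f x) + df +o_ 0 id.
  by apply/eqaddoP => e e0; exact: H.
have dE : 'd f x = df :> (V -> W) by apply: diff_unique.
have fdiff : differentiable f x by apply/diff_locallyP; rewrite dE.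
by split=> // v; rewrite deriveE// dE.
Qed.

End Expansion.

Section InverseFunction.
Variable R : realType.
Variable n : nat.
Variables (D : set 'rV[R]_n) (F : 'rV[R]_n -> 'rV[R]_n)
  (B : 'I_n -> 'rV[R]_n -> 'rV[R]_n).
Hypotheses (oD : open D) (sF : smooth_on D F) (sB : forall j, smooth_on D (B j)).
Hypothesis FB : forall w j, D w -> 'D_(B j w) F w = delta_mx 0 j.

Let L (w z : 'rV[R]_n) := \sum_j z 0 j *: B j w.

Let L_linear w : linear (L w).
Proof.
move=> a x y; rewrite /L scaler_sumr -big_split /=; apply: eq_bigr => j _.
by rewrite !mxE scalerDl scalerA.
Qed.

Let L_bound w : exists2 M, 0 < M & forall z, `|L w z| <= M * `|z|.
Proof.
exists (\sum_j `|B j w| + 1).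
  by rewrite ltr_wpDl// sumr_ge0.
move=> z; rewrite (le_trans (ler_norm_sum _ _ _))// mulrDl mulr_suml mul1r.
rewrite -[leLHS]addr0 lerD// ler_sum// => j _.
by rewrite normrZ mulrC ler_wpM2l// rV_norm_coord.
Qed.

Let L_right w z : D w -> 'D_(L w z) F w = z.
Proof.
move=> Dw; have dF := smooth_diff sF Dw.
rewrite deriveE// linear_sum /= [RHS]row_sum_delta; apply: eq_bigr => j _.
by rewrite linearZ /= -deriveE// FB.
Qed.

(** In equal dimensions a right inverse of the Jacobian is also a left inverse. *)
Let L_left w v : D w -> L w ('D_v F w) = v.
Proof.
move=> Dw; have dF := smooth_diff sF Dw.
pose Bm := \matrix_(i < n, j < n) B i w 0 j.
pose J := \matrix_(i < n, j < n) ('D_(delta_mx 0 i) F w) 0 j.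
have DE v' : 'D_v' F w = v' *m J.
  rewrite (derive_rV v' dF); apply/rowP => j; rewrite summxE !mxE.
  by apply: eq_bigr => i _; rewrite !mxE.
have LE z : L w z = z *m Bm.
  apply/rowP => j; rewrite summxE !mxE.
  by apply: eq_bigr => i _; rewrite !mxE.
have BJ : Bm *m J = 1%:M.
  apply/row_matrixP => i; rewrite row_mul -DE row1 -(FB i Dw); congr ('D_ _ F w).
  by apply/rowP => j; rewrite !mxE.
by rewrite LE DE -mulmxA (mulmx1C BJ) mulmx1.
Qed.

(** The map of the simplified Newton iteration, with the derivative frozen at [w0]; its own
    derivative vanishes at [w0]. *)
Let residual w0 w := w - L w0 (F w).

Let residual_smooth w0 : smooth_on D (residual w0).
Proof.
apply: smoothB => //; first exact: smooth_id.
apply: smooth_sum => // j; apply: smoothZ => //; last exact: smooth_cst.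
by move/(smooth_coord oD): sF; apply.
Qed.

Let residual_derive w0 w v : D w -> 'D_v (residual w0) w = v - L w0 ('D_v F w).
Proof.
move=> Dw; have dF := smooth_diff sF Dw.
pose lM := GRing.isLinear.Build _ _ _ _ _ (L_linear w0).
pose LL : {linear 'rV[R]_n -> 'rV[R]_n} := HB.pack (L w0) lM.
have Lc : continuous LL.
  apply/linear_bounded_continuous/bounded_funP => r.
  have [M M0 LM] := L_bound w0; exists (M * r) => x xr.
  by rewrite (le_trans (LM x))// ler_wpM2l// ltW.
apply: dderiv_val; apply: dderivB.
  by split; [exact: (@ex_diff _ _ _ _ _ _ _ (is_diff_id w))|exact: derive_id].
exact: (dderiv_lin Lc (dderiv_diff v dF)).
Qed.

Let residual_lipschitz w0 : D w0 -> exists2 r, 0 < r & forall x y,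
  `|w0 - x| <= r -> `|w0 - y| <= r -> [/\ D x, D y &
    `|residual w0 x - residual w0 y| <= 2^-1 * `|x - y|].
Proof.
(* Each coordinate of the increment is bounded by a sum of [n] terms of size [e * |x - y|], so this
   [e] gives the constant 1/2; [n.+1] avoids dividing by 0. *)
move=> Dw0; pose e : R := (2 * n.+1%:R)^-1.
have n0 : 0 < n.+1%:R :> R by rewrite ltr0n.
have e0 : 0 < e by rewrite invr_gt0 mulr_gt0.
have near_small : \forall w \near w0, D w /\ forall j, `|'D_(delta_mx 0 j) (residual w0) w| <= e.
  have h1 : \forall w \near w0, D w by exact: (open_nbhs_nbhs (conj oD Dw0)).
  have h2 : \forall w \near w0, forall j, `|'D_(delta_mx 0 j) (residual w0) w| <= e.
    apply: (filter_forall (F := nbhs w0) (f := fun j w => `|'D_(delta_mx 0 j) (residual w0) w| <= e)) => j.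
    have /differentiable_continuous := smooth_diff (smooth_derive j (@residual_smooth w0)) Dw0.
    move=> /cvgrPdist_le /(_ e e0); rewrite residual_derive// L_left// subrr.
    by apply: filterS => w; rewrite sub0r normrN.
  by apply: filterS2 h1 h2.
move: near_small => /nbhs_ballP[r /= r0]; rewrite mx_norm_ball => rP.
exists (r / 2); first by rewrite divr_gt0.
have half x : `|w0 - x| <= r / 2 -> ball_ Num.norm w0 r x.
  by move=> wx; rewrite /ball_ /= (le_lt_trans wx)//; lra.
move=> x y wx wy.
have [[Dx _] [Dy _]] := (rP _ (half x wx), rP _ (half y wy)); split=> //.
apply: rV_norm_le => [|i]; first by rewrite mulr_ge0.
pose f w : R^o := residual w0 w 0 i.
have df w v : D w -> dderiv f w v ('D_v (residual w0) w 0 i).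
  move=> Dw.
  have lin : linear (fun y : 'rV[R]_n => y 0 i : R^o) by move=> a x' y'; rewrite !mxE.
  pose lM := GRing.isLinear.Build _ _ _ _ _ lin.
  pose LL : {linear _ -> _} := HB.pack (fun y : 'rV[R]_n => y 0 i : R^o) lM.
  apply: (@dderiv_lin _ _ _ _ LL); first by move=> z; exact: coord_continuous.
  by apply: dderiv_diff; exact: smooth_diff (@residual_smooth w0) Dw.
have seg t : 0 <= t <= 1 -> ball_ Num.norm w0 r (y + t *: (x - y)).
  move=> /andP[t0 t1]; apply: half.
  have -> : w0 - (y + t *: (x - y)) = (1 - t) *: (w0 - y) + t *: (w0 - x).
    by apply/rowP => k; rewrite !mxE; ring.
  rewrite (le_trans (ler_normD _ _))// !normrZ (ger0_norm t0) ger0_norm ?subr_ge0//.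
  have -> : r / 2 = (1 - t) * (r / 2) + t * (r / 2) by ring.
  by rewrite lerD// ler_wpM2l// subr_ge0.
have [t th|t /seg tb] := @mean_value _ _ f y (x - y) 1 ler01.
  by apply: (df _ 0 _).1; have [] := rP _ (seg t th).
rewrite scale1r mul1r subrKC => E.
have [Dt et] := rP _ tb.
have -> : (residual w0 x - residual w0 y) 0 i = f x - f y.
  by rewrite /f; move: (residual w0 x) (residual w0 y) => a b; rewrite !mxE.
rewrite E (df _ _ Dt).2 (derive_rV _ (smooth_diff (@residual_smooth w0) Dt)) summxE.
rewrite (le_trans (ler_norm_sum _ _ _))//.
apply: (@le_trans _ _ (\sum_(j < n) `|x - y| * e)).
  apply: ler_sum => j _; rewrite mxE normrM ler_pM// ?rV_norm_coord//.
  exact: (le_trans (rV_norm_coord _ _) (et j)).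
rewrite sumr_const card_ord -mulrnAr mulrC ler_wpM2r// -mulr_natl.
rewrite /e invfM mulrCA -[leRHS]mulr1 ler_wpM2l//.
by rewrite ler_pdivrMr// mul1r ler_nat.
Qed.

(** The inverse Jacobian is supplied as the smooth fields [B j], so the derivative of the local
    inverse is simply [B j \o g]. The inverse itself comes from a contraction on a closed ball. *)
Lemma inverse_function w0 : D w0 -> exists (W : set 'rV[R]_n) (g : 'rV[R]_n -> 'rV[R]_n) d,
  [/\ 0 < d, open W, W w0 & W `<=` D] /\
  [/\ forall w, W w -> ball (F w0) d (F w) /\ g (F w) = w,
      forall y, ball (F w0) d y -> W (g y) /\ F (g y) = y,
      smooth_on (ball (F w0) d) g &
      forall y j, ball (F w0) d y -> 'D_(delta_mx 0 j) g y = B j (g y)].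
Proof.
move=> Dw0.
have [r r0 rP] := residual_lipschitz Dw0.
have [M M0 LM] := L_bound w0.
have LB x y : L w0 (x - y) = L w0 x - L w0 y.
  by have := L_linear w0 (-1) y x; rewrite !scaleN1r (addrC (- y)) (addrC (- L w0 y)).
have sh (a b c : 'rV[R]_n) : a + c - (b + c) = a - b.
  by apply/rowP => i; rewrite !mxE; ring.
have w0r : `|w0 - w0| <= r by rewrite subrr normr0 ltW.
(* As [L w0] is bounded by [M], targets within this distance move the centre by at most [r / 2], and
   the contraction maps the ball of radius [r] to itself. *)
have d0 : 0 < r / (2 * M) by rewrite divr_gt0// mulr_gt0.
set d := r / (2 * M) in d0.
(* [x - y] is the difference of residuals plus [L w0 (F x - F y)]; the first is at most half of
   [|x - y|] and is absorbed. This gives injectivity and a Lipschitz inverse. *)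
have lip x y : `|w0 - x| <= r -> `|w0 - y| <= r -> `|x - y| <= 2 * M * `|F x - F y|.
  move=> xr yr; have [_ _ xy] := rP _ _ xr yr; have := LM (F x - F y); rewrite LB.
  have -> : L w0 (F x) - L w0 (F y) = (x - y) - (residual w0 x - residual w0 y).
    by rewrite /residual; apply/rowP => i; rewrite !mxE; ring.
  have := lerB_dist (x - y) (residual w0 x - residual w0 y); lra.
have sol y : `|F w0 - y| < d -> exists w, `|w0 - w| < r /\ F w = y.
  move=> yd.
  have Ly : `|L w0 (F w0 - y)| <= r / 2.
    by rewrite (le_trans (LM _))// mulrC -ler_pdivlMr// -mulrA -invfM ltW.
  (* A fixed point satisfies [L w0 (F w) = L w0 y], and [L w0] is injective. *)
  have [||||w wr Tw] := @contraction_fixed _ _ (closed_ball_ Num.norm w0 r)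
    (fun w => residual w0 w + L w0 y) (@compact_closed_ball_rV _ _ _ _).
  - by exists w0.
  - move=> w wr; have [_ _ h] := rP _ _ w0r wr; rewrite /closed_ball_ /=.
    have -> : w0 - (residual w0 w + L w0 y) =
        (residual w0 w0 - residual w0 w) + L w0 (F w0 - y).
      by rewrite LB /residual; apply/rowP => i; rewrite !mxE; ring.
    rewrite (le_trans (ler_normD _ _))//.
    have : `|w0 - w| <= r by [].
    lra.
  - move=> w wr; have [Dw _ _] := rP _ _ wr w0r.
    apply: (@continuousD _ _ _ (residual w0) (cst (L w0 y))); last exact: cst_continuous.
    by apply: differentiable_continuous; exact: smooth_diff (@residual_smooth w0) Dw.
  - by move=> x z xr zr; have [_ _] := rP _ _ xr zr; rewrite sh.
  have [Dw _ _] := rP _ _ wr w0r.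
  have Fw : F w = y.
    apply/eqP; rewrite -subr_eq0 -(L_right (F w - y) Dw0) LB.
    have -> : L w0 (F w) - L w0 y = 0.
      apply/eqP; rewrite subr_eq0 eq_sym -subr_eq0; apply/eqP.
      transitivity (residual w0 w + L w0 y - w); last by rewrite Tw subrr.
      rewrite /residual; move: (L w0 y) (L w0 (F w)) => a b.
      by apply/rowP => i; rewrite !mxE; ring.
    by rewrite (derive0 F w0).
  exists w; split=> //; rewrite (le_lt_trans (lip _ _ w0r wr))// Fw.
  by rewrite mulrC -ltr_pdivlMr// mulr_gt0.
(* On the ball the preimage exists by [sol] and is unique by [lip]; elsewhere [get] may return a
   default value. *)
pose g y := get [set w | `|w0 - w| < r /\ F w = y].
have gP y : `|F w0 - y| < d -> `|w0 - g y| < r /\ F (g y) = y.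
  by move=> yd; exact: (getPex (sol y yd)).
have gF w : `|w0 - w| < r -> `|F w0 - F w| < d -> g (F w) = w.
  move=> wr Fwd; have [gr Fg] := gP _ Fwd; apply/eqP; rewrite -subr_eq0 -normr_le0.
  by rewrite (le_trans (lip _ _ (ltW gr) (ltW wr)))// Fg subrr normr0 mulr0.
have Dr w : `|w0 - w| < r -> D w by move=> /ltW wr; have [] := rP _ _ wr w0r.
have dg y : `|F w0 - y| < d -> differentiable g y /\ forall v, 'D_v g y = L (g y) v.
  move=> yd; have [gr Fg] := gP _ yd; have Dg := Dr _ gr.
  have [M' M'0 LM'] := L_bound (g y).
  pose lM := GRing.isLinear.Build _ _ _ _ _ (L_linear (g y)).
  pose LL : {linear 'rV[R]_n -> 'rV[R]_n} := HB.pack (L (g y)) lM.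
  have Lc : continuous LL.
    apply/linear_bounded_continuous/bounded_funP => s.
    exists (M' * s) => x xs.
    by rewrite (le_trans (LM' x))// ler_wpM2l// ltW.
  apply: (expansion_differentiable Lc) => e e0.
  (* The error in the expansion of [F] is multiplied by [2 * M], the Lipschitz constant of [g], and
     by [M'], the bound on [L (g y)]. *)
  have e'0 : 0 < e / (2 * M * M') by rewrite divr_gt0// !mulr_gt0.
  have := differentiable_expansion (smooth_diff sF Dg) e'0 => /nbhs_ballP[s /= s0].
  rewrite mx_norm_ball => sP.
  have s'0 : 0 < s / (2 * M) by rewrite divr_gt0// mulr_gt0.
  have h1 : \forall h \near (0 : 'rV[R]_n), `|h| < s / (2 * M).
    apply/nbhs_ballP; exists (s / (2 * M)) => //; rewrite mx_norm_ball => h.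
    by rewrite /ball_ /= sub0r normrN.
  have d'0 : 0 < d - `|F w0 - y| by rewrite subr_gt0.
  have h2 : \forall h \near (0 : 'rV[R]_n), `|h| < d - `|F w0 - y|.
    apply/nbhs_ballP; exists (d - `|F w0 - y|) => //; rewrite mx_norm_ball => h.
    by rewrite /ball_ /= sub0r normrN.
  apply: filterS2 h1 h2 => h hs hd.
  have yhd : `|F w0 - (h + y)| < d.
    rewrite opprD addrCA addrC (le_lt_trans (ler_normB _ _))//; lra.
  have [ghr Fgh] := gP _ yhd.
  pose k := g (h + y) - g y.
  have kh : `|k| <= 2 * M * `|h|.
    by rewrite (le_trans (lip _ _ (ltW ghr) (ltW gr)))// Fgh Fg addrK.
  have ks : ball_ Num.norm 0 s k.
    rewrite /ball_ /= sub0r normrN (le_lt_trans kh)//.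
    by rewrite mulrC -ltr_pdivlMr// mulr_gt0.
  have := sP _ ks.
  rewrite /k subrK Fgh Fg -/k.
  move=> hk.
  have -> : g (h + y) - (g y + L (g y) h) = - L (g y) (h + y - (y + 'D_k F (g y))).
    have LB' a b : L (g y) (a - b) = L (g y) a - L (g y) b.
      by have := L_linear (g y) (-1) b a; rewrite !scaleN1r (addrC (- b)) (addrC (- L (g y) b)).
    have -> : h + y - (y + 'D_k F (g y)) = h - 'D_k F (g y).
      by apply/rowP => i; rewrite !mxE; ring.
    by rewrite LB' L_left// /k; apply/rowP => i; rewrite !mxE; ring.
  rewrite normrN (le_trans (LM' _))//.
  rewrite (le_trans (ler_wpM2l (ltW M'0) hk))//.
  rewrite (le_trans (ler_wpM2l (ltW M'0) (ler_wpM2l (ltW e'0) kh)))//.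
  rewrite le_eqVlt; apply/orP; left; apply/eqP; field.
  by rewrite !gt_eqF.
have oB : open (ball (F w0) d) by apply: ball_open.
have ballE : ball (F w0) d = [set y | `|F w0 - y| < d] by rewrite mx_norm_ball.
exists [set w | `|w0 - w| < r /\ `|F w0 - F w| < d], g, d; split; split=> //.
- rewrite openE => w [wr Fwd].
  have h1 : \forall w' \near w, `|w0 - w'| < r.
    have : ball w0 r w by rewrite mx_norm_ball.
    move=> wb; have := open_nbhs_nbhs (conj (ball_open w0 r) wb).
    by rewrite mx_norm_ball.
  have cF := differentiable_continuous (smooth_diff sF (Dr _ wr)).
  have h2 : \forall w' \near w, `|F w0 - F w'| < d.
    apply: (cF [set y | `|F w0 - y| < d]).
    rewrite -ballE; apply: open_nbhs_nbhs; split=> //.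
    by rewrite ballE.
  exact: filterS2 h1 h2.
- by split; rewrite subrr normr0.
- by move=> w [wr _]; exact: Dr.
- by move=> w [wr Fwd]; rewrite ballE; split=> //; exact: gF.
- by move=> y; rewrite ballE /= => yd; have [gr Fg] := gP _ yd; rewrite Fg.
(* Bootstrapping: the partial derivatives of [g] are [B j \o g], so order [k] for [g] gives order
   [k + 1]. *)
- rewrite ballE in oB *; apply/smooth_onP; elim=> [|k IH].
    by split=> // y yd; have [] := dg y yd.
  apply: (Ck_intro oB (df := fun j => B j \o g)).
  + by move=> y yd; have [] := dg y yd.
  + move=> y j yd; rewrite (dg y yd).2 /L (bigD1 j)//= big1 ?addr0.
      by rewrite !mxE !eqxx scale1r.
    by move=> i ij; rewrite !mxE eqxx (negbTE ij) scale0r.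
  + move=> j; apply: (Ck_comp (D := D) oB) IH _.
      by move=> y yd; apply: Dr; have [] := gP _ yd.
    by have /smooth_onP := sB j; apply.
- move=> y j; rewrite ballE => yd; rewrite (dg y yd).2 /L (bigD1 j)//= big1 ?addr0.
    by rewrite !mxE !eqxx scale1r.
  by move=> i ij; rewrite !mxE eqxx (negbTE ij) scale0r.
Qed.

End InverseFunction.

(** * Geometry of the ambient space *)

#[local] Opaque derive.

Section Dot4.
Variable R : realType.
Implicit Types p q r : R4 R.

Lemma dot4Dl p q r : dot4 (p + q) r = dot4 p r + dot4 q r.
Proof. by have := dot4Pl 1 p q r; rewrite scale1r mul1r. Qed.
Lemma dot4Dr p q r : dot4 r (p + q) = dot4 r p + dot4 r q.
Proof. by rewrite dot4C dot4Dl !(dot4C r). Qed.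
Lemma dot40l p : dot4 0 p = 0.
Proof. by have := dot4Dl 0 0 p; rewrite addr0 -{1}[dot4 0 p]addr0 => /addrI. Qed.
Lemma dot40r p : dot4 p 0 = 0.
Proof. by rewrite dot4C dot40l. Qed.
Lemma dot4Zl a p q : dot4 (a *: p) q = a * dot4 p q.
Proof. by have := dot4Pl a p 0 q; rewrite addr0 dot40l addr0. Qed.
Lemma dot4Zr a p q : dot4 q (a *: p) = a * dot4 q p.
Proof. by rewrite dot4C dot4Zl dot4C. Qed.
Lemma dot4Nl p q : dot4 (- p) q = - dot4 p q.
Proof. by rewrite -scaleN1r dot4Zl mulN1r. Qed.
Lemma dot4Nr p q : dot4 q (- p) = - dot4 q p.
Proof. by rewrite dot4C dot4Nl dot4C. Qed.
Lemma dot4_suml I (s : seq I) (P : pred I) (f : I -> R4 R) q :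
  dot4 (\sum_(i <- s | P i) f i) q = \sum_(i <- s | P i) dot4 (f i) q.
Proof.
by apply: (big_morph (fun p => dot4 p q)) => [p r|]; rewrite ?dot4Dl ?dot40l.
Qed.
Lemma dot4_sumr I (s : seq I) (P : pred I) (f : I -> R4 R) q :
  dot4 q (\sum_(i <- s | P i) f i) = \sum_(i <- s | P i) dot4 q (f i).
Proof. by rewrite dot4C dot4_suml; apply: eq_bigr => i _; rewrite dot4C. Qed.

Definition dot4E :=
  (dot4Dl, dot4Dr, dot4Zl, dot4Zr, dot4Nl, dot4Nr, dot40l, dot40r).

Definition vert : R4 R := (0, 1).
(** Expressed through [dot4], so that identities about horizontal parts become bilinear algebra;
    [horizE] gives the form by components. *)
Definition horiz q : R4 R := q - dot4 q vert *: vert.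

Lemma dot4_vert q : dot4 q vert = q.2.
Proof.
rewrite /dot4 /vert /= mulr1 /dot big1 ?add0r// => i _.
by rewrite mxE mulr0.
Qed.

Lemma dot4_vv : dot4 vert vert = 1.
Proof. by rewrite dot4_vert. Qed.

Lemma horizE q : horiz q = (q.1, 0).
Proof.
rewrite /horiz dot4_vert /vert; congr (_, _).
  by rewrite -[LHS]/(q.1 - q.2 *: 0) scaler0 subr0.
by rewrite -[LHS]/(q.2 - q.2 * 1) mulr1 subrr.
Qed.

Lemma dot4_horizr p q : dot4 p (horiz q) = dot4 p q - dot4 p vert * dot4 q vert.
Proof. by rewrite /horiz !dot4E mulrC. Qed.

Lemma dot4_horizl p q : dot4 (horiz q) p = dot4 q p - dot4 q vert * dot4 p vert.
Proof. by rewrite dot4C dot4_horizr dot4C mulrC. Qed.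

Lemma dot_fst p q : dot p.1 q.1 = dot4 p (horiz q).
Proof. by rewrite horizE /dot4 /= mulr0 addr0. Qed.

Lemma horiz_vert q : dot4 (horiz q) vert = 0.
Proof. by rewrite dot4_horizl dot4_vv mulr1 subrr. Qed.

Lemma projE q v : projS2xR q v = v - dot4 v (horiz q) *: horiz q.
Proof.
rewrite -dot_fst horizE /projS2xR; congr (_, _).
by rewrite -[RHS]/(v.2 - dot v.1 q.1 * 0) mulr0 subr0.
Qed.

Lemma horizD p q : horiz (p + q) = horiz p + horiz q.
Proof. by rewrite /horiz dot4Dl scalerDl opprD addrACA. Qed.
Lemma horizZ a p : horiz (a *: p) = a *: horiz p.
Proof. by rewrite /horiz dot4Zl scalerBr scalerA. Qed.
Lemma horizK p : horiz (horiz p) = horiz p.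
Proof. by rewrite {1}/horiz horiz_vert scale0r subr0. Qed.

Variable V : normedModType R.

Lemma dderiv_horiz (f : V -> R4 R) w v d : dderiv f w v d ->
  dderiv (fun w => horiz (f w)) w v (horiz d).
Proof.
move=> fd; apply: dderivB => //.
apply: dderiv_eq (dderivZ (dderiv_dot4 fd (dderiv_cst _ _ _)) (dderiv_cst _ _ _)) _.
by rewrite dot40r addr0 scaler0 addr0.
Qed.

Lemma dderiv_id (w v : V) : dderiv (fun w => w) w v v.
Proof. by split; [exact: (@ex_diff _ _ _ _ _ _ _ (is_diff_id w))|exact: derive_id]. Qed.

End Dot4.

#[local] Opaque dot4 horiz.

(** * The curvature tensor of the ambient space *)

Section CurvatureAlgebra.
Variables (R : comRingType) (V : lmodType R) (dp : V -> V -> R).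
Hypothesis dpDl : forall p q r, dp (p + q) r = dp p r + dp q r.
Hypothesis dpDr : forall p q r, dp r (p + q) = dp r p + dp r q.
Hypothesis dpZl : forall a p q, dp (a *: p) q = a * dp p q.
Hypothesis dpZr : forall a p q, dp q (a *: p) = a * dp q p.
Hypothesis dpNl : forall p q, dp (- p) q = - dp p q.
Hypothesis dpNr : forall p q, dp q (- p) = - dp q p.
Hypothesis dp0l : forall p, dp 0 p = 0.
Hypothesis dp0r : forall p, dp p 0 = 0.
Let dpE := (dpDl, dpDr, dpZl, dpZr, dpNl, dpNr, dp0l, dp0r).
(** [Q], [X], [Y] stand for the horizontal parts of [q], [x], [y], and [A'], [u'], [G'] for
    derivatives along [x] at [q] of the fields [A], [u], [G] occurring in [nabla2_projfield]. The
    form is abstract to keep the computation purely bilinear. *)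
Lemma nabla2_projfield_algebra (y z Q X Y c : V) :
 dp Q Q = 1 -> dp y Q = 0 -> dp z Q = 0 -> dp X Q = 0 -> dp Q X = 0 -> dp Y Q = 0 -> dp Q Y = 0 ->
 let A := Y - dp y Q *: Q in
 let A' := 0 - ((dp 0 Q + dp y X) *: Q + dp y Q *: X) in
 let u := - (dp z A *: Q + dp z Q *: A) in
 let u' := - ((dp 0 A + dp z A') *: Q + dp z A *: X + ((dp 0 Q + dp z X) *: A + dp z Q *: A')) in
 let G' := u' - ((dp u' Q + dp u X) *: Q + dp u Q *: X) in
  dp (G' - dp G' Q *: Q) c = dp (- dp z X *: Y) c.
Proof.
move=> qq yq zq xq xq2 yq' yq2 A A' u u' G'.
have zA : dp z A = dp z Y by rewrite /A !dpE yq zq; ring.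
have AE w : dp A w = dp Y w by rewrite /A !dpE yq; ring.
have zA' : dp z A' = 0 by rewrite /A' !dpE zq yq; ring.
clearbody A A'.
have uE w : dp u w = - dp z Y * dp Q w by rewrite /u !dpE zA zq; ring.
have u'E w : dp u' w = - dp z Y * dp X w - dp z X * dp Y w.
  by rewrite /u' !dpE zA' zA zq AE; ring.
clearbody u u'.
have G'E w : dp G' w = - dp z X * dp Y w.
  by rewrite /G' !dpE !u'E !uE xq xq2 yq' qq; ring.
clearbody G'.
by rewrite !dpE !G'E yq'; ring.
Qed.
End CurvatureAlgebra.

Section Curvature.
Variable R : realType.
Implicit Types q x y z v : R4 R.
Local Notation hz := (@horiz R).

Lemma dderiv_projfield x q v : dderiv (fun q' => projS2xR q' x) q v
  (- (dot4 x (hz v) *: hz q + dot4 x (hz q) *: hz v)).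
Proof.
have -> : (fun q' => projS2xR q' x) = (fun q' => x - dot4 x (hz q') *: hz q').
  by apply/funext => q'; rewrite projE.
have dh : dderiv hz q v (hz v) by apply: dderiv_horiz; exact: dderiv_id.
apply: dderiv_eq (dderivB (dderiv_cst _ _ _)
  (dderivZ (dderiv_dot4 (dderiv_cst _ _ _) dh) dh)) _.
by rewrite dot40l !add0r.
Qed.

Lemma nabla_projfield y z q : nablaS2xR (fun q' => projS2xR q' y) (fun q' => projS2xR q' z) q =
  let A := hz y - dot4 y (hz q) *: hz q in
  projS2xR q (- (dot4 z A *: hz q + dot4 z (hz q) *: A)).
Proof.
rewrite /nablaS2xR (dderiv_projfield z q _).2 [in hz (projS2xR _ _)]projE.
by rewrite horizD -scaleNr horizZ horizK scaleNr.
Qed.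

(** The inner covariant derivative must be kept as a field around [q]: coefficients such as
    [dot4 y (hz q')] vanish at [q] but their derivatives do not. *)
Lemma nabla2_projfield x y z q : dot4 (hz q) (hz q) = 1 ->
  dot4 x (hz q) = 0 -> dot4 y (hz q) = 0 -> dot4 z (hz q) = 0 ->
  nablaS2xR (fun q' => projS2xR q' x)
    (nablaS2xR (fun q' => projS2xR q' y) (fun q' => projS2xR q' z)) q =
  - dot4 z (hz x) *: hz y.
Proof.
move=> qq xq yq zq; rewrite /nablaS2xR -/(nablaS2xR _ _).
have -> : projS2xR q x = x by rewrite projE xq scale0r subr0.
pose A q' := hz y - dot4 y (hz q') *: hz q'.
pose u q' := - (dot4 z (A q') *: hz q' + dot4 z (hz q') *: A q').
pose G q' := u q' - dot4 (u q') (hz q') *: hz q'.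
have -> : (nablaS2xR (fun q' => projS2xR q' y) (fun q' => projS2xR q' z)) = G.
  by apply/funext => q'; rewrite nabla_projfield /= projE.
have dh : dderiv hz q x (hz x) by apply: dderiv_horiz; exact: dderiv_id.
have dc c : dderiv (fun _ : R4 R => c) q x (0 : R4 R) by exact: dderiv_cst.
have dA := dderivB (dc (hz y)) (dderivZ (dderiv_dot4 (dc y) dh) dh).
have du := dderivN (dderivD (dderivZ (dderiv_dot4 (dc z) dA) dh)
  (dderivZ (dderiv_dot4 (dc z) dh) dA)).
have dG := dderivB du (dderivZ (dderiv_dot4 du dh) dh).
rewrite (dderiv_val (f := G) dG) !projE /u /A.
have xq' : dot4 (hz x) (hz q) = 0 by rewrite dot4_horizl xq horiz_vert mulr0 subr0.
have yq' : dot4 (hz y) (hz q) = 0 by rewrite dot4_horizl yq horiz_vert mulr0 subr0.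
have xq2 : dot4 (hz q) (hz x) = 0 by rewrite dot4C.
have yq2 : dot4 (hz q) (hz y) = 0 by rewrite dot4C.
apply: dot4_ext => c.
exact: (nabla2_projfield_algebra (@dot4Dl R) (@dot4Dr R) (@dot4Zl R) (@dot4Zr R)
  (@dot4Nl R) (@dot4Nr R) (@dot40l R) (@dot40r R) c qq yq zq xq' xq2 yq' yq2).
Qed.

(** The vertical factor is flat, so only horizontal parts enter, with the constant curvature 1 of
    the sphere. *)
Lemma curvatureE q x y z : dot4 (hz q) (hz q) = 1 ->
  dot4 x (hz q) = 0 -> dot4 y (hz q) = 0 -> dot4 z (hz q) = 0 ->
  curvature q x y z = dot4 z (hz y) *: hz x - dot4 z (hz x) *: hz y.
Proof.
move=> qq xq yq zq; rewrite /curvature /curvature_field.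
rewrite !nabla2_projfield// [X in _ - X]/nablaS2xR.
(* The derivatives of the two fields at [q] are multiples of [hz q], with a coefficient symmetric in
   [x] and [y]. *)
have -> : lie_bracket (fun q' => projS2xR q' x) (fun q' => projS2xR q' y) q = 0.
  rewrite /lie_bracket (dderiv_projfield y q _).2 (dderiv_projfield x q _).2.
  rewrite !projE xq yq !scale0r !subr0 !addr0.
  by rewrite dot4_horizr (dot4_horizr x) (dot4C y x) mulrC subrr.
rewrite derive0 projE dot40l scale0r !subr0.
by rewrite !scaleNr opprK addrC.
Qed.

End Curvature.

#[local] Transparent dot4 horiz.

(** * Index algebra for the bitension field *)

Section IndexAlgebra.
Variable R : comRingType.

Lemma sum2 (V : nmodType) (F : 'I_2 -> V) : \sum_i F i = F 0 + F 1.
Proof. by rewrite big_ord_recl big_ord1; congr (_ + F _); apply/val_inj. Qed.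

Lemma sum22 (V : nmodType) (f : 'I_2 -> 'I_2 -> V) :
  \sum_i \sum_j f i j = f 0 0 + f 0 1 + (f 1 0 + f 1 1).
Proof. by rewrite !sum2. Qed.

Lemma sum_delta m (f : 'I_m -> R) l : \sum_i f i * (i == l)%:R = f l.
Proof.
rewrite (bigD1 l)//= eqxx mulr1 big1 ?addr0// => i il.
by rewrite (negbTE il) mulr0.
Qed.

Lemma ord2P (Q : 'I_2 -> Prop) : Q 0 -> Q 1 -> forall i, Q i.
Proof.
move=> Q0 Q1; case=> [[|[|//]] lt2].
  by have -> : Ordinal lt2 = 0 by apply/val_inj.
by have -> : Ordinal lt2 = 1 by apply/val_inj.
Qed.

(** For an immersion [x] with normal [n]: [g] is the metric, [P] its inverse, [h] the second
    fundamental form and [F] its trace. [c i j l] is the product of [x_ij] with [x_l], [C] collects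
    the normal components of third derivatives, and [T], [N] are the vertical components of the
    [x_i] and of [n]. *)
Variables P g h : 'I_2 -> 'I_2 -> R.
Variables Gam C dh dP c : 'I_2 -> 'I_2 -> 'I_2 -> R.
Variables (T dF : 'I_2 -> R) (N F : R).
Hypothesis Psym : forall i j, P i j = P j i.
Hypothesis gsym : forall i j, g i j = g j i.
Hypothesis hsym : forall i j, h i j = h j i.
Hypothesis csym : forall i j l, c i j l = c j i l.
Hypothesis PgK : forall i k, \sum_j P i j * g j k = (i == k)%:R.
Hypothesis GamE : forall k i j, Gam k i j = \sum_m P k m * c i j m.

Lemma Gam_lower i j l : \sum_k Gam k i j * g k l = c i j l.
Proof.
have K0 : P 0 0 * g 0 l + P 0 1 * g 1 l = (0 == l)%:R by have := PgK 0 l; rewrite sum2.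
have K1 : P 1 0 * g 0 l + P 1 1 * g 1 l = (1 == l)%:R by have := PgK 1 l; rewrite sum2.
have -> : \sum_k Gam k i j * g k l =
    (P 0 0 * g 0 l + P 0 1 * g 1 l) * c i j 0 + (P 1 0 * g 0 l + P 1 1 * g 1 l) * c i j 1.
  by rewrite !sum2 !GamE !sum2 (Psym 1 0); ring.
by rewrite K0 K1; elim/ord2P: l {K0 K1}; rewrite /= ?mul1r ?mul0r ?addr0 ?add0r.
Qed.

Hypothesis dPg : forall l i k,
  \sum_j (dP l i j * g j k + P i j * (c l j k + c l k j)) = 0.

(** [dPg] is the derivative of [P g = 1]; multiplying it by [P] on the right isolates [dP]. *)
Lemma dP_E l i j : dP l i j = - (\sum_a P i a * Gam j l a + \sum_b Gam i l b * P b j).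
Proof.
have K k : g k 0 * P 0 j + g k 1 * P 1 j = (k == j)%:R.
  rewrite eq_sym -PgK sum2 (Psym 0) (Psym 1) !(gsym k); ring.
have E : dP l i j + (\sum_a P i a * Gam j l a + \sum_b Gam i l b * P b j) =
   (\sum_k (dP l i k * g k 0 + P i k * (c l k 0 + c l 0 k))) * P 0 j +
   (\sum_k (dP l i k * g k 1 + P i k * (c l k 1 + c l 1 k))) * P 1 j.
  transitivity (dP l i 0 * (g 0 0 * P 0 j + g 0 1 * P 1 j) + dP l i 1 * (g 1 0 * P 0 j + g 1 1 * P 1 j)
     + (\sum_a P i a * Gam j l a + \sum_b Gam i l b * P b j)).
    congr (_ + _); rewrite !K; elim/ord2P: j {K} => /=; ring.
  by rewrite !sum2 !GamE !sum2 !(Psym j); ring.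
by apply/eqP; rewrite -addr_eq0 E !dPg !mul0r addr0.
Qed.

Hypothesis Csym1 : forall i j l, C i j l = C j i l.
Hypothesis Csym2 : forall i j l, C i j l = C i l j.
Hypothesis dhE : forall i j l, dh i j l =
  C i j l - \sum_k Gam k j l * h i k - N * T i * (g j l - T j * T l).
Hypothesis dFE : forall l, dF l = \sum_i \sum_j (dP l i j * h i j + P i j * dh l i j).

(** For the field [F n] the tangential Laplacian is [-2 A(grad F) - F div A]. The contracted Codazzi
    equation replaces [div A] by [grad F + N T]; it is encoded in [Csym1] and in the last term of
    [dhE]. *)
Lemma laplacian_algebra l :
  \sum_i \sum_j P i j * (- (dF i * h j l + F * dh i j l)
    - (- F * (\sum_k Gam k i l * h j k) + h i l * dF j)
    + F * \sum_k Gam k i j * h k l) =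
  - (2 * \sum_i \sum_j P i j * dF i * h j l) - F * dF l - F * N * T l.
Proof.
have Gsym k i j : Gam k i j = Gam k j i.
  by rewrite !GamE; apply: eq_bigr => m _; rewrite csym.
have trace_g : P 0 0 * g 0 0 + P 0 1 * g 0 1 + P 1 0 * g 1 0 + P 1 1 * g 1 1 = 2.
  have E0 : P 0 0 * g 0 0 + P 0 1 * g 1 0 = 1 by have := PgK 0 0; rewrite sum2.
  have E1 : P 1 0 * g 0 1 + P 1 1 * g 1 1 = 1 by have := PgK 1 1; rewrite sum2.
  transitivity ((P 0 0 * g 0 0 + P 0 1 * g 1 0) + (P 1 0 * g 0 1 + P 1 1 * g 1 1)).
    by rewrite (gsym 1 0); ring.
  by rewrite E0 E1; ring.
have raiseT : P 0 0 * T 0 * g 0 l + P 0 1 * T 0 * g 1 l + P 1 0 * T 1 * g 0 l + P 1 1 * T 1 * g 1 l = T l.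
  transitivity (T 0 * (\sum_j P 0 j * g j l) + T 1 * (\sum_j P 1 j * g j l)).
    by rewrite !sum2; ring.
  by rewrite !PgK; elim/ord2P: l => /=; ring.
apply/eqP; rewrite -subr_eq0; apply/eqP.
(* What survives the cancellations is the ambient term, which vanishes as [T - 2 T + T] because the
   metric has trace 2. *)
transitivity (F * N * ((P 0 0 * T 0 * g 0 l + P 0 1 * T 0 * g 1 l + P 1 0 * T 1 * g 0 l + P 1 1 * T 1 * g 1 l)
  - T l * (P 0 0 * g 0 0 + P 0 1 * g 0 1 + P 1 0 * g 1 0 + P 1 1 * g 1 1) + T l)); last first.
  by rewrite raiseT trace_g; ring.
rewrite (dFE l).
rewrite !sum2 !dP_E !dhE !sum2.
have C010 : C 0 1 0 = C 0 0 1 by rewrite Csym2.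
have C100 : C 1 0 0 = C 0 0 1 by rewrite Csym1.
have C101 : C 1 0 1 = C 0 1 1 by rewrite Csym1.
have C110 : C 1 1 0 = C 0 1 1 by rewrite Csym2.
elim/ord2P: l {raiseT};
  rewrite (Psym 1 0) (gsym 1 0) (hsym 1 0) !(Gsym _ 1 0) ?(C010, C100, C101, C110); ring.
Qed.

Lemma curvature_algebra l :
  \sum_i \sum_j P i j * (F * (- (T j * N)) * (g i l - T i * T l)
     - (g j i - T j * T i) * (F * - (N * T l))) = F * N * T l.
Proof.
have trace_g : P 0 0 * g 0 0 + P 0 1 * g 0 1 + P 1 0 * g 1 0 + P 1 1 * g 1 1 = 2.
  have E0 : P 0 0 * g 0 0 + P 0 1 * g 1 0 = 1 by have := PgK 0 0; rewrite sum2.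
  have E1 : P 1 0 * g 0 1 + P 1 1 * g 1 1 = 1 by have := PgK 1 1; rewrite sum2.
  transitivity ((P 0 0 * g 0 0 + P 0 1 * g 1 0) + (P 1 0 * g 0 1 + P 1 1 * g 1 1)).
    by rewrite (gsym 1 0); ring.
  by rewrite E0 E1; ring.
have raiseT : T 0 * (P 0 0 * g 0 l + P 0 1 * g 1 l) + T 1 * (P 1 0 * g 0 l + P 1 1 * g 1 l) = T l.
  transitivity (T 0 * (\sum_j P 0 j * g j l) + T 1 * (\sum_j P 1 j * g j l)).
    by rewrite !sum2; ring.
  by rewrite !PgK; elim/ord2P: l => /=; ring.
transitivity (F * N * (T l * (P 0 0 * g 0 0 + P 0 1 * g 0 1 + P 1 0 * g 1 0 + P 1 1 * g 1 1)
  - (T 0 * (P 0 0 * g 0 l + P 0 1 * g 1 l) + T 1 * (P 1 0 * g 0 l + P 1 1 * g 1 l)))); last first.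
  by rewrite raiseT trace_g; ring.
by rewrite !sum2 (Psym 1 0) (gsym 1 0); ring.
Qed.

End IndexAlgebra.

(** Cofactor formula for a symmetric matrix of order 2; in ['I_2] the index [i + 1] is the one
    different from [i]. *)
Lemma inverse2_algebra (R : fieldType) (g : 'I_2 -> 'I_2 -> R) (i j : 'I_2) :
  (forall i j, g i j = g j i) -> g 0 0 * g 1 1 - g 0 1 * g 0 1 != 0 ->
  \sum_k (if i == k then g (i + 1) (i + 1) else - g i k)
     * (g 0 0 * g 1 1 - g 0 1 * g 0 1)^-1 * g k j = (i == j)%:R.
Proof.
move=> gsym; rewrite sum2.
have o11 : (1 + 1 : 'I_2) = 0 by apply/val_inj.
have o01 : (0 + 1 : 'I_2) = 1 by apply/val_inj.
elim/ord2P: i; elim/ord2P: j; rewrite ?o11 ?o01 ?(gsym 1 0) /= => d0; field; exact: d0.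
Qed.

Lemma contraction_algebra (R : realFieldType) (P h : 'I_2 -> 'I_2 -> R) (v m T : 'I_2 -> R) (M N : R) :
  (forall i j, P i j = P j i) ->
  (forall l, 2 * (\sum_i \sum_j P i j * (2 * m i) * h j l) + 2 * M * (2 * m l)
     + 2 * (2 * M * N * T l) = 0) ->
  \sum_i \sum_k (\sum_j P i j * m j) * v k * h i k + M * (\sum_l v l * m l)
    + M * (N * \sum_l v l * T l) = 0.
Proof.
(* The equation was derived for the trace [F = 2 M]; both this and its overall factor 2 contribute
   to the 4. *)
move=> Psym BC; apply: (mulfI (_ : 4 != 0)); first by rewrite pnatr_eq0.
have E := congr2 (fun a b => v 0 * a + v 1 * b) (BC 0) (BC 1).
apply: etrans _ (etrans E _); last by ring.
by rewrite !sum22 !sum2 (Psym 1 0); ring.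
Qed.

(** * Surfaces in a chart *)

#[local] Opaque derive.

Section Basis.
Variable R : realType.

(** Row vectors make the inner product a matrix product, so that linear independence can be used
    through invertibility. *)
Let rowv (p : R4 R) : 'rV[R]_(3 + 1) := row_mx p.1 (const_mx p.2).

Let rowvP a p q : rowv (a *: p + q) = a *: rowv p + rowv q.
Proof.
rewrite /rowv scale_row_mx add_row_mx; congr row_mx.
by apply/rowP => i; rewrite !mxE.
Qed.

Let rowv_sum m (r : 'I_m -> R4 R) (u : 'rV[R]_m) :
  rowv (\sum_i u 0 i *: r i) = \sum_i u 0 i *: rowv (r i).
Proof.
have rowv0 : rowv 0 = 0.
  by rewrite -[in LHS](addNr 0) -scaleN1r rowvP scaleN1r addNr.
rewrite (big_morph rowv (id1 := 0) (op1 := +%R)) //=.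
  by apply: eq_bigr => i _; rewrite -[_ *: r i]addr0 rowvP rowv0 addr0.
by move=> p q; rewrite -[p]scale1r rowvP !scale1r.
Qed.

Let dot4_rowv p q : dot4 p q = (rowv p *m (rowv q)^T) 0 0.
Proof.
rewrite /rowv tr_row_mx mul_row_col !mxE /dot4 /dot; congr (_ + _).
  by apply: eq_bigr => i _; rewrite !mxE.
by rewrite big_ord1 !mxE.
Qed.

Lemma free_eq0 (r : 'I_4 -> R4 R) :
  (forall u : 'rV[R]_4, \sum_i u 0 i *: r i = 0 -> u = 0) ->
  forall v, (forall i, dot4 v (r i) = 0) -> v = 0.
Proof.
move=> rfree v vr; pose A : 'M[R]_4 := \matrix_i rowv (r i).
have /eqP Aker : kermx A == 0.
  apply/eqP/row_matrixP => i; rewrite row0; apply: rfree.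
  have : row i (kermx A) *m A = 0 by rewrite -row_mul mulmx_ker row0.
  rewrite mulmx_sum_row; under eq_bigr do rewrite rowK.
  rewrite -rowv_sum => /(congr1 (fun y => y *m (y^T))).
  move: (\sum_i _ *: _) => p; rewrite mul0mx => /matrixP/(_ 0 0).
  by rewrite -dot4_rowv mxE => /dot4_eq0.
have Au : A \in unitmx by rewrite -row_free_unit -kermx_eq0 Aker.
have : A *m (rowv v)^T = 0.
  apply/matrixP => i j; rewrite !ord1 [RHS]mxE -(vr i) dot4_rowv !mxE.
  by apply: eq_bigr => k _; rewrite !mxE mulrC.
move=> /(congr1 (mulmx (invmx A))); rewrite mulKmx// mulmx0 => v0.
by apply: dot4_eq0; rewrite dot4_rowv v0 mulmx0 mxE.
Qed.

Lemma unitmx_inj m (A : 'M[R]_m) :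
  (forall u : 'rV[R]_m, u *m A = 0 -> u = 0) -> A \in unitmx.
Proof.
move=> Ainj; rewrite -row_free_unit -kermx_eq0; apply/eqP/row_matrixP => i.
by rewrite row0; apply: Ainj; rewrite -row_mul mulmx_ker row0.
Qed.

Lemma dot4_hh (p q : R4 R) : dot4 (horiz p) (horiz q) = dot4 p (horiz q).
Proof. by rewrite dot4_horizl horiz_vert mulr0 subr0. Qed.

End Basis.

#[local] Opaque dot4 horiz vert R4.

Lemma frame_coeffs (R : realType) (X0 X1 n z : R4 R) (u0 u1 u2 u3 : R) :
  dot4 n X0 = 0 -> dot4 n X1 = 0 -> dot4 n n = 1 -> dot4 n z = 0 ->
  dot4 X0 z = 0 -> dot4 X1 z = 0 -> dot4 z z = 1 ->
  u0 *: X0 + (u1 *: X1 + (u2 *: n + u3 *: z)) = 0 ->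
  [/\ u2 = 0, u3 = 0 & u0 *: X0 + u1 *: X1 = 0].
Proof.
move=> n0 n1 nn nz z0 z1 zz uE.
have v2 : u2 = 0.
  have := congr1 (dot4 n) uE; rewrite dot40r !dot4Dr !dot4Zr n0 n1 nn nz.
  by rewrite !mulr0 mulr1 !add0r addr0.
have v3 : u3 = 0.
  have := congr1 (fun p : R4 R => dot4 p z) uE; rewrite /= dot40l !dot4Dl !dot4Zl z0 z1 nz zz.
  by rewrite !mulr0 mulr1 !add0r.
by split=> //; rewrite -uE v2 v3 !scale0r !addr0.
Qed.

Lemma koszul_algebra (R : realType) (xij xji xim xmi xjm xmj xi xj xm : R4 R) :
  xij = xji -> xim = xmi -> xjm = xmj ->
  (dot4 xij xm + dot4 xj xim) + (dot4 xji xm + dot4 xi xjm)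
    - (dot4 xmi xj + dot4 xi xmj) = 2 * dot4 xij xm.
Proof. by move=> <- <- <-; rewrite (dot4C xj xim); ring. Qed.

Lemma half_algebra (R : realType) (p A B C A' B' C' r : R) : A = A' -> B = B' -> C = C' ->
  A' + B' - C' = 2 * r -> 2^-1 * (p * (A + B - C)) = p * r.
Proof. by move=> -> -> -> ->; field. Qed.

Lemma dot4_proj (R : realType) (q y p : R4 R) :
  dot4 (projS2xR q y) p = dot4 y p - dot4 y (horiz q) * dot4 (horiz q) p.
Proof. by rewrite projE dot4Dl dot4Nl dot4Zl. Qed.

Lemma dot4_lincomb (R : realType) m (y p : R4 R) (c : 'I_m -> R) (X : 'I_m -> R4 R) :
  dot4 (y - \sum_k c k *: X k) p = dot4 y p - \sum_k c k * dot4 (X k) p.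
Proof.
rewrite dot4Dl dot4Nl dot4_suml; congr (_ - _).
by apply: eq_bigr => k _; rewrite dot4Zl.
Qed.

Lemma gram_schmidt_algebra (R : realType) (p q : R4 R) :
  dot4 ((- dot4 p q) *: p + dot4 p p *: q) ((- dot4 p q) *: p + dot4 p p *: q) =
  dot4 p p * (dot4 p p * dot4 q q - dot4 p q * dot4 p q).
Proof. by rewrite !dot4Dl !dot4Dr !dot4Zl !dot4Zr (dot4C q p); ring. Qed.

Lemma gauss_dot_algebra (R : realType) m (X : 'I_m -> R4 R) (G h : 'I_m -> R)
    (q n z : R4 R) (b N T Tj Tl glj gjl y : R) :
  dot4 n q = 0 -> dot4 z q = N * T -> y = - (glj - Tl * Tj) -> glj = gjl ->
  (forall k, dot4 (X k) q = - h k) ->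
  dot4 (\sum_k G k *: X k + b *: n + y *: z) q =
  - (\sum_k G k * h k) - N * T * (gjl - Tj * Tl).
Proof.
move=> nq zq -> -> Xq; rewrite !dot4Dl dot4_suml !dot4Zl nq zq mulr0 addr0.
congr (_ + _); last by ring.
by rewrite -sumrN; apply: eq_bigr => k _; rewrite dot4Zl Xq mulrN.
Qed.

Lemma dot4_proj_comb (R : realType) (q n m p : R4 R) (a b : R) :
  dot4 (projS2xR q (a *: n + b *: m)) p = a * dot4 n p + b * dot4 m p
   - (a * dot4 n (horiz q) + b * dot4 m (horiz q)) * dot4 (horiz q) p.
Proof. by rewrite dot4_proj !dot4Dl !dot4Zl. Qed.

Lemma curvature_dot_algebra (R : realType) (F N Ti Tj Tl gji gil : R) (n xi_ xj xl : R4 R) :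
  dot4 n (vert R) = N -> dot4 xi_ (vert R) = Ti -> dot4 xj (vert R) = Tj ->
  dot4 xl (vert R) = Tl -> dot4 n xj = 0 -> dot4 n xl = 0 -> dot4 xj xi_ = gji ->
  dot4 xi_ xl = gil ->
  dot4 (dot4 xj (horiz (F *: n)) *: horiz xi_ - dot4 xj (horiz xi_) *: horiz (F *: n)) xl =
  F * (- (Tj * N)) * (gil - Ti * Tl) - (gji - Tj * Ti) * (F * - (N * Tl)).
Proof.
move=> <- <- <- <- nj nl <- <-.
rewrite dot4Dl dot4Nl !dot4Zl horizZ dot4Zr dot4Zl !dot4_horizr !dot4_horizl.
by rewrite (dot4C xj n) nj nl !sub0r.
Qed.

Record local_surface (R : realType) (D : set 'rV[R]_2) (x n : 'rV[R]_2 -> R4 R) : Prop :=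
  LocalSurface {
    ls_open : open D ;
    ls_smooth : smooth_on D x ;
    ls_normal_smooth : smooth_on D n ;
    ls_on : forall w, D w -> dot4 (x w) (horiz (x w)) = 1 ;
    ls_immersion : forall w b, D w -> b != 0 -> 'D_b x w != 0 ;
    ls_unit : forall w, D w -> dot4 (n w) (n w) = 1 ;
    ls_normal_horiz : forall w, D w -> dot4 (n w) (horiz (x w)) = 0 ;
    ls_normal : forall w b, D w -> dot4 (n w) ('D_b x w) = 0
  }.

Section LocalChart.
Variable R : realType.
Variables (D : set 'rV[R]_2) (x n : 'rV[R]_2 -> R4 R).
Hypothesis LS : local_surface D x n.
Let oD := ls_open LS.
Let sx := ls_smooth LS.
Let sn := ls_normal_smooth LS.
Let xS := ls_on LS.
Let x_imm := ls_immersion LS.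
Let n_unit := ls_unit LS.
Let n_hx := ls_normal_horiz LS.
Let n_dx := ls_normal LS.

Local Notation e i := (delta_mx 0 i : 'rV[R]_2).
Local Notation xd i := ('D_(e i) x).
Local Notation xdd i j := ('D_(e i) ('D_(e j) x)).
Local Notation xi w := (horiz (x w)).
Local Notation N w := (dot4 (n w) (vert R)).
Local Notation g i j w := (dot4 (xd i w) (xd j w)).

Lemma addr_eq0_opp (a b c : R) : a + b = 0 -> b = c -> a = - c.
Proof. by move=> /eqP; rewrite addr_eq0 => /eqP -> ->. Qed.

Lemma dderiv_x w v : D w -> dderiv x w v ('D_v x w).
Proof. by move=> Dw; apply: dderiv_diff; exact: smooth_diff sx Dw. Qed.

Lemma dderiv_n w v : D w -> dderiv n w v ('D_v n w).
Proof. by move=> Dw; apply: dderiv_diff; exact: smooth_diff sn Dw. Qed.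

Lemma dderiv_xd w v i : D w -> dderiv (xd i) w v ('D_v (xd i) w).
Proof. by move=> Dw; apply: dderiv_diff; exact: smooth_diff (smooth_derive i sx) Dw. Qed.

Lemma dderiv_xi w v : D w -> dderiv (fun w => xi w) w v (horiz ('D_v x w)).
Proof. by move=> Dw; apply/dderiv_horiz/dderiv_x. Qed.

Lemma xi_unit w : D w -> dot4 (xi w) (xi w) = 1.
Proof. by move=> Dw; rewrite dot4_hh xS. Qed.

Lemma dx_xi w v : D w -> dot4 ('D_v x w) (xi w) = 0.
Proof.
move=> Dw; have := dderiv_dot4 (dderiv_xi v Dw) (dderiv_xi v Dw).
move/(dderiv_const_on oD Dw xi_unit); rewrite (dot4C (xi w)) dot4_hh.
lra.
Qed.

Lemma dn_n w v : D w -> dot4 ('D_v n w) (n w) = 0.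
Proof.
move=> Dw; have := dderiv_dot4 (dderiv_n v Dw) (dderiv_n v Dw).
move/(dderiv_const_on oD Dw n_unit); rewrite (dot4C (n w)).
lra.
Qed.

(** The derivative of [xi] is only the horizontal part of that of [x]. Its vertical defect gives the
    term on the right, the source of the ambient curvature in what follows. *)
Lemma dn_xi w v : D w -> dot4 ('D_v n w) (xi w) = N w * dot4 ('D_v x w) (vert R).
Proof.
move=> Dw.
have E := dderiv_const_on oD Dw n_hx (dderiv_dot4 (dderiv_n v Dw) (dderiv_xi v Dw)).
apply: etrans (addr_eq0_opp E (dot4_horizr (n w) ('D_v x w))) _.
by rewrite opprB (n_dx v Dw) subr0.
Qed.

Lemma dn_xd w v j : D w -> dot4 ('D_v n w) (xd j w) = - dot4 ('D_v (xd j) w) (n w).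
Proof.
move=> Dw; have E := dderiv_const_on oD Dw (fun w => n_dx (e j))
  (dderiv_dot4 (dderiv_n v Dw) (dderiv_xd v j Dw)).
exact: addr_eq0_opp E (dot4C (n w) ('D_v (xd j) w)).
Qed.

Lemma dxd_xi w v j : D w -> dot4 ('D_v (xd j) w) (xi w) =
  - (dot4 (xd j w) ('D_v x w) - dot4 (xd j w) (vert R) * dot4 ('D_v x w) (vert R)).
Proof.
move=> Dw; have E := dderiv_const_on oD Dw (fun w => dx_xi (e j))
  (dderiv_dot4 (dderiv_xd v j Dw) (dderiv_xi v Dw)).
exact: addr_eq0_opp E (dot4_horizr (xd j w) ('D_v x w)).
Qed.

Lemma dir_sum w v : D w -> 'D_v x w = \sum_i v 0 i *: xd i w.
Proof. by move=> Dw; rewrite (derive_rV v (smooth_diff sx Dw)). Qed.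

Lemma gram_unit w : D w -> gram x w \in unitmx.
Proof.
move=> Dw; apply: unitmx_inj => u ug.
have ux j : dot4 ('D_u x w) (xd j w) = 0.
  transitivity ((u *m gram x w) 0 j); last by rewrite ug mxE.
  rewrite (dir_sum u Dw) dot4_suml mxE.
  by apply: eq_bigr => i _; rewrite dot4Zl mxE.
have ux0 : 'D_u x w = 0.
  apply: dot4_eq0; rewrite {2}(dir_sum u Dw) dot4_sumr big1// => j _.
  by rewrite dot4Zr ux mulr0.
by apply/eqP; apply/negPn/negP => /(x_imm Dw); rewrite ux0 eqxx.
Qed.

Lemma frame_eq0 w p : D w -> (forall i, dot4 p (xd i w) = 0) ->
  dot4 p (n w) = 0 -> dot4 p (xi w) = 0 -> p = 0.
Proof.
move=> Dw px pn pxi.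
pose r (i : 'I_4) := nth 0 [:: xd 0 w; xd 1 w; n w; xi w] i.
apply: (@free_eq0 _ r); last first.
  case; do 4! (case=> [?|]; first by rewrite /r /=; (apply: px || apply: pn || apply: pxi)).
  by [].
move=> u; rewrite !big_ord_recl big_ord0 addr0 => uE.
set u0 := u 0 _ in uE; set u1 := u 0 _ in uE; set u2 := u 0 _ in uE; set u3 := u 0 _ in uE.
have [v2 v3 xE] : [/\ u2 = 0, u3 = 0 & u0 *: xd 0 w + u1 *: xd 1 w = 0].
  exact: (frame_coeffs (n_dx (e 0) Dw) (n_dx (e 1) Dw) (n_unit Dw) (n_hx Dw)
    (dx_xi (e 0) Dw) (dx_xi (e 1) Dw) (xi_unit Dw) uE).
have bE : 'D_(\row_(i < 2) (if i == 0 then u0 else u1)) x w = 0.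
  apply: etrans (dir_sum _ Dw) (etrans _ xE).
  rewrite big_ord_recl big_ord1 !mxE /=.
  by congr (_ + _ *: 'D_(delta_mx 0 _) _ _); apply/val_inj.
have b0 : \row_(i < 2) (if i == 0 then u0 else u1) = 0.
  by apply/eqP; apply/negPn/negP => /(x_imm Dw); rewrite bE eqxx.
have v0 : u0 = 0 by move/rowP/(_ 0): b0; rewrite !mxE.
have v1 : u1 = 0 by move/rowP/(_ 1): b0; rewrite !mxE.
apply/rowP; case=> [[|[|[|[|//]]]] lt4]; rewrite !mxE.
- by rewrite -[RHS]v0; congr (u 0 _); apply/val_inj.
- by rewrite -[RHS]v1; congr (u 0 _); apply/val_inj.
- by rewrite -[RHS]v2; congr (u 0 _); apply/val_inj.
- by rewrite -[RHS]v3; congr (u 0 _); apply/val_inj.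
Qed.

Lemma frame_ext w p q : D w -> (forall i, dot4 p (xd i w) = dot4 q (xd i w)) ->
  dot4 p (n w) = dot4 q (n w) -> dot4 p (xi w) = dot4 q (xi w) -> p = q.
Proof.
move=> Dw px pn pxi; apply/eqP; rewrite -subr_eq0; apply/eqP.
by apply: (frame_eq0 Dw) => [i||]; rewrite dot4Dl dot4Nl ?px ?pn ?pxi subrr.
Qed.

Local Notation P i j w := (gram_inv x w i j).
Local Notation c i j l w := (dot4 (xdd i j w) (xd l w)).
Local Notation h i j w := (dot4 (xdd i j w) (n w)).
Local Notation T i w := (dot4 (xd i w) (vert R)).

Lemma gramE w i j : gram x w i j = g i j w.
Proof. by rewrite mxE. Qed.

Lemma gram_invK w i k : D w -> \sum_j P i j w * g j k w = (i == k)%:R.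
Proof.
move=> Dw; have := mulVmx (gram_unit Dw) => /matrixP/(_ i k); rewrite !mxE => <-.
by apply: eq_bigr => j _; rewrite gramE.
Qed.

Lemma gram_inv_sym w i j : P i j w = P j i w.
Proof.
have gT : (gram x w)^T = gram x w.
  by apply/matrixP => a b; rewrite mxE (gramE w b a) (gramE w a b); exact: dot4C.
by rewrite /gram_inv -{1}gT -trmx_inv mxE.
Qed.

Lemma xdd_sym w i j : D w -> xdd i j w = xdd j i w.
Proof. by move=> Dw; exact: (schwarz4 oD i j sx Dw). Qed.

Lemma dderiv_gram w i j l : D w ->
  dderiv (fun w' => gram x w' j l : R^o) w (e i) (c i j l w + dot4 (xd j w) (xdd i l w)).
Proof.
move=> Dw; have -> : (fun w' => gram x w' j l : R^o) = (fun w' => g j l w').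
  by apply/funext => w'; rewrite gramE.
exact: (dderiv_dot4 (dderiv_xd (e i) j Dw) (dderiv_xd (e i) l Dw)).
Qed.

(** Koszul: with commuting second derivatives, the alternating sum of metric derivatives collapses
    to [2 * c i j m]. *)
Lemma christoffelE w k i j : D w -> christoffel x k i j w = \sum_m P k m w * c i j m w.
Proof.
move=> Dw; rewrite /christoffel mulr_sumr; apply: eq_bigr => m _.
apply: (half_algebra _ (dderiv_gram i j m Dw).2 (dderiv_gram j i m Dw).2 (dderiv_gram m i j Dw).2).
by apply: koszul_algebra; exact: xdd_sym.
Qed.

Lemma c_sym w i j l : D w -> c i j l w = c j i l w.
Proof. by move=> Dw; exact: (congr1 (fun p => dot4 p (xd l w)) (xdd_sym i j Dw)). Qed.

Lemma christoffel_lower w i j l : D w -> \sum_k christoffel x k i j w * g k l w = c i j l w.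
Proof.
move=> Dw.
exact: (@Gam_lower R (fun i j => P i j w) (fun i j => g i j w) (fun k i j => christoffel x k i j w)
  (fun i j l => c i j l w) (@gram_inv_sym w) (fun i k => gram_invK i k Dw)
  (fun k i j => christoffelE k i j Dw)).
Qed.

(** Gauss formula: the projection removes the [xi] component and the Christoffel terms the
    tangential one. *)
Lemma hessianE w i j : D w -> hessian_map x i j w = h i j w *: n w.
Proof.
move=> Dw; have xix l : dot4 (xi w) (xd l w) = 0.
  exact: (etrans (dot4C _ _) (dx_xi _ Dw)).
have nxd l : dot4 (n w) (xd l w) = 0 := n_dx _ Dw.
have dotE p : dot4 (hessian_map x i j w) p = dot4 (xdd i j w) p
    - dot4 (xdd i j w) (xi w) * dot4 (xi w) p
    - \sum_k christoffel x k i j w * dot4 (xd k w) p.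
  apply: etrans (dot4_lincomb _ _ _ _) _; congr (_ - _).
  exact: dot4_proj.
apply: (frame_ext Dw) => [l||]; rewrite dotE dot4Zl.
- by rewrite christoffel_lower// xix nxd !mulr0 subr0 subrr.
- have -> : dot4 (xi w) (n w) = 0 := etrans (dot4C _ _) (n_hx Dw).
  rewrite n_unit// mulr1 mulr0 subr0 big1 ?subr0// => k _.
  by rewrite (dot4C (xd k w)) nxd mulr0.
- rewrite xi_unit// n_hx// mulr1 mulr0 subrr sub0r big1 ?oppr0// => k _.
  by rewrite (dot4C (xd k w)) xix mulr0.
Qed.

Definition trace_h w : R^o := \sum_i \sum_j P i j w * h i j w.

Lemma tensionE w : D w -> tension x w = trace_h w *: n w.
Proof.
move=> Dw; rewrite /trace_h scaler_suml; apply: eq_bigr => i _.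
by rewrite scaler_suml; apply: eq_bigr => j _; rewrite hessianE// scalerA.
Qed.

Lemma shape_dot w v p : D w -> dot4 (xi w) p = 0 ->
  dot4 (Defs.shape x n w v) p = - dot4 ('D_v n w) p.
Proof.
move=> Dw xp; rewrite dot4Nl; congr (- _); apply: etrans (dot4_proj _ _ _) _.
by rewrite xp mulr0 subr0.
Qed.

Lemma mean_curvatureE w : D w -> mean_curvature x n w = 2^-1 * trace_h w.
Proof.
move=> Dw; congr (_ * _); apply: eq_bigr => i _; apply: eq_bigr => j _; congr (_ * _).
rewrite shape_dot//; last exact: (etrans (dot4C _ _) (dx_xi _ Dw)).
exact: (etrans (congr1 -%R (dn_xd _ _ Dw)) (opprK _)).
Qed.

Let det w : R := g 0 0 w * g 1 1 w - g 0 1 w * g 0 1 w.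

Lemma xd_gt0 w i : D w -> 0 < g i i w.
Proof.
move=> Dw; apply/dot4_gt0/(x_imm Dw); apply/eqP => /matrixP/(_ 0 i).
by rewrite !mxE !eqxx => /eqP; rewrite oner_eq0.
Qed.

Lemma det_gt0 w : D w -> 0 < det w.
Proof.
move=> Dw; pose u : 'rV[R]_2 := \row_i (if i == 0 then - g 0 1 w else g 0 0 w).
have uE : 'D_u x w = (- g 0 1 w) *: xd 0 w + g 0 0 w *: xd 1 w.
  by rewrite (dir_sum u Dw) sum2 !mxE.
have u0 : u != 0.
  apply/eqP => /rowP/(_ 1); rewrite !mxE /= => /eqP.
  by rewrite gt_eqF// xd_gt0.
have := dot4_gt0 (x_imm Dw u0); rewrite uE (gram_schmidt_algebra (xd 0 w) (xd 1 w)).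
by rewrite pmulr_rgt0// xd_gt0.
Qed.

Lemma det_neq0 w : D w -> det w != 0.
Proof. by move=> Dw; rewrite gt_eqF// det_gt0. Qed.

(** Cofactors exhibit the inverse metric as a rational function of the metric; its smoothness rests
    on this. *)
Lemma gram_invE w i j : D w ->
  P i j w = (if i == j then g (i + 1) (i + 1) w else - g i j w) * (det w)^-1.
Proof.
move=> Dw; pose Q := \matrix_(i < 2, j < 2)
  ((if i == j then g (i + 1) (i + 1) w else - g i j w) * (det w)^-1).
suff QE : Q *m gram x w = 1%:M.
  rewrite /gram_inv -[invmx _]mul1mx -QE mulmxK ?gram_unit//.
  by rewrite mxE.
apply/matrixP => a b; rewrite !mxE.
transitivity (\sum_k (if a == k then g (a + 1) (a + 1) w else - g a k w) * (det w)^-1 * g k b w).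
  by apply: eq_bigr => k _; rewrite gramE mxE.
exact: (inverse2_algebra a b (fun i j => dot4C (xd i w) (xd j w)) (det_neq0 Dw)).
Qed.

Lemma smooth_g i j : smooth_on D (fun w => g i j w : R^o).
Proof. by apply: smooth_dot4 => //; exact: smooth_derive. Qed.

Lemma smooth_gram_inv i j : smooth_on D (fun w => P i j w : R^o).
Proof.
have s := smooth_g.
apply: (smooth_ext oD (f := fun w =>
   (if i == j then g (i + 1) (i + 1) w else - g i j w) * (det w)^-1 : R^o)).
  by move=> w Dw; rewrite gram_invE.
apply: (smoothM oD).
  by case: (i == j); [exact: s|apply: (smoothN oD); exact: s].
apply: (smoothV oD); first exact: det_neq0.
by apply: (smoothB oD); apply: (smoothM oD); exact: s.
Qed.

Lemma smooth_h i j : smooth_on D (fun w => h i j w : R^o).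
Proof. by apply: smooth_dot4 => //; do 2! apply: smooth_derive. Qed.

Lemma smooth_trace_h : smooth_on D trace_h.
Proof.
apply: (smooth_sum oD) => i; apply: (smooth_sum oD) => j.
apply: (smoothM oD); [exact: smooth_gram_inv|exact: smooth_h].
Qed.

Lemma dderiv_smooth (W : normedModType R) (f : 'rV[R]_2 -> W) w v : smooth_on D f ->
  D w -> dderiv f w v ('D_v f w).
Proof. by move=> sf Dw; apply: dderiv_diff; exact: smooth_diff sf Dw. Qed.

Let C i j l w : R := dot4 ('D_(e i) (xdd j l) w) (n w).
Let dh i j l w : R := C i j l w + dot4 (xdd j l w) ('D_(e i) n w).
Let dP l i j w : R := 'D_(e l) (fun w => P i j w : R^o) w.
Let dF l w : R := 'D_(e l) trace_h w.
Let Gam k i j w := christoffel x k i j w.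

Let smooth_xdd i j : smooth_on D (xdd i j).
Proof. by do 2! apply: smooth_derive. Qed.

Let dderiv_h i j l w : D w -> dderiv (fun w => h j l w : R^o) w (e i) (dh i j l w).
Proof.
by move=> Dw; exact: (dderiv_dot4 (dderiv_smooth _ (smooth_xdd j l) Dw) (dderiv_n _ Dw)).
Qed.

Let C_sym1 i j l w : D w -> C i j l w = C j i l w.
Proof.
move=> Dw; exact: (congr1 (fun p => dot4 p (n w)) (schwarz4 oD i j (smooth_derive l sx) Dw)).
Qed.

Let C_sym2 i j l w : D w -> C i j l w = C i l j w.
Proof.
move=> Dw; apply: (congr1 (fun p => dot4 p (n w))).
exact: (@eq_on_derive R 2 D oD _ (xdd j l) (xdd l j) w (e i) (fun y Dy => xdd_sym j l Dy) Dw).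
Qed.

Let gauss j l w : D w -> xdd j l w = \sum_k Gam k j l w *: xd k w + h j l w *: n w
  + dot4 (xdd j l w) (xi w) *: xi w.
Proof.
move=> Dw; rewrite -hessianE// /hessian_map /nabla_along projE addrC.
by rewrite [X in _ = _ + X]addrC addrNK addrC addrNK.
Qed.

Let dn_xd' i k w : D w -> dot4 (xd k w) ('D_(e i) n w) = - h i k w.
Proof. by move=> Dw; exact: (etrans (dot4C _ _) (dn_xd _ _ Dw)). Qed.

(** In the Gauss decomposition of [xdd j l], only the tangential and [xi] parts pair nontrivially
    with the derivative of [n]. *)
Let dhE i j l w : D w -> dh i j l w =
  C i j l w - \sum_k Gam k j l w * h i k w - N w * T i w * (g j l w - T j w * T l w).
Proof.
move=> Dw; apply: etrans (congr1 (+%R (C i j l w)) _) (addrA _ _ _).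
have E := congr1 (fun p => dot4 p ('D_(e i) n w)) (gauss j l Dw).
apply: etrans E _.
have n0 : dot4 (n w) ('D_(e i) n w) = 0 := etrans (dot4C _ _) (dn_n _ Dw).
have n1 : dot4 (xi w) ('D_(e i) n w) = N w * T i w := etrans (dot4C _ _) (dn_xi _ Dw).
have n2 : dot4 (xdd j l w) (xi w) = - (g l j w - T l w * T j w) := dxd_xi _ _ Dw.
exact: (@gauss_dot_algebra R 2 (fun k => xd k w) (fun k => Gam k j l w) (fun k => h i k w)
  _ (n w) (xi w) (h j l w) (N w) (T i w) (T j w) (T l w) (g l j w) (g j l w) _
  n0 n1 n2 (dot4C _ _) (fun k => dn_xd' i k Dw)).
Qed.

Let dPg l i k w : D w ->
  \sum_j (dP l i j w * g j k w + P i j w * (c l j k w + c l k j w)) = 0.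
Proof.
move=> Dw; have dPi j := dderiv_smooth (e l) (smooth_gram_inv i j) Dw.
have dg j := dderiv_dot4 (dderiv_xd (e l) j Dw) (dderiv_xd (e l) k Dw).
have E := dderivD (dderivM (dPi 0) (dg 0)) (dderivM (dPi 1) (dg 1)).
have PgK y : D y -> P i 0 y * g 0 k y + P i 1 y * g 1 k y = (i == k)%:R.
  by move=> Dy; rewrite -(gram_invK i k Dy) sum2.
have subst (a b c a' b' c' d d1 d' d1' : R) : d = d1 -> d' = d1' ->
  a + b * (c + d) + (a' + b' * (c' + d')) = a + b * (c + d1) + (a' + b' * (c' + d1')).
  by move=> -> ->.
apply: etrans (sum2 _) _; apply: etrans _ (dderiv_const_on oD Dw PgK E).
exact: subst (dot4C _ _) (dot4C _ _).
Qed.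

Let dFE l w : D w -> dF l w = \sum_i \sum_j (dP l i j w * h i j w + P i j w * dh l i j w).
Proof.
move=> Dw; have dPi i j := dderiv_smooth (e l) (smooth_gram_inv i j) Dw.
have E i j := dderivM (dPi i j) (dderiv_h l i j Dw).
have E2 := dderivD (dderivD (E 0 0) (E 0 1)) (dderivD (E 1 0) (E 1 1)).
have hE y : D y -> P 0 0 y * h 0 0 y + P 0 1 y * h 0 1 y +
    (P 1 0 y * h 1 0 y + P 1 1 y * h 1 1 y) = trace_h y.
  by move=> _; exact: (esym (sum22 _)).
exact: (etrans (dderiv_on oD Dw hE E2).2 (esym (sum22 _))).
Qed.

Lemma smooth_xi : smooth_on D (fun w => xi w).
Proof.
apply: (smoothB oD) => //; apply: (smoothZ oD); last exact: smooth_cst.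
by apply: (smooth_dot4 oD) => //; exact: smooth_cst.
Qed.

Let V := tension x.
Let W j := nabla_along x (e j) V.

Let smooth_V : smooth_on D V.
Proof.
apply: (smooth_ext oD (f := fun w => trace_h w *: n w)).
  by move=> w Dw; rewrite -tensionE.
exact: (smoothZ oD smooth_trace_h sn).
Qed.

Let dV w v : D w -> 'D_v V w = 'D_v trace_h w *: n w + trace_h w *: 'D_v n w.
Proof.
move=> Dw; have hE y : D y -> trace_h y *: n y = V y.
  by move=> Dy; exact: (esym (tensionE Dy)).
have E := dderivZ (dderiv_smooth v smooth_trace_h Dw) (dderiv_n v Dw).
exact: (dderiv_on oD Dw hE E).2.
Qed.

Let W_dot w j p : D w -> dot4 (W j w) p =
  dF j w * dot4 (n w) p + trace_h w * dot4 ('D_(e j) n w) p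
  - (dF j w * dot4 (n w) (xi w) + trace_h w * dot4 ('D_(e j) n w) (xi w)) * dot4 (xi w) p.
Proof.
move=> Dw; apply: etrans (dot4_proj_comb _ _ _ _ _ _).
exact: (congr1 (fun y => dot4 (projS2xR (x w) y) p) (dV (e j) Dw)).
Qed.

Let comb3 (a b r p q s p' q' s' : R) : p = p' -> q = q' -> s = s' ->
  a * p + b * q - r * s = a * p' + b * q' - r * s'.
Proof. by move=> -> -> ->. Qed.

Let W_xd w j l : D w -> dot4 (W j w) (xd l w) = - (trace_h w * h j l w).
Proof.
move=> Dw; apply: etrans (W_dot j _ Dw) _.
apply: etrans (comb3 _ _ _ (n_dx _ Dw) (dn_xd _ _ Dw) (etrans (dot4C _ _) (dx_xi _ Dw))) _.
by rewrite mulr0 add0r mulr0 subr0 mulrN.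
Qed.

Let W_n w j : D w -> dot4 (W j w) (n w) = dF j w.
Proof.
move=> Dw; apply: etrans (W_dot j _ Dw) _.
apply: etrans (comb3 _ _ _ (n_unit Dw) (dn_n _ Dw) (etrans (dot4C _ _) (n_hx Dw))) _.
by rewrite mulr1 mulr0 addr0 mulr0 subr0.
Qed.

Let W_xi w j : D w -> dot4 (W j w) (xi w) = 0.
Proof.
move=> Dw; apply: etrans (W_dot j _ Dw) _.
have -> : dot4 (xi w) (xi w) = 1 := xi_unit Dw.
by rewrite mulr1 subrr.
Qed.

Let smooth_W j : smooth_on D (W j).
Proof.
have sV' : smooth_on D ('D_(e j) V) by exact: smooth_derive.
apply: (smooth_ext oD (f := fun w => 'D_(e j) V w - dot4 ('D_(e j) V w) (xi w) *: xi w)).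
  by move=> w Dw; exact: (esym (projE _ _)).
apply: (smoothB oD) => //; apply: (smoothZ oD _ smooth_xi).
exact: (smooth_dot4 oD _ smooth_xi).
Qed.

Let W_xdd w i j l : D w -> dot4 (W j w) (xdd i l w) =
  - trace_h w * (\sum_k Gam k i l w * h j k w) + h i l w * dF j w.
Proof.
move=> Dw; apply: etrans (congr1 (dot4 (W j w)) (gauss i l Dw)) _.
rewrite 2!dot4Dr dot4_sumr 2!dot4Zr.
have -> : dot4 (W j w) (xi w) = 0 := W_xi j Dw.
have -> : dot4 (W j w) (n w) = dF j w := W_n j Dw.
rewrite mulr0 addr0 mulr_sumr; congr (_ + _); apply: eq_bigr => k _.
apply: etrans (dot4Zr _ _ _) _; apply: etrans (congr1 _ (W_xd j k Dw)) _.
by rewrite mulrN mulrCA mulNr.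
Qed.

(** Differentiating the identity [W_xd] yields the tangential components of the second covariant
    derivative without any second derivative of [n]. *)
Let dW_xd w i j l : D w -> dot4 ('D_(e i) (W j) w) (xd l w) =
  - (dF i w * h j l w + trace_h w * dh i j l w)
  - (- trace_h w * (\sum_k Gam k i l w * h j k w) + h i l w * dF j w).
Proof.
move=> Dw.
have E1 := dderiv_dot4 (dderiv_smooth (e i) (@smooth_W j) Dw) (dderiv_xd (e i) l Dw).
have E2 := dderivN (dderivM (dderiv_smooth (e i) smooth_trace_h Dw) (dderiv_h i j l Dw)).
have hE y : D y -> - (trace_h y * h j l y) = dot4 (W j y) (xd l y).
  by move=> Dy; exact: (esym (W_xd j l Dy)).
have E3 := dderiv_uniq E1 (dderiv_on oD Dw hE E2).
have sw (a b c d : R) : a + b = c -> b = d -> a = c - d by move=> <- ->; rewrite addrK.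
exact: (sw _ _ _ _ E3 (W_xdd i j l Dw)).
Qed.

Let laplacian_xd w l : D w -> dot4 (rough_laplacian x V w) (xd l w) =
  - (2 * \sum_i \sum_j P i j w * dF i w * h j l w) - trace_h w * dF l w
  - trace_h w * N w * T l w.
Proof.
move=> Dw.
have xix : dot4 (xi w) (xd l w) = 0 := etrans (dot4C _ _) (dx_xi _ Dw).
apply: etrans (@laplacian_algebra R (fun i j => P i j w) (fun i j => g i j w) (fun i j => h i j w)
  (fun k i j => Gam k i j w) (fun i j l => C i j l w) (fun i j l => dh i j l w)
  (fun l i j => dP l i j w) (fun i j l => c i j l w) (fun i => T i w) (fun i => dF i w)
  (N w) (trace_h w) (@gram_inv_sym w) (fun i j => dot4C _ _)
  (fun i j => congr1 (fun p => dot4 p (n w)) (xdd_sym i j Dw))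
  (fun i j l => c_sym i j l Dw) (fun i k => gram_invK i k Dw) (fun k i j => christoffelE k i j Dw)
  (fun l i k => dPg l i k Dw) (fun i j l => C_sym1 i j l Dw) (fun i j l => C_sym2 i j l Dw)
  (fun i j l => dhE i j l Dw) (fun l => dFE l Dw) l).
rewrite dot4_suml; apply: eq_bigr => i _.
rewrite dot4_suml; apply: eq_bigr => j _.
apply: etrans (dot4Zl _ _ _) _; congr (_ * _).
apply: etrans (dot4_lincomb _ _ _ _) _; congr (_ + _).
  apply: etrans (dot4_proj _ _ _) _; rewrite xix mulr0 subr0.
  exact: dW_xd.
rewrite mulr_sumr -sumrN; apply: eq_bigr => k _.
apply: etrans (congr1 (fun y => - (Gam k i j w * y)) (W_xd k l Dw)) _.
by rewrite mulrN opprK mulrCA.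
Qed.

Let curvature_xd w l : D w ->
  dot4 (\sum_i \sum_j P i j w *: curvature (x w) (xd i w) (V w) (xd j w)) (xd l w) =
  trace_h w * N w * T l w.
Proof.
move=> Dw.
apply: etrans (@curvature_algebra R (fun i j => P i j w) (fun i j => g i j w)
  (fun i => T i w) (N w) (trace_h w) (@gram_inv_sym w) (fun i j => dot4C _ _)
  (fun i k => gram_invK i k Dw) l).
rewrite dot4_suml; apply: eq_bigr => i _.
rewrite dot4_suml; apply: eq_bigr => j _.
apply: etrans (dot4Zl _ _ _) _; congr (_ * _).
have nxi : dot4 (trace_h w *: n w) (xi w) = 0.
  by apply: etrans (dot4Zl _ _ _) _; rewrite n_hx// mulr0.
have cE : curvature (x w) (xd i w) (V w) (xd j w) =
    dot4 (xd j w) (horiz (trace_h w *: n w)) *: horiz (xd i w)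
    - dot4 (xd j w) (horiz (xd i w)) *: horiz (trace_h w *: n w).
  apply: etrans (congr1 (fun y => curvature (x w) (xd i w) y (xd j w)) (tensionE Dw)) _.
  exact: (curvatureE (xi_unit Dw) (dx_xi _ Dw) nxi (dx_xi _ Dw)).
apply: etrans (congr1 (fun p => dot4 p (xd l w)) cE) _.
exact: (curvature_dot_algebra (trace_h w) erefl erefl erefl erefl (n_dx _ Dw) (n_dx _ Dw) erefl erefl).
Qed.

Lemma tangent_part_dot w p l : D w -> dot4 (tangent_part x w p) (xd l w) = dot4 p (xd l w).
Proof.
move=> Dw; transitivity (\sum_i dot4 p (xd i w) * (i == l)%:R).
  rewrite dot4_suml; apply: eq_bigr => i _.
  rewrite dot4_suml -(gram_invK i l Dw) mulr_sumr; apply: eq_bigr => j _.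
  apply: etrans (dot4Zl _ _ _) _.
  have sw (a b c' : R) : a * b * c' = b * (a * c') by rewrite mulrAC mulrC.
  exact: sw.
exact: (sum_delta (fun i => dot4 p (xd i w))).
Qed.

(** The Laplacian and the curvature trace each contribute [trace_h * N * T], whence the last factor
    2. With [trace_h = 2 f] this is four times the [l] component of
    [A(grad f) + f grad f + f N T = 0]. *)
Lemma biconservative_equation w l : D w -> tangent_part x w (bitension x w) = 0 ->
  2 * (\sum_i \sum_j P i j w * 'D_(e i) trace_h w * h j l w)
  + trace_h w * 'D_(e l) trace_h w + 2 * (trace_h w * N w * T l w) = 0.
Proof.
move=> Dw bw.
have fin (A B S X Y : R) : A - B = 0 -> A = - (2 * S) - X - Y -> B = Y ->
  2 * S + X + 2 * Y = 0 by move=> *; lra.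
apply: fin (laplacian_xd l Dw) (curvature_xd l Dw).
have dB (p q r : R4 R) : dot4 (p - q) r = dot4 p r - dot4 q r.
  by rewrite dot4Dl dot4Nl.
apply: etrans (esym (dB _ _ _)) _.
apply: etrans (esym (tangent_part_dot _ l Dw)) _.
exact: (etrans (congr1 (fun p => dot4 p (xd l w)) bw) (dot40l _)).
Qed.

End LocalChart.

(** * The principal frame *)

#[local] Opaque derive dot4 horiz vert R4.

Lemma deriveZv (R : realType) (V W : normedModType R) (f : V -> W) w a v :
  differentiable f w -> 'D_(a *: v) f w = a *: 'D_v f w.
Proof. by move=> df; rewrite !deriveE// linearZ. Qed.

Lemma deriveDv (R : realType) (V W : normedModType R) (f : V -> W) w u v :
  differentiable f w -> 'D_(u + v) f w = 'D_u f w + 'D_v f w.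
Proof. by move=> df; rewrite !deriveE// linearD. Qed.

(** [u] is the quarter turn of [X] in the plane of [p] and [q], up to the square root of the Gram
    determinant. It supplies the second frame vector smoothly and without a choice. *)
Lemma normal_complement (R : realType) (X p q : R4 R) (a b : R) : X = a *: p + b *: q ->
  dot4 X X = 1 -> let u := - dot4 X q *: p + dot4 X p *: q in
  dot4 X u = 0 /\ dot4 u u = dot4 p p * dot4 q q - dot4 p q * dot4 p q.
Proof.
move=> XE XX /=; split; first by rewrite dot4Dr !dot4Zr; ring.
have Xp : dot4 X p = a * dot4 p p + b * dot4 p q.
  by rewrite XE dot4Dl !dot4Zl (dot4C q).
have Xq : dot4 X q = a * dot4 p q + b * dot4 q q by rewrite XE dot4Dl !dot4Zl.
have one : a * (a * dot4 p p + b * dot4 p q) + b * (a * dot4 p q + b * dot4 q q) = 1.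
  by rewrite -XX {2}XE dot4Dr !dot4Zr Xp Xq.
rewrite -[RHS]mulr1 -one dot4Dl !dot4Dr !dot4Zl !dot4Zr (dot4C q p) Xp Xq.
ring.
Qed.

(** [b1] and [b2] are the coordinates of the orthonormal tangent frame, and [rho] is the norm of the
    gradient of [f]; the last two fields are the components of the biconservative equation. *)
Record adapted_frame (R : realType) (D : set 'rV[R]_2) (x n : 'rV[R]_2 -> R4 R)
    (b1 b2 : 'rV[R]_2 -> 'rV[R]_2) (f rho : 'rV[R]_2 -> R^o) : Prop := AdaptedFrame {
  af_surface : local_surface D x n ;
  af_b1 : smooth_on D b1 ;
  af_b2 : smooth_on D b2 ;
  af_f : smooth_on D f ;
  af_11 : forall w, D w -> dot4 ('D_(b1 w) x w) ('D_(b1 w) x w) = 1 ;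
  af_22 : forall w, D w -> dot4 ('D_(b2 w) x w) ('D_(b2 w) x w) = 1 ;
  af_12 : forall w, D w -> dot4 ('D_(b1 w) x w) ('D_(b2 w) x w) = 0 ;
  af_h12 : forall w, D w -> dot4 ('D_(b1 w) n w) ('D_(b2 w) x w) = 0 ;
  af_h21 : forall w, D w -> dot4 ('D_(b2 w) n w) ('D_(b1 w) x w) = 0 ;
  af_trace : forall w, D w ->
    - dot4 ('D_(b1 w) n w) ('D_(b1 w) x w) - dot4 ('D_(b2 w) n w) ('D_(b2 w) x w) = 2 * f w ;
  af_f_gt0 : forall w, D w -> 0 < f w ;
  af_rho : forall w, D w -> 'D_(b1 w) f w = rho w ;
  af_rho_gt0 : forall w, D w -> 0 < rho w ;
  af_f2 : forall w, D w -> 'D_(b2 w) f w = 0 ;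
  af_bc1 : forall w, D w ->
    (- dot4 ('D_(b1 w) n w) ('D_(b1 w) x w) + f w) * rho w
    + f w * (dot4 (n w) (vert R) * dot4 ('D_(b1 w) x w) (vert R)) = 0 ;
  af_bc2 : forall w, D w -> f w * (dot4 (n w) (vert R) * dot4 ('D_(b2 w) x w) (vert R)) = 0
}.

Section AdaptedFrame.
Variable R : realType.
Variables (D : set 'rV[R]_2) (x n : 'rV[R]_2 -> R4 R).
Hypothesis LS : local_surface D x n.
Let M : 'rV[R]_2 -> R^o := mean_curvature x n.
Let F := trace_h x n.
Let G := gradient x M.
Hypothesis M_gt0 : forall w, D w -> 0 < M w.
Hypothesis G_neq0 : forall w, D w -> G w != 0.
Hypothesis G_principal : forall w, D w -> principal_direction x n w (G w).
Hypothesis bicons : forall w, D w -> tangent_part x w (bitension x w) = 0.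
Let oD := ls_open LS.

Local Notation e i := (delta_mx 0 i : 'rV[R]_2).
Local Notation xd i := ('D_(e i) x).
Local Notation xdd i j := ('D_(e i) ('D_(e j) x)).
Local Notation P i j w := (gram_inv x w i j).
Local Notation g i j w := (dot4 (xd i w) (xd j w)).
Local Notation h i j w := (dot4 (xdd i j w) (n w)).
Local Notation xi w := (horiz (x w)).

Let smooth_M : smooth_on D M.
Proof.
apply: (smooth_ext oD (f := fun w => 2^-1 * F w : R^o)).
  by move=> w Dw; exact: (esym (mean_curvatureE LS Dw)).
apply: (smoothM oD); first exact: smooth_cst.
exact: smooth_trace_h.
Qed.

Let dF w v : D w -> 'D_v F w = 2 * 'D_v M w.
Proof.
move=> Dw; have hE y : D y -> 2 * M y = F y.
  by move=> Dy; rewrite /M (mean_curvatureE LS Dy) mulrA mulfV ?mul1r.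
have E := dderivM (dderiv_cst (2 : R^o) w v) (dderiv_smooth v smooth_M Dw).
by rewrite (dderiv_on oD Dw hE E).2 mul0r add0r.
Qed.

Let smooth_G : smooth_on D G.
Proof.
apply/(smooth_coord oD) => i.
apply: (smooth_ext oD (f := fun w => \sum_j (P i j w * 'D_(e j) M w : R^o))).
  by move=> w _; rewrite mxE.
apply: (smooth_sum oD) => j; apply: (smoothM oD); first exact: (smooth_gram_inv LS).
exact: smooth_derive.
Qed.

Let G_xd w k : D w -> dot4 ('D_(G w) x w) (xd k w) = 'D_(e k) M w.
Proof.
move=> Dw; apply: etrans (congr1 (fun p => dot4 p (xd k w)) (dir_sum LS _ Dw)) _.
rewrite dot4_suml; apply: etrans _ (sum_delta (fun j => 'D_(e j) M w) k).
transitivity (\sum_i \sum_j P j i w * 'D_(e j) M w * g i k w).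
  apply: eq_bigr => i _; apply: etrans (dot4Zl _ _ _) _; rewrite mxE mulr_suml.
  by apply: eq_bigr => j _; rewrite (gram_inv_sym x w i j).
rewrite exchange_big; apply: eq_bigr => j _ /=.
rewrite -(gram_invK LS j k Dw) mulr_sumr; apply: eq_bigr => i _.
have sw (a b c : R) : a * b * c = b * (a * c) by ring.
exact: sw.
Qed.

Let G_dot w v : D w -> dot4 ('D_(G w) x w) ('D_v x w) = 'D_v M w.
Proof.
move=> Dw; apply: etrans (congr1 (dot4 _) (dir_sum LS v Dw)) _.
rewrite dot4_sumr (derive_rV v (smooth_diff smooth_M Dw)); apply: eq_bigr => k _.
by apply: etrans (dot4Zr _ _ _) _; congr (_ * _); exact: G_xd.
Qed.

Let hform w (u v : 'rV[R]_2) : R := \sum_i \sum_k u 0 i * v 0 k * h i k w.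

Let dn_dx w u v : D w -> dot4 ('D_u n w) ('D_v x w) = - hform w u v.
Proof.
move=> Dw; have dn := smooth_diff (ls_normal_smooth LS) Dw.
apply: etrans (congr1 (fun p => dot4 p _) (derive_rV u dn)) _.
apply: etrans (congr1 (dot4 _) (dir_sum LS v Dw)) _.
rewrite dot4_suml /hform -sumrN; apply: eq_bigr => i _.
rewrite dot4_sumr -sumrN; apply: eq_bigr => k _.
apply: etrans (dot4Zl _ _ _) _; apply: etrans (congr1 _ (dot4Zr _ _ _)) _.
apply: etrans (congr1 (fun y => _ * (_ * y)) (dn_xd LS (e i) k Dw)) _.
by rewrite !mulrN mulrA.
Qed.

Let hform_sym w u v : D w -> hform w u v = hform w v u.
Proof.
move=> Dw; rewrite /hform exchange_big; apply: eq_bigr => i _; apply: eq_bigr => k _ /=.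
have sw (a b c c' : R) : c = c' -> a * b * c = b * a * c' by move=> ->; rewrite (mulrC a).
exact: (sw _ _ _ _ (congr1 (fun p => dot4 p (n w)) (xdd_sym LS k i Dw))).
Qed.

Let bc w v : D w -> - dot4 ('D_(G w) n w) ('D_v x w) + M w * 'D_v M w
  + M w * (dot4 (n w) (vert R) * dot4 ('D_v x w) (vert R)) = 0.
Proof.
move=> Dw.
have FE : F w = 2 * M w by rewrite /M (mean_curvatureE LS Dw) mulrA mulfV ?mul1r.
have BC l := biconservative_equation LS l Dw (bicons Dw).
have BC' l : 2 * (\sum_i \sum_j P i j w * (2 * 'D_(e i) M w) * h j l w)
    + 2 * M w * (2 * 'D_(e l) M w)
    + 2 * (2 * M w * dot4 (n w) (vert R) * dot4 (xd l w) (vert R)) = 0.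
  apply: etrans _ (BC l); rewrite -FE (dF (e l) Dw); congr (2 * _ + _ + _).
  apply: eq_bigr => i _; apply: eq_bigr => j _; congr (_ * _ * _).
  exact: (esym (dF (e i) Dw)).
have vM : 'D_v M w = \sum_l v 0 l * 'D_(e l) M w.
  exact: derive_rV (smooth_diff smooth_M Dw).
have vT : dot4 ('D_v x w) (vert R) = \sum_l v 0 l * dot4 (xd l w) (vert R).
  apply: etrans (congr1 (fun p => dot4 p _) (dir_sum LS v Dw)) _.
  by rewrite dot4_suml; apply: eq_bigr => l _; exact: dot4Zl.
have hG : - dot4 ('D_(G w) n w) ('D_v x w) =
    \sum_i \sum_k (\sum_j P i j w * 'D_(e j) M w) * v 0 k * h i k w.
  apply: etrans (congr1 -%R (dn_dx _ _ Dw)) (etrans (opprK _) _).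
  apply: eq_bigr => i _; apply: eq_bigr => k _.
  by rewrite mxE.
have sub3 (a a' b b' c c' m q : R) : a = a' -> b = b' -> c = c' ->
    a + m * b + m * (q * c) = a' + m * b' + m * (q * c') by move=> -> -> ->.
apply: etrans (sub3 _ _ _ _ _ _ _ _ hG vM vT) _.
exact: (@contraction_algebra R (fun i j => P i j w) (fun i j => h i j w) (fun l => v 0 l)
  (fun i => 'D_(e i) M w) (fun l => dot4 (xd l w) (vert R)) (M w) (dot4 (n w) (vert R))
  (gram_inv_sym x w) BC').
Qed.

Let rho w : R^o := Num.sqrt (dot4 ('D_(G w) x w) ('D_(G w) x w)).
Let b1 w : 'rV[R]_2 := (rho w)^-1 *: G w.
Let X1 w := 'D_(b1 w) x w.
Let det w : R := g 0 0 w * g 1 1 w - g 0 1 w * g 0 1 w.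
Let b2 w : 'rV[R]_2 := (Num.sqrt (det w))^-1 *:
  \row_i (if i == 0 then - dot4 (X1 w) (xd 1 w) else dot4 (X1 w) (xd 0 w)).
Let X2 w := 'D_(b2 w) x w.

Let dx_diff w : D w -> differentiable x w.
Proof. exact: smooth_diff (ls_smooth LS). Qed.
Let dn_diff w : D w -> differentiable n w.
Proof. exact: smooth_diff (ls_normal_smooth LS). Qed.

Let GG_gt0 w : D w -> 0 < dot4 ('D_(G w) x w) ('D_(G w) x w).
Proof. by move=> Dw; apply: dot4_gt0; exact: (ls_immersion LS Dw (G_neq0 Dw)). Qed.

Let rho_gt0 w : D w -> 0 < rho w.
Proof. by move=> Dw; rewrite sqrtr_gt0 GG_gt0. Qed.

Let rho_sq w : D w -> dot4 ('D_(G w) x w) ('D_(G w) x w) = rho w * rho w.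
Proof. by move=> Dw; rewrite -expr2 sqr_sqrtr// ltW// GG_gt0. Qed.

Let X1E w : D w -> X1 w = (rho w)^-1 *: 'D_(G w) x w.
Proof. by move=> Dw; exact: deriveZv (dx_diff Dw). Qed.

Let X11 w : D w -> dot4 (X1 w) (X1 w) = 1.
Proof.
move=> Dw; rewrite X1E// dot4Zl dot4Zr rho_sq// mulKf ?mulVf//.
all: by rewrite gt_eqF// rho_gt0.
Qed.

Let X1sum w : D w -> X1 w = b1 w 0 0 *: xd 0 w + b1 w 0 1 *: xd 1 w.
Proof. by move=> Dw; exact: (etrans (dir_sum LS _ Dw) (sum2 _)). Qed.

Let X2E w : D w -> X2 w = (Num.sqrt (det w))^-1 *:
  (- dot4 (X1 w) (xd 1 w) *: xd 0 w + dot4 (X1 w) (xd 0 w) *: xd 1 w).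
Proof.
move=> Dw; apply: etrans (deriveZv _ _ (dx_diff Dw)) _; congr (_ *: _).
by apply: etrans (dir_sum LS _ Dw) _; rewrite sum2 !mxE.
Qed.

Let sqrt_det_gt0 w : D w -> 0 < Num.sqrt (det w).
Proof. by move=> Dw; rewrite sqrtr_gt0; exact: det_gt0 LS _ Dw. Qed.

Let X12 w : D w -> dot4 (X1 w) (X2 w) = 0.
Proof.
move=> Dw; have [E _] := normal_complement (X1sum Dw) (X11 Dw).
apply: etrans (congr1 (dot4 _) (X2E Dw)) _; apply: etrans (dot4Zr _ _ _) _.
exact: (etrans (congr1 _ E) (mulr0 _)).
Qed.

Let X22 w : D w -> dot4 (X2 w) (X2 w) = 1.
Proof.
move=> Dw; have [_ E] := normal_complement (X1sum Dw) (X11 Dw).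
apply: etrans (congr1 (fun p => dot4 p p) (X2E Dw)) _.
apply: etrans (dot4Zl _ _ _) _; apply: etrans (congr1 _ (dot4Zr _ _ _)) _.
have unit (d : R) : 0 < d -> (Num.sqrt d)^-1 * ((Num.sqrt d)^-1 * d) = 1.
  move=> d0; have s0 : Num.sqrt d != 0 by rewrite gt_eqF// sqrtr_gt0.
  by rewrite -{3}(sqr_sqrtr (ltW d0)) expr2 mulKf ?mulVf.
exact: (etrans (congr1 (fun y => _ * (_ * y)) E) (unit _ (det_gt0 LS Dw))).
Qed.

Let principal w p : D w -> dot4 (xi w) p = 0 ->
  exists lambda, dot4 ('D_(b1 w) n w) p = lambda * dot4 (X1 w) p.
Proof.
move=> Dw xp; have [_ [lambda E]] := G_principal Dw; exists (- lambda).
have nE : 'D_(b1 w) n w = (rho w)^-1 *: 'D_(G w) n w := deriveZv _ _ (dn_diff Dw).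
have En : dot4 ('D_(b1 w) n w) p = (rho w)^-1 * dot4 ('D_(G w) n w) p.
  exact: (etrans (congr1 (fun q => dot4 q p) nE) (dot4Zl _ _ _)).
have Ex : dot4 (X1 w) p = (rho w)^-1 * dot4 ('D_(G w) x w) p.
  exact: (etrans (congr1 (fun q => dot4 q p) (X1E Dw)) (dot4Zl _ _ _)).
have EG : - dot4 ('D_(G w) n w) p = lambda * dot4 ('D_(G w) x w) p.
  apply: etrans (esym (shape_dot n (G w) Dw xp)) _.
  exact: (etrans (congr1 (fun q => dot4 q p) E) (dot4Zl _ _ _)).
have sw (u v c u' v' l : R) : u = c * u' -> v = c * v' -> - u' = l * v' -> u = - l * v.
  by move=> -> ->; rewrite mulNr mulrCA => <-; rewrite mulrN opprK.
exact: (sw _ _ _ _ _ _ En Ex EG).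
Qed.

Let smooth_b1 : smooth_on D b1.
Proof.
apply: (smoothZ oD) smooth_G; apply: (smoothV oD).
  by move=> w Dw; rewrite gt_eqF// rho_gt0.
apply: (smooth_sqrt oD); first exact: GG_gt0.
have sGx : smooth_on D (fun w => 'D_(G w) x w) := smooth_dir oD (ls_smooth LS) smooth_G.
exact: (smooth_dot4 oD sGx sGx).
Qed.

Let smooth_b2 : smooth_on D b2.
Proof.
have sX1 : smooth_on D X1 := smooth_dir oD (ls_smooth LS) smooth_b1.
have sxd i : smooth_on D (xd i) := smooth_derive i (ls_smooth LS).
apply: (smoothZ oD).
  apply: (smoothV oD); first by move=> w Dw; rewrite gt_eqF// sqrt_det_gt0.
  apply: (smooth_sqrt oD); first by move=> w Dw; exact: det_gt0 LS _ Dw.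
  by apply: (smoothB oD); apply: (smoothM oD); exact: smooth_g LS _ _.
apply/(smooth_coord oD) => i.
apply: (smooth_ext oD (f := fun w => (if i == 0 then - dot4 (X1 w) (xd 1 w) else dot4 (X1 w) (xd 0 w)) : R^o)).
  by move=> w _; rewrite mxE.
case: (i == 0); last exact: (smooth_dot4 oD sX1 (sxd 0)).
exact: (smoothN oD (smooth_dot4 oD sX1 (sxd 1))).
Qed.

Let h12 w : D w -> dot4 ('D_(b1 w) n w) (X2 w) = 0.
Proof.
move=> Dw; have xx : dot4 (xi w) (X2 w) = 0 := etrans (dot4C _ _) (dx_xi LS (b2 w) Dw).
have [lambda E] := principal Dw xx.
exact: (etrans E (etrans (congr1 _ (X12 Dw)) (mulr0 _))).
Qed.

(** The shape operator is self-adjoint, so the direction orthogonal to a principal one is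
    principal. *)
Let h21 w : D w -> dot4 ('D_(b2 w) n w) (X1 w) = 0.
Proof.
move=> Dw; apply: etrans (dn_dx (b2 w) (b1 w) Dw) _.
apply: etrans (congr1 -%R (hform_sym (b2 w) (b1 w) Dw)) _.
exact: (etrans (esym (dn_dx (b1 w) (b2 w) Dw)) (h12 Dw)).
Qed.

(** With the frame as rows of [B], orthonormality reads [B g B^T = 1], hence [B^T B] is the inverse
    metric. This turns the coordinate trace into a trace over the frame. *)
Let gram_inv_frame w i j : D w -> P i j w = b1 w 0 i * b1 w 0 j + b2 w 0 i * b2 w 0 j.
Proof.
move=> Dw; pose B := \matrix_(a < 2, i < 2) (if a == 0 then b1 w 0 i else b2 w 0 i).
have dotB (u v : 'rV[R]_2) : (u *m gram x w *m v^T) 0 0 = dot4 ('D_u x w) ('D_v x w).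
  apply: esym; apply: etrans (congr1 (dot4 _) (dir_sum LS v Dw)) _.
  rewrite dot4_sumr mxE; apply: eq_bigr => k _; apply: etrans (dot4Zr _ _ _) _.
  have -> : v^T k 0 = v 0 k by rewrite mxE.
  have sw (a c c' : R) : c = c' -> a * c = c' * a by move=> ->; rewrite mulrC.
  apply: sw; rewrite mxE.
  apply: etrans (congr1 (fun p => dot4 p _) (dir_sum LS u Dw)) _.
  rewrite dot4_suml; apply: eq_bigr => l _; rewrite gramE; exact: dot4Zl.
have BgB : B *m gram x w *m B^T = 1%:M.
  apply/matrixP => a b.
  have -> : (B *m gram x w *m B^T) a b = (row a B *m gram x w *m (row b B)^T) 0 0.
    by rewrite tr_row -row_mul -row_mul [RHS]mxE !mxE; apply: eq_bigr => k _; rewrite !mxE.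
  rewrite dotB.
  have rB c : row c B = if c == 0 then b1 w else b2 w.
    by apply/rowP => k; rewrite [LHS]mxE [LHS]mxE; case: (c == 0).
  rewrite !rB mxE.
  have d1 : (1 : R) = true%:R by [].
  have d0 : (0 : R) = false%:R by [].
  elim/ord2P: a; elim/ord2P: b.
  - exact: (etrans (X11 Dw) d1).
  - exact: (etrans (X12 Dw) d0).
  - exact: (etrans (dot4C _ _) (etrans (X12 Dw) d0)).
  - exact: (etrans (X22 Dw) d1).
have BB : B^T *m B = gram_inv x w.
  have gBB : gram x w *m (B^T *m B) = 1%:M.
    by rewrite mulmxA; apply: mulmx1C; rewrite mulmxA.
  by rewrite /gram_inv -[LHS](mulKmx (gram_unit LS Dw)) gBB mulmx1.
by rewrite -BB mxE sum2 !mxE.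
Qed.

Let trace w : D w -> - dot4 ('D_(b1 w) n w) (X1 w) - dot4 ('D_(b2 w) n w) (X2 w) = 2 * M w.
Proof.
move=> Dw.
have sw (a b p q r : R) : a = - p -> b = - q -> p + q = r -> - a - b = r.
  by move=> -> -> <-; rewrite !opprK.
apply: (sw _ _ _ _ _ (dn_dx (b1 w) (b1 w) Dw) (dn_dx (b2 w) (b2 w) Dw)).
have -> : 2 * M w = F w by rewrite /M (mean_curvatureE LS Dw) mulrA mulfV ?mul1r.
rewrite /hform -big_split; apply: eq_bigr => i _; rewrite -big_split.
by apply: eq_bigr => j _; rewrite (gram_inv_frame i j Dw) mulrDl.
Qed.

Let GE w : D w -> G w = rho w *: b1 w.
Proof. by move=> Dw; rewrite /b1 scalerA mulfV ?scale1r// gt_eqF// rho_gt0. Qed.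

Let DM w v : D w -> 'D_v M w = rho w * dot4 (X1 w) ('D_v x w).
Proof.
move=> Dw; apply: etrans (esym (G_dot v Dw)) _.
have xE : 'D_(G w) x w = rho w *: X1 w.
  exact: (etrans (congr1 (fun b => 'D_b x w) (GE Dw)) (deriveZv _ _ (dx_diff Dw))).
exact: (etrans (congr1 (fun p => dot4 p ('D_v x w)) xE) (dot4Zl _ _ _)).
Qed.

Let bc_frame w v : D w -> - (rho w * dot4 ('D_(b1 w) n w) ('D_v x w))
  + M w * (rho w * dot4 (X1 w) ('D_v x w))
  + M w * (dot4 (n w) (vert R) * dot4 ('D_v x w) (vert R)) = 0.
Proof.
move=> Dw; have nE : 'D_(G w) n w = rho w *: 'D_(b1 w) n w.
  exact: (etrans (congr1 (fun b => 'D_b n w) (GE Dw)) (deriveZv _ _ (dn_diff Dw))).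
have En := etrans (congr1 (fun p => dot4 p ('D_v x w)) nE) (dot4Zl _ _ _).
have sub2 (a a' b b' c m : R) : a = a' -> b = b' -> - a' + m * b' + c = - a + m * b + c.
  by move=> -> ->.
exact: (etrans (sub2 _ _ _ _ _ _ En (DM v Dw)) (bc v Dw)).
Qed.

Lemma adapted_frame_exists : exists b1 b2 rho, adapted_frame D x n b1 b2 M rho.
Proof.
exists b1, b2, rho.
apply: (AdaptedFrame LS smooth_b1 smooth_b2 smooth_M X11 X22 X12 h12 h21 trace M_gt0 _ rho_gt0).
- by move=> w Dw; exact: (etrans (DM _ Dw) (etrans (congr1 _ (X11 Dw)) (mulr1 _))).
- by move=> w Dw; exact: (etrans (DM _ Dw) (etrans (congr1 _ (X12 Dw)) (mulr0 _))).
- move=> w Dw; apply: etrans _ (bc_frame (b1 w) Dw).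
  have sw (a l r m c : R) : a = 1 -> (- l + m) * r + c = - (r * l) + m * (r * a) + c.
    by move=> ->; ring.
  exact: sw (X11 Dw).
- move=> w Dw; apply: etrans _ (bc_frame (b2 w) Dw).
  have sw (a l r m c : R) : a = 0 -> l = 0 -> c = - (r * l) + m * (r * a) + c.
    by move=> -> ->; ring.
  exact: sw (X12 Dw) (h12 Dw).
Qed.

End AdaptedFrame.

(** * Structure equations *)

#[local] Opaque derive dot4 horiz vert R4.

(* [N] and [s] are the vertical components of the unit normal and of [X1], [l] and
   [a * s] the principal curvatures; [C] spans the rotation axis and [r] is the
   unit vector that the rotation turns. *)
Record rotational_data (R : realType) (D : set 'rV[R]_2) (b1 b2 : 'rV[R]_2 -> 'rV[R]_2)
    (xi X1 X2 C r : 'rV[R]_2 -> R4 R) (f rho N s l a : 'rV[R]_2 -> R^o) : Prop :=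
  RotationalData {
    rd_smooth_N : smooth_on D N ;
    rd_smooth_s : smooth_on D s ;
    rd_smooth_a : smooth_on D a ;
    rd_smooth_C : smooth_on D C ;
    rd_smooth_r : smooth_on D r ;
    rd_s_neq0 : forall w, D w -> s w != 0 ;
    rd_N_neq0 : forall w, D w -> N w != 0 ;
    rd_sN : forall w, D w -> s w * s w + N w * N w = 1 ;
    rd_s : forall w, D w -> dot4 (X1 w) (vert R) = s w ;
    rd_X2v : forall w, D w -> dot4 (X2 w) (vert R) = 0 ;
    rd_dN1 : forall w, D w -> dderiv N w (b1 w) (- (l w * s w)) ;
    rd_dN2 : forall w, D w -> dderiv N w (b2 w) 0 ;
    rd_ds1 : forall w, D w -> dderiv s w (b1 w) (l w * N w) ;
    rd_ds2 : forall w, D w -> dderiv s w (b2 w) 0 ;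
    rd_da1 : forall w, D w -> dderiv a w (b1 w) (- (N w * (1 + a w * a w))) ;
    rd_da2 : forall w, D w -> dderiv a w (b2 w) 0 ;
    rd_dC1 : forall w, D w -> dderiv C w (b1 w) 0 ;
    rd_dC2 : forall w, D w -> dderiv C w (b2 w) 0 ;
    rd_dr1 : forall w, D w -> dderiv r w (b1 w) 0 ;
    rd_dr2 : forall w, D w -> dderiv r w (b2 w) (Num.sqrt (a w ^+ 2 + 1) *: X2 w) ;
    rd_l : forall w, D w -> l w = 2 * f w - a w * s w ;
    rd_df : forall w, D w -> dderiv f w (b1 w) (rho w) ;
    rd_bc : forall w, D w -> (l w + f w) * rho w + f w * (N w * s w) = 0 ;
    rd_CC : forall w, D w -> dot4 (C w) (C w) = 1 ;
    rd_rr : forall w, D w -> dot4 (r w) (r w) = 1 ;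
    rd_Cr : forall w, D w -> dot4 (C w) (r w) = 0 ;
    rd_CX : forall w, D w -> dot4 (C w) (X2 w) = 0 ;
    rd_rX : forall w, D w -> dot4 (r w) (X2 w) = 0 ;
    rd_XX : forall w, D w -> dot4 (X2 w) (X2 w) = 1 ;
    rd_Cv : forall w, D w -> dot4 (C w) (vert R) = 0 ;
    rd_rv : forall w, D w -> dot4 (r w) (vert R) = 0 ;
    rd_xi : forall w, D w -> xi w = (Num.sqrt (a w ^+ 2 + 1))^-1 *: (r w + a w *: C w)
  }.

Section Structure.
Variable R : realType.
Variables (D : set 'rV[R]_2) (b1 b2 : 'rV[R]_2 -> 'rV[R]_2).
Variables xi n X1 X2 n1 n2 Y11 Y12 Y21 Y22 : 'rV[R]_2 -> R4 R.
Variables f rho : 'rV[R]_2 -> R^o.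
Local Notation vt := (vert R).
Let N w : R^o := dot4 (n w) vt.
Let s w : R^o := dot4 (X1 w) vt.
Let l1 w : R^o := - dot4 (n1 w) (X1 w).
Let l2 w : R^o := - dot4 (n2 w) (X2 w).
Hypothesis oD : open D.
Hypotheses (sxi : smooth_on D xi) (sn : smooth_on D n) (sX1 : smooth_on D X1)
  (sX2 : smooth_on D X2) (sn1 : smooth_on D n1) (sn2 : smooth_on D n2) (srho : smooth_on D rho).
Hypothesis o11 : forall w, D w -> dot4 (X1 w) (X1 w) = 1.
Hypothesis o22 : forall w, D w -> dot4 (X2 w) (X2 w) = 1.
Hypothesis o12 : forall w, D w -> dot4 (X1 w) (X2 w) = 0.
Hypothesis onn : forall w, D w -> dot4 (n w) (n w) = 1.
Hypothesis on1 : forall w, D w -> dot4 (n w) (X1 w) = 0.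
Hypothesis on2 : forall w, D w -> dot4 (n w) (X2 w) = 0.
Hypothesis oxx : forall w, D w -> dot4 (xi w) (xi w) = 1.
Hypothesis oxn : forall w, D w -> dot4 (xi w) (n w) = 0.
Hypothesis ox1 : forall w, D w -> dot4 (xi w) (X1 w) = 0.
Hypothesis ox2 : forall w, D w -> dot4 (xi w) (X2 w) = 0.
Hypothesis oxv : forall w, D w -> dot4 (xi w) vt = 0.
Hypothesis complete : forall w p q, D w -> dot4 p (X1 w) = dot4 q (X1 w) ->
  dot4 p (X2 w) = dot4 q (X2 w) -> dot4 p (n w) = dot4 q (n w) ->
  dot4 p (xi w) = dot4 q (xi w) -> p = q.
Hypothesis dxi1 : forall w, D w -> dderiv xi w (b1 w) (X1 w - dot4 (X1 w) vt *: vt).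
Hypothesis dxi2 : forall w, D w -> dderiv xi w (b2 w) (X2 w - dot4 (X2 w) vt *: vt).
Hypothesis dn1 : forall w, D w -> dderiv n w (b1 w) (n1 w).
Hypothesis dn2 : forall w, D w -> dderiv n w (b2 w) (n2 w).
Hypothesis dX11 : forall w, D w -> dderiv X1 w (b1 w) (Y11 w).
Hypothesis dX12 : forall w, D w -> dderiv X2 w (b1 w) (Y12 w).
Hypothesis dX21 : forall w, D w -> dderiv X1 w (b2 w) (Y21 w).
Hypothesis dX22 : forall w, D w -> dderiv X2 w (b2 w) (Y22 w).
Hypothesis h12 : forall w, D w -> dot4 (n1 w) (X2 w) = 0.
Hypothesis h21 : forall w, D w -> dot4 (n2 w) (X1 w) = 0.
Hypothesis trace_l : forall w, D w -> l1 w + l2 w = 2 * f w.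
Hypothesis f_gt0 : forall w, D w -> 0 < f w.
Hypothesis rho_gt0 : forall w, D w -> 0 < rho w.
Hypothesis df1 : forall w, D w -> dderiv f w (b1 w) (rho w).
Hypothesis df2 : forall w, D w -> dderiv f w (b2 w) 0.
Hypothesis bc1 : forall w, D w -> (l1 w + f w) * rho w + f w * (N w * s w) = 0.
Hypothesis bc2 : forall w, D w -> f w * (N w * dot4 (X2 w) vt) = 0.
(** [Y12 w - Y21 w] is the image of the bracket under the differential of the immersion; when it is
    [c *: X2 w], the bracket acts on every function as [c] times the derivative along [X2]. *)
Hypothesis comm4 : forall (F G1 G2 : 'rV[R]_2 -> R4 R) w A B c, D w ->
  smooth_on D F -> (forall y, D y -> dderiv F y (b1 y) (G1 y)) ->
  (forall y, D y -> dderiv F y (b2 y) (G2 y)) ->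
  dderiv G2 w (b1 w) A -> dderiv G1 w (b2 w) B ->
  Y12 w - Y21 w = c *: X2 w -> A - B = c *: G2 w.
Hypothesis comm : forall (F G1 G2 : 'rV[R]_2 -> R^o) w A B c, D w ->
  smooth_on D F -> (forall y, D y -> dderiv F y (b1 y) (G1 y)) ->
  (forall y, D y -> dderiv F y (b2 y) (G2 y)) ->
  dderiv G2 w (b1 w) A -> dderiv G1 w (b2 w) B ->
  Y12 w - Y21 w = c *: X2 w -> A - B = c *: G2 w.

Lemma dot_sum_eq0 (p q : 'rV[R]_2 -> R4 R) (c : R) w v dp dq : D w ->
  (forall y, D y -> dot4 (p y) (q y) = c) -> dderiv p w v dp -> dderiv q w v dq ->
  dot4 dp (q w) = - dot4 dq (p w).
Proof.
move=> Dw pqc hp hq; have E := dderiv_const_on oD Dw pqc (dderiv_dot4 hp hq).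
by move/eqP: E; rewrite addr_eq0 (dot4C (p w)) => /eqP.
Qed.

Lemma dot_self_eq0 (p : 'rV[R]_2 -> R4 R) w v dp : D w ->
  (forall y, D y -> dot4 (p y) (p y) = 1) -> dderiv p w v dp -> dot4 dp (p w) = 0.
Proof.
move=> Dw pp hp; have := dot_sum_eq0 Dw pp hp hp.
by move: (dot4 dp (p w)) => u; lra.
Qed.

Lemma vertE w : D w -> vt = s w *: X1 w + dot4 (X2 w) vt *: X2 w + N w *: n w.
Proof.
move=> Dw.
have a12 := o12 Dw; have a21 : dot4 (X2 w) (X1 w) = 0 by rewrite dot4C.
have a1n : dot4 (X1 w) (n w) = 0 by rewrite dot4C on1.
have a2n : dot4 (X2 w) (n w) = 0 by rewrite dot4C on2.
have a1x : dot4 (X1 w) (xi w) = 0 by rewrite dot4C ox1.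
have a2x : dot4 (X2 w) (xi w) = 0 by rewrite dot4C ox2.
have anx : dot4 (n w) (xi w) = 0 by rewrite dot4C oxn.
apply: (complete Dw); rewrite 2!dot4Dl 3!dot4Zl.
- by rewrite o11// a21 on1// !mulr0 !addr0 mulr1 dot4C.
- by rewrite o22// a12 on2// !mulr0 addr0 add0r mulr1 dot4C.
- by rewrite onn// a1n a2n !mulr0 !add0r mulr1 dot4C.
- by rewrite a1x a2x anx !mulr0 !addr0 dot4C oxv.
Qed.

Lemma dot_vert w p : D w -> dot4 p vt =
  s w * dot4 p (X1 w) + dot4 (X2 w) vt * dot4 p (X2 w) + N w * dot4 p (n w).
Proof.
by move=> Dw; rewrite [in LHS](vertE Dw) 2!dot4Dr 3!dot4Zr.
Qed.

Lemma n1_n w : D w -> dot4 (n1 w) (n w) = 0.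
Proof. by move=> Dw; exact: (dot_self_eq0 Dw onn (dn1 Dw)). Qed.
Lemma n2_n w : D w -> dot4 (n2 w) (n w) = 0.
Proof. by move=> Dw; exact: (dot_self_eq0 Dw onn (dn2 Dw)). Qed.

(** Where [X2] is not horizontal, [bc2] makes [N] vanish on a neighbourhood. Its derivative along
    [X2] then gives [l2 = 0], while [bc1] gives [l1 = - f]; the trace [2 f] would be [- f]. *)
Lemma X2_vert w : D w -> dot4 (X2 w) vt = 0.
Proof.
move=> Dw; apply/eqP; apply/negPn/negP => T2w.
pose T2 y : R^o := dot4 (X2 y) vt.
have sT2 : smooth_on D T2 by apply: (smooth_dot4 oD) => //; exact: smooth_cst.
have N0 y : D y -> T2 y != 0 -> N y = 0.
  move=> Dy T2y; have := bc2 Dy; have := f_gt0 Dy; rewrite -/(T2 y).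
  move: (f y) (N y) (T2 y) T2y => a b c c0 a0 /eqP.
  by rewrite !mulf_eq0 (gt_eqF a0) (negbTE c0) orbF => /eqP.
have near0 : \forall y \near w, 0 = N y :> R^o.
  have c2 : {for w, continuous T2} by apply: differentiable_continuous; exact: smooth_diff sT2 Dw.
  have hT : \forall y \near w, T2 y != 0.
    exact: (cvgr_neq0 _ c2 T2w).
  have hD : \forall y \near w, D y by exact: (open_nbhs_nbhs (conj oD Dw)).
  by apply: filterS2 hT hD => y T2y Dy; rewrite N0.
have dN0 : dot4 (n2 w) vt = 0.
  have E := dderiv_dot4 (dn2 Dw) (dderiv_cst vt w (b2 w)).
  by have := dderiv_uniq E (dderiv_near near0 (dderiv_cst 0 w (b2 w))); rewrite dot40r addr0.
have := dot_vert (n2 w) Dw; rewrite dN0 h21// n2_n// !mulr0 add0r addr0.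
have := bc1 Dw; rewrite (N0 w Dw T2w) mul0r mulr0 addr0.
have := trace_l Dw; have := f_gt0 Dw; have := rho_gt0 Dw.
rewrite /l2; move: (l1 w) (f w) (rho w) (dot4 (n2 w) (X2 w)) (dot4 (X2 w) vt) T2w => l f' r m t t0 r0 f0 tr.
move=> /eqP; rewrite mulf_eq0 (gt_eqF r0) orbF => /eqP lf /esym/eqP.
by rewrite mulf_eq0 (negbTE t0) /= => /eqP m0; lra.
Qed.

Lemma dot_vert' w p : D w -> dot4 p vt = s w * dot4 p (X1 w) + N w * dot4 p (n w).
Proof. by move=> Dw; rewrite (dot_vert p Dw) X2_vert// mul0r addr0. Qed.

Lemma sN1 w : D w -> s w * s w + N w * N w = 1.
Proof.
move=> Dw; rewrite -(dot4_vv R) [in RHS](dot_vert' vt Dw).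
by rewrite (dot4C _ (X1 w)) (dot4C _ (n w)).
Qed.

Lemma dxi1' w : D w -> dderiv xi w (b1 w) (X1 w - s w *: vt).
Proof. exact: dxi1. Qed.

Lemma dxi2' w : D w -> dderiv xi w (b2 w) (X2 w).
Proof. by move=> Dw; apply: dderiv_eq (dxi2 Dw) _; rewrite X2_vert// scale0r subr0. Qed.

Lemma ds2_l2 w : D w -> s w * dot4 (Y21 w) (X2 w) = N w * l2 w.
Proof.
move=> Dw.
have E := dderiv_const_on oD Dw X2_vert (dderiv_dot4 (dX22 Dw) (dderiv_cst vt w (b2 w))).
move: E; rewrite dot40r addr0 (dot_vert' _ Dw).
have o21 y : D y -> dot4 (X2 y) (X1 y) = 0 by move=> Dy; rewrite dot4C o12.
have o2n y : D y -> dot4 (X2 y) (n y) = 0 by move=> Dy; rewrite dot4C on2.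
rewrite (dot_sum_eq0 Dw o21 (dX22 Dw) (dX21 Dw)).
rewrite (dot_sum_eq0 Dw o2n (dX22 Dw) (dn2 Dw)) /l2 !mulrN.
by move/eqP; rewrite subr_eq0 => /eqP <-; rewrite opprK.
Qed.

(** If [s = 0], then [N] is 1 or -1 and [ds2_l2] gives [l2 = 0], so [l1 = 2 f]; but [bc1] gives
    [l1 = - f]. *)
Lemma s_neq0 w : D w -> s w != 0.
Proof.
move=> Dw; apply/eqP => s0.
have := ds2_l2 Dw; have := sN1 Dw; have := bc1 Dw; have := trace_l Dw.
rewrite s0 !mul0r !mulr0 addr0 add0r.
have := f_gt0 Dw; have := rho_gt0 Dw.
move: (N w) (l1 w) (l2 w) (f w) (rho w) => N' l m f' r r0 f0 tr /eqP.
rewrite mulf_eq0 (gt_eqF r0) orbF => /eqP lf NN /esym/eqP.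
rewrite mulf_eq0 => /orP[/eqP N0|/eqP m0]; last by lra.
by move: NN; rewrite N0 mul0r => /esym/eqP; rewrite oner_eq0.
Qed.

(** Up to sign, the geodesic curvature in the sphere of the integral curves of [X2]: by [dnu2] it is
    the rate at which their horizontal normal [nu] turns. *)
Let a w : R^o := l2 w / s w.
Let nu w : R4 R := N w *: X1 w - s w *: n w.

Let l2E w : D w -> l2 w = a w * s w.
Proof. by move=> Dw; rewrite /a divfK// s_neq0. Qed.

Let o21 w : D w -> dot4 (X2 w) (X1 w) = 0.
Proof. by move=> Dw; rewrite dot4C o12. Qed.
Let o1n w : D w -> dot4 (X1 w) (n w) = 0.
Proof. by move=> Dw; rewrite dot4C on1. Qed.
Let o2n w : D w -> dot4 (X2 w) (n w) = 0.
Proof. by move=> Dw; rewrite dot4C on2. Qed.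
Let o1x w : D w -> dot4 (X1 w) (xi w) = 0.
Proof. by move=> Dw; rewrite dot4C ox1. Qed.
Let o2x w : D w -> dot4 (X2 w) (xi w) = 0.
Proof. by move=> Dw; rewrite dot4C ox2. Qed.
Let onx w : D w -> dot4 (n w) (xi w) = 0.
Proof. by move=> Dw; rewrite dot4C oxn. Qed.

Let dxi1_dot w p : dot4 (X1 w - s w *: vt) p = dot4 (X1 w) p - s w * dot4 p vt.
Proof. by rewrite dot4Dl dot4Nl dot4Zl (dot4C vt). Qed.

Lemma n1E w : D w -> n1 w = - l1 w *: X1 w + (s w * N w) *: xi w.
Proof.
move=> Dw; apply: (complete Dw); rewrite dot4Dl 2!dot4Zl.
- by rewrite o11// ox1// mulr0 addr0 mulr1 opprK.
- by rewrite h12// o12// ox2// !mulr0 addr0.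
- by rewrite n1_n// o1n// oxn// !mulr0 addr0.
- rewrite o1x// oxx// mulr0 add0r mulr1.
  rewrite (dot_sum_eq0 Dw onx (dn1 Dw) (dxi1' Dw)) dxi1_dot o1n// sub0r opprK.
  by [].
Qed.

Lemma n2E w : D w -> n2 w = - l2 w *: X2 w.
Proof.
move=> Dw; apply: (complete Dw); rewrite dot4Zl.
- by rewrite h21// o21// mulr0.
- by rewrite o22// mulr1 opprK.
- by rewrite n2_n// o2n// mulr0.
- by rewrite o2x// mulr0 (dot_sum_eq0 Dw onx (dn2 Dw) (dxi2' Dw)) o2n// oppr0.
Qed.

Let Y12_n w : D w -> dot4 (Y12 w) (n w) = 0.
Proof. by move=> Dw; rewrite (dot_sum_eq0 Dw o2n (dX12 Dw) (dn1 Dw)) h12// oppr0. Qed.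

(** Since [X2] stays horizontal along [X1], its derivative is horizontal; having no normal part and
    [s] being nonzero, it has no [X1] part either. *)
Let Y12_X1 w : D w -> dot4 (Y12 w) (X1 w) = 0.
Proof.
move=> Dw.
have := dderiv_const_on oD Dw X2_vert (dderiv_dot4 (dX12 Dw) (dderiv_cst vt w (b1 w))).
rewrite dot40r addr0 (dot_vert' _ Dw) Y12_n// mulr0 addr0 => /eqP.
by rewrite mulf_eq0 (negbTE (s_neq0 Dw)) => /eqP.
Qed.

Lemma Y12E w : D w -> Y12 w = 0.
Proof.
move=> Dw; apply: (complete Dw); rewrite dot40l.
- exact: Y12_X1.
- exact: (dot_self_eq0 Dw o22 (dX12 Dw)).
- exact: Y12_n.
- rewrite (dot_sum_eq0 Dw o2x (dX12 Dw) (dxi1' Dw)) dxi1_dot o12// X2_vert// mulr0.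
  by rewrite subr0 oppr0.
Qed.

Lemma Y11E w : D w -> Y11 w = l1 w *: n w - (N w * N w) *: xi w.
Proof.
move=> Dw; apply: (complete Dw); rewrite dot4Dl dot4Nl 2!dot4Zl.
- by rewrite (dot_self_eq0 Dw o11 (dX11 Dw)) on1// ox1// !mulr0 subr0.
- rewrite (dot_sum_eq0 Dw o12 (dX11 Dw) (dX12 Dw)) Y12_X1// on2// ox2//.
  by rewrite !mulr0 subr0 oppr0.
- by rewrite (dot_sum_eq0 Dw o1n (dX11 Dw) (dn1 Dw)) onn// oxn// mulr0 subr0 mulr1.
- rewrite (dot_sum_eq0 Dw o1x (dX11 Dw) (dxi1' Dw)) dxi1_dot o11// onx// oxx//.
  have := sN1 Dw; rewrite -/(s w); move: (s w) (N w) (l1 w) => s' N' l; lra.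
Qed.

Lemma Y21E w : D w -> Y21 w = (a w * N w) *: X2 w.
Proof.
move=> Dw; apply: (complete Dw); rewrite dot4Zl.
- by rewrite (dot_self_eq0 Dw o11 (dX21 Dw)) o21// mulr0.
- rewrite o22// mulr1; apply: (mulfI (s_neq0 Dw)).
  by rewrite ds2_l2// l2E// mulrCA mulrA mulrC mulrA.
- by rewrite (dot_sum_eq0 Dw o1n (dX21 Dw) (dn2 Dw)) h21// o2n// mulr0 oppr0.
- by rewrite (dot_sum_eq0 Dw o1x (dX21 Dw) (dxi2' Dw)) o21// o2x// mulr0 oppr0.
Qed.

Lemma dN1 w : D w -> dderiv N w (b1 w) (- (l1 w * s w)).
Proof.
move=> Dw; apply: dderiv_eq (dderiv_dot4 (dn1 Dw) (dderiv_cst vt w (b1 w))) _.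
by rewrite dot40r addr0 (dot_vert' _ Dw) n1_n// mulr0 addr0 /l1 mulNr opprK mulrC.
Qed.

Lemma dN2 w : D w -> dderiv N w (b2 w) 0.
Proof.
move=> Dw; apply: dderiv_eq (dderiv_dot4 (dn2 Dw) (dderiv_cst vt w (b2 w))) _.
by rewrite dot40r addr0 (dot_vert' _ Dw) n2_n// h21// !mulr0 addr0.
Qed.

Lemma ds1 w : D w -> dderiv s w (b1 w) (l1 w * N w).
Proof.
move=> Dw; apply: dderiv_eq (dderiv_dot4 (dX11 Dw) (dderiv_cst vt w (b1 w))) _.
rewrite dot40r addr0 Y11E// dot4Dl dot4Nl 2!dot4Zl (oxv Dw) mulr0 subr0.
by [].
Qed.

Lemma ds2 w : D w -> dderiv s w (b2 w) 0.
Proof.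
move=> Dw; apply: dderiv_eq (dderiv_dot4 (dX21 Dw) (dderiv_cst vt w (b2 w))) _.
by rewrite dot40r addr0 Y21E// dot4Zl X2_vert// mulr0.
Qed.

Lemma dxi_nu w : D w -> dderiv xi w (b1 w) (N w *: nu w).
Proof.
move=> Dw; apply: dderiv_eq (dxi1' Dw) _; apply: dot4_ext => c.
rewrite dxi1_dot (dot_vert' c Dw) dot4Zl dot4Dl dot4Nl 2!dot4Zl.
rewrite (dot4C c) (dot4C c); have := sN1 Dw.
move: (s w) (N w) (dot4 (X1 w) c) (dot4 (n w) c) => s' N' p q sN.
transitivity (p * (1 - s' * s') - s' * N' * q); first by ring.
by rewrite -sN; ring.
Qed.

Lemma dnu1 w : D w -> dderiv nu w (b1 w) (- (N w *: xi w)).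
Proof.
move=> Dw; apply: dderiv_eq.
  exact: (dderivB (dderivZ (dN1 Dw) (dX11 Dw)) (dderivZ (ds1 Dw) (dn1 Dw))).
rewrite Y11E// n1E//; apply: dot4_ext => c.
rewrite !(dot4Dl, dot4Nl, dot4Zl); have := sN1 Dw.
move: (s w) (N w) (l1 w) (dot4 (X1 w) c) (dot4 (n w) c) (dot4 (xi w) c) => s' N' l p q r sN.
transitivity (- (N' * ((s' * s' + N' * N') * r))); first by ring.
by rewrite sN mul1r.
Qed.

Lemma dnu2 w : D w -> dderiv nu w (b2 w) (a w *: X2 w).
Proof.
move=> Dw; apply: dderiv_eq.
  exact: (dderivB (dderivZ (dN2 Dw) (dX21 Dw)) (dderivZ (ds2 Dw) (dn2 Dw))).
rewrite Y21E// n2E// l2E//; apply: dot4_ext => c.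
rewrite !(dot4Dl, dot4Nl, dot4Zl); have := sN1 Dw.
move: (s w) (N w) (a w) (dot4 (X1 w) c) (dot4 (n w) c) (dot4 (X2 w) c) => s' N' l p q r sN.
transitivity ((s' * s' + N' * N') * (l * r)); first by ring.
by rewrite sN mul1r.
Qed.

Let sN : smooth_on D N.
Proof. by apply: (smooth_dot4 oD) => //; exact: smooth_cst. Qed.
Let ss : smooth_on D s.
Proof. by apply: (smooth_dot4 oD) => //; exact: smooth_cst. Qed.
Let sl2 : smooth_on D l2.
Proof. by apply: (smoothN oD); exact: (smooth_dot4 oD). Qed.
Let sl1 : smooth_on D l1.
Proof. by apply: (smoothN oD); exact: (smooth_dot4 oD). Qed.
Lemma smooth_a : smooth_on D a.
Proof. by apply: (smooth_div oD) => //; exact: s_neq0. Qed.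
Lemma smooth_nu : smooth_on D nu.
Proof. by apply: (smoothB oD); exact: (smoothZ oD). Qed.

Let YE w : D w -> Y12 w - Y21 w = - (a w * N w) *: X2 w.
Proof. by move=> Dw; rewrite Y12E// Y21E// sub0r scaleNr. Qed.

(** The bracket [- a N X2] applied to [nu]: the [X2] component reads [X1 a + N = - a^2 N]. *)
Lemma da1 w : D w -> dderiv a w (b1 w) (- (N w * (1 + a w * a w))).
Proof.
move=> Dw; have da := dderiv_smooth (b1 w) smooth_a Dw.
apply: dderiv_eq da _.
move: ('D_(b1 w) a w) (dderiv_smooth (b1 w) smooth_a Dw) => a' da.
have E := comm4 Dw smooth_nu dnu1 dnu2 (dderivZ da (dX12 Dw))
  (dderivN (dderivZ (dN2 Dw) (dxi2' Dw))) (YE Dw).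
have := congr1 (fun p => dot4 p (X2 w)) E.
rewrite Y12E// !(dot4Dl, dot4Nl, dot4Zl, dot40l) o22// ox2//.
move: (a w) (N w) => u v; lra.
Qed.

(** At a zero of [N] one has [s^2 = 1] and [l1 = - f], and the derivative of [bc1] along [X1]
    becomes [3 rho^2 + f^2 = 0]. The factor 3 comes from [X1 l1 = 2 rho] together with
    [X1 f = rho]. *)
Lemma N_neq0 w : D w -> N w != 0.
Proof.
move=> Dw; apply/eqP => N0.
have l1E y : D y -> 2 * f y - a y * s y = l1 y.
  by move=> Dy; rewrite -(trace_l Dy) l2E// addrK.
have dl1 := dderiv_on oD Dw l1E (dderivB (dderivM (dderiv_cst (2 : R^o) w (b1 w)) (df1 Dw))
  (dderivM (da1 Dw) (ds1 Dw))).
have := dderiv_const_on oD Dw bc1 (dderivD (dderivM (dderivD dl1 (df1 Dw)) (dderiv_smooth (b1 w) srho Dw))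
  (dderivM (df1 Dw) (dderivM (dN1 Dw) (ds1 Dw)))).
have := bc1 Dw; have := sN1 Dw; rewrite N0.
have := f_gt0 Dw; have := rho_gt0 Dw.
move: ('D_(b1 w) rho w) (rho w) (f w) (s w) (a w) (l1 w) => dr r f' s' u l r0 f0 ss1 bc.
have {}bc : l = - f'.
  move/eqP: bc; rewrite mul0r mulr0 addr0 mulf_eq0 (gt_eqF r0) orbF addr_eq0.
  by move/eqP.
have s1 : s' * s' = 1 by lra.
rewrite bc => H.
have : 3 * (r * r) + f' * f' * (s' * s') = 0 by rewrite -[RHS]H; ring.
rewrite s1; have := mulr_gt0 r0 r0; have := mulr_gt0 f0 f0; lra.
Qed.

(** The bracket applied to [N]: as [X2 N = 0], it leaves [X2 (l1 s) = 0], and [X2 s = 0]. *)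
Lemma dl1_2 w : D w -> dderiv l1 w (b2 w) 0.
Proof.
move=> Dw; have dl := dderiv_smooth (b2 w) sl1 Dw; apply: dderiv_eq dl _.
move: ('D_(b2 w) l1 w) (dderiv_smooth (b2 w) sl1 Dw) => d dl.
have E := comm Dw sN dN1 dN2 (dderiv_cst (0 : R^o) w (b1 w)) (dderivN (dderivM dl (ds2 Dw))) (YE Dw).
move: E; rewrite scaler0 sub0r opprK mulr0 addr0 => /eqP.
by rewrite mulf_eq0 (negbTE (s_neq0 Dw)) orbF => /eqP.
Qed.

Lemma da2 w : D w -> dderiv a w (b2 w) 0.
Proof.
move=> Dw; have aE y : D y -> (2 * f y - l1 y) * (s y)^-1 = a y.
  by move=> Dy; rewrite -(trace_l Dy) addrAC subrr add0r.
apply: dderiv_eq (dderiv_on oD Dw aE (dderivM (dderivB (dderivM (dderiv_cst (2 : R^o) w (b2 w)) (df2 Dw))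
  (dl1_2 Dw)) (dderivV (s_neq0 Dw) (ds2 Dw)))) _.
by rewrite !(oppr0, mul0r, mulr0, addr0, add0r).
Qed.

Let q w : R^o := Num.sqrt (a w ^+ 2 + 1).
Let k w : R^o := (q w)^-1.
Let C w : R4 R := k w *: (a w *: xi w - nu w).
Let r w : R4 R := k w *: (xi w + a w *: nu w).

Let a2_gt0 w : 0 < a w ^+ 2 + 1.
Proof. by rewrite ltr_wpDl// sqr_ge0. Qed.
Let q_gt0 w : 0 < q w.
Proof. by rewrite sqrtr_gt0. Qed.
Let qq w : q w * q w = a w * a w + 1.
Proof. by rewrite -!expr2 sqr_sqrtr// ltW. Qed.
Let qk w : q w * k w = 1.
Proof. by rewrite mulfV// gt_eqF. Qed.
Let kk w : k w * k w * (a w * a w + 1) = 1.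
Proof. by rewrite -qq mulrACA mulrC (mulrC (k w)) qk mulr1. Qed.

Let sk : smooth_on D k.
Proof.
apply: (smoothV oD); first by move=> w _; rewrite gt_eqF.
apply: (smooth_sqrt oD) => //.
apply: (smoothD oD); last exact: smooth_cst.
by apply: (smooth_ext oD) (smoothM oD smooth_a smooth_a) => w _; rewrite expr2.
Qed.

Let dk w v d : D w -> dderiv a w v d -> dderiv k w v (- (a w * d) * (k w * k w * k w)).
Proof.
move=> Dw da; have dq : dderiv q w v ((d * a w + a w * d + 0) / (2 * q w)).
  apply: (dderiv_sqrt (f := fun w => a w ^+ 2 + 1) (a2_gt0 w)).
  apply: dderivD (dderiv_cst (1 : R^o) w v).
  exact: (dderivM da da).
apply: dderiv_eq (dderivV _ dq) _; first by rewrite gt_eqF.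
rewrite /k; have q0 : q w != 0 by rewrite gt_eqF.
by move: (q w) (a w) q0 => q' a' q0; field.
Qed.

Let dk1 w : D w -> dderiv k w (b1 w) (a w * N w * k w).
Proof.
move=> Dw; apply: dderiv_eq (dk Dw (da1 Dw)) _; have := kk w.
move: (k w) (a w) (N w) => k' a' N' kk'.
transitivity (a' * N' * k' * (k' * k' * (a' * a' + 1))); first by ring.
by rewrite kk' mulr1.
Qed.

Let dk2 w : D w -> dderiv k w (b2 w) 0.
Proof. by move=> Dw; apply: dderiv_eq (dk Dw (da2 Dw)) _; rewrite mulr0 oppr0 mul0r. Qed.

Let dC1 w : D w -> dderiv C w (b1 w) 0.
Proof.
move=> Dw; apply: dderiv_eq.
  exact: (dderivZ (dk1 Dw) (dderivB (dderivZ (da1 Dw) (dxi_nu Dw)) (dnu1 Dw))).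
apply: dot4_ext => c; rewrite !(dot4Dl, dot4Nl, dot4Zl, dot40l).
move: (k w) (a w) (N w) (dot4 (xi w) c) (dot4 (nu w) c) => k' a' N' p p'; ring.
Qed.

Let dC2 w : D w -> dderiv C w (b2 w) 0.
Proof.
move=> Dw; apply: dderiv_eq.
  exact: (dderivZ (dk2 Dw) (dderivB (dderivZ (da2 Dw) (dxi2' Dw)) (dnu2 Dw))).
apply: dot4_ext => c; rewrite !(dot4Dl, dot4Nl, dot4Zl, dot40l).
move: (k w) (a w) (dot4 (xi w) c) (dot4 (nu w) c) (dot4 (X2 w) c) => *; ring.
Qed.

Let dr1 w : D w -> dderiv r w (b1 w) 0.
Proof.
move=> Dw; apply: dderiv_eq.
  exact: (dderivZ (dk1 Dw) (dderivD (dxi_nu Dw) (dderivZ (da1 Dw) (dnu1 Dw)))).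
apply: dot4_ext => c; rewrite !(dot4Dl, dot4Nl, dot4Zl, dot40l).
move: (k w) (a w) (N w) (dot4 (xi w) c) (dot4 (nu w) c) => k' a' N' p p'; ring.
Qed.

Let dr2 w : D w -> dderiv r w (b2 w) (q w *: X2 w).
Proof.
move=> Dw; apply: dderiv_eq.
  exact: (dderivZ (dk2 Dw) (dderivD (dxi2' Dw) (dderivZ (da2 Dw) (dnu2 Dw)))).
apply: dot4_ext => c; rewrite !(dot4Dl, dot4Nl, dot4Zl, dot40l).
have := qq w; have := qk w.
move: (k w) (a w) (q w) (dot4 (nu w) c) (dot4 (xi w) c) (dot4 (X2 w) c) => k' a' q' p p' y qk1 qq1.
transitivity ((a' * a' + 1) * k' * y); first by ring.
by rewrite -qq1 -(mulrA q') qk1 mulr1.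
Qed.

Let nunu w : D w -> dot4 (nu w) (nu w) = 1.
Proof.
move=> Dw; rewrite dot4Dl dot4Nl 2!dot4Zl !dot4Dr !dot4Nr !dot4Zr.
rewrite o11// onn// o1n// on1//; have := sN1 Dw.
move: (s w) (N w) => s' N' sN'; transitivity (s' * s' + N' * N') => //; ring.
Qed.

Let nuxi w : D w -> dot4 (nu w) (xi w) = 0.
Proof. by move=> Dw; rewrite dot4Dl dot4Nl !dot4Zl o1x// onx// !mulr0 subr0. Qed.

Let nuX2 w : D w -> dot4 (nu w) (X2 w) = 0.
Proof. by move=> Dw; rewrite dot4Dl dot4Nl !dot4Zl o12// on2// !mulr0 subr0. Qed.

Let nuv w : D w -> dot4 (nu w) vt = 0.
Proof.
move=> Dw; rewrite dot4Dl dot4Nl !dot4Zl -[dot4 (X1 w) vt]/(s w) -[dot4 (n w) vt]/(N w).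
by rewrite mulrC subrr.
Qed.

Lemma rotational_structure :
  rotational_data D b1 b2 xi X1 X2 C r f rho N s l1 a.
Proof.
have dotC w p : dot4 (C w) p = k w * (a w * dot4 (xi w) p - dot4 (nu w) p).
  by rewrite dot4Zl dot4Dl dot4Nl dot4Zl.
have dotr w p : dot4 (r w) p = k w * (dot4 (xi w) p + a w * dot4 (nu w) p).
  by rewrite dot4Zl dot4Dl dot4Zl.
have sC : smooth_on D C.
  apply: (smoothZ oD) => //; apply: (smoothB oD); last exact: smooth_nu.
  by apply: (smoothZ oD) => //; exact: smooth_a.
have sr : smooth_on D r.
  apply: (smoothZ oD) => //; apply: (smoothD oD) => //.
  by apply: (smoothZ oD); [exact: smooth_a|exact: smooth_nu].
apply: (RotationalData sN ss smooth_a sC sr s_neq0 N_neq0 sN1 (fun _ _ => erefl)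
  X2_vert dN1 dN2 ds1 ds2 da1 da2 dC1 dC2 dr1 dr2 _ df1 bc1).
- by move=> w Dw; rewrite -(trace_l Dw) -l2E// addrK.
- move=> w Dw; rewrite dotC !(dot4C _ (C w)) !dotC oxx// (dot4C _ (nu w)) nuxi// nunu//.
  by have := kk w; move: (k w) (a w) => k' a' kk'; rewrite -[RHS]kk'; ring.
- move=> w Dw; rewrite dotr !(dot4C _ (r w)) !dotr oxx// (dot4C _ (nu w)) nuxi// nunu//.
  by have := kk w; move: (k w) (a w) => k' a' kk'; rewrite -[RHS]kk'; ring.
- move=> w Dw; rewrite dotC !(dot4C _ (r w)) !dotr oxx// (dot4C _ (nu w)) nuxi// nunu//.
  by move: (k w) (a w) => k' a'; ring.
- by move=> w Dw; rewrite dotC ox2// nuX2// mulr0 subr0 mulr0.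
- by move=> w Dw; rewrite dotr ox2// nuX2// mulr0 addr0 mulr0.
- exact: o22.
- by move=> w Dw; rewrite dotC oxv// nuv// mulr0 subr0 mulr0.
- by move=> w Dw; rewrite dotr oxv// nuv// mulr0 addr0 mulr0.
- move=> w Dw; apply: dot4_ext => c; rewrite dot4Zl dot4Dl dotr (dot4Zl (a w) (C w) c) dotC -/(q w) -/(k w).
  have := kk w; move: (k w) (a w) (dot4 (xi w) c) (dot4 (nu w) c) => k' a' p p' kk'.
  by rewrite -[LHS]mul1r -kk'; ring.
Qed.

End Structure.

#[local] Opaque derive dot4 horiz vert R4.

Lemma dderiv_coord (R : realType) (V : normedModType R) m (g : V -> 'rV[R]_m) w v dg j :
  dderiv g w v dg -> dderiv (fun w => g w 0 j : R^o) w v (dg 0 j).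
Proof.
have lin : linear (fun y : 'rV[R]_m => y 0 j : R^o) by move=> a x y; rewrite !mxE.
pose lM := GRing.isLinear.Build _ _ _ _ _ lin.
pose L : {linear _ -> _} := HB.pack (fun y : 'rV[R]_m => y 0 j : R^o) lM.
by move=> hg; apply: (dderiv_lin (L := L)) hg => y; exact: coord_continuous.
Qed.

Lemma dderiv_sum (R : realType) (V W : normedModType R) m (f : 'I_m -> V -> W) w v
    (df : 'I_m -> W) : (forall j, dderiv (f j) w v (df j)) ->
  dderiv (fun w => \sum_j f j w) w v (\sum_j df j).
Proof.
elim: m f df => [|m IH] f df h.
  rewrite big_ord0; apply: dderiv_near (dderiv_cst 0 w v).
  by apply: nearW => y; rewrite big_ord0.
rewrite big_ord_recl; apply: dderiv_near (dderivD (h ord0) (IH _ _ (fun j => h (lift ord0 j)))).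
by apply: nearW => y; rewrite big_ord_recl.
Qed.

(** * Brackets of vector fields given in coordinates *)

Section Commutator.
Variables (R : realType) (n : nat) (D : set 'rV[R]_n) (W : normedModType R).
Hypothesis oD : open D.
Variable F : 'rV[R]_n -> W.
Hypothesis sF : smooth_on D F.
Hypothesis symF : forall i j w, D w -> 'D_(delta_mx 0 i) ('D_(delta_mx 0 j) F) w =
  'D_(delta_mx 0 j) ('D_(delta_mx 0 i) F) w.

Lemma dderiv_dir (b : 'rV[R]_n -> 'rV[R]_n) w v db : dderiv b w v db -> D w ->
  dderiv (fun y => 'D_(b y) F y) w v ('D_db F w + \sum_i \sum_j
    (b w 0 i * v 0 j) *: 'D_(delta_mx 0 j) ('D_(delta_mx 0 i) F) w).
Proof.
move=> hb Dw.
have E y : D y -> \sum_i (b y 0 i : R^o) *: 'D_(delta_mx 0 i) F y = 'D_(b y) F y.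
  by move=> Dy; exact: (esym (derive_rV _ (smooth_diff sF Dy))).
have di i := dderivZ (dderiv_coord i hb)
  (dderiv_diff v (smooth_diff (smooth_derive i sF) Dw)).
apply: dderiv_eq (dderiv_on oD Dw E (dderiv_sum di)) _.
apply: etrans (big_split _ _ _ _ _) _.
apply: (congr2 +%R).
  exact: (esym (derive_rV _ (smooth_diff sF Dw))).
apply: eq_bigr => i _.
apply: etrans (congr1 (fun p => (b w 0 i) *: p)
  (derive_rV _ (smooth_diff (smooth_derive i sF) Dw))) _.
apply: etrans (scaler_sumr _ _ _ _) _.
by apply: eq_bigr => j _; exact: scalerA.
Qed.

(** The second-order terms of the two iterated derivatives cancel by symmetry; the first-order terms
    form the bracket [d12 - d21]. *)
Lemma commutator (b1 b2 : 'rV[R]_n -> 'rV[R]_n) w d12 d21 A B :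
  dderiv b2 w (b1 w) d12 -> dderiv b1 w (b2 w) d21 -> D w ->
  dderiv (fun y => 'D_(b2 y) F y) w (b1 w) A ->
  dderiv (fun y => 'D_(b1 y) F y) w (b2 w) B ->
  A - B = 'D_(d12 - d21) F w.
Proof.
move=> h12 h21 Dw hA hB.
have EA := dderiv_uniq hA (dderiv_dir h12 Dw).
have EB := dderiv_uniq hB (dderiv_dir h21 Dw).
have dF := smooth_diff sF Dw.
have ED : 'D_(d12 - d21) F w = 'D_d12 F w - 'D_d21 F w.
  apply: etrans (deriveDv _ _ dF) _; apply: (congr1 (fun p => 'D_d12 F w + p)).
  apply: etrans (congr1 (fun v => 'D_v F w) (esym (scaleN1r _))) _.
  exact: etrans (deriveZv _ _ dF) (scaleN1r _).
apply: etrans (congr2 (fun p q => p - q) EA EB) _; apply: etrans _ (esym ED).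
have sw (p q r r' : W) : r = r' -> p + r - (q + r') = p - q.
  by move=> ->; rewrite opprD addrACA subrr addr0.
apply: sw; apply: etrans (exchange_big _ _ _ _ _ _) _.
apply: eq_bigr => i _; apply: eq_bigr => j _.
exact: (congr2 *:%R (mulrC _ _) (symF _ _ Dw)).
Qed.

End Commutator.

Lemma orthonormal_free (R : realType) (p q : R4 R) (a b : R) : dot4 p p = 1 ->
  dot4 q q = 1 -> dot4 p q = 0 -> a *: p + b *: q = 0 -> a = 0 /\ b = 0.
Proof.
move=> pp qq pq E; have qp := etrans (dot4C q p) pq.
have E1 := congr1 (fun r => dot4 r p) E; have E2 := congr1 (fun r => dot4 r q) E.
move: E1 E2; rewrite !dot4Dl !dot4Zl !dot40l pp qq pq qp.
by rewrite !mulr1 !mulr0 addr0 add0r.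
Qed.

Lemma dot4_comb_eq0 (R : realType) (p q r y : R4 R) (a b c : R) : c != 0 ->
  c *: y = a *: p + b *: q -> dot4 r p = 0 -> dot4 r q = 0 -> dot4 r y = 0.
Proof.
move=> c0 E rp rq; have := congr1 (dot4 r) E.
rewrite dot4Zr dot4Dr !dot4Zr rp rq !mulr0 addr0 => /eqP.
by rewrite mulf_eq0 (negbTE c0) => /eqP.
Qed.

(** * From the adapted frame to the structure equations *)

Section Bridge.
Variable R : realType.
Variables (D : set 'rV[R]_2) (x n : 'rV[R]_2 -> R4 R) (b1 b2 : 'rV[R]_2 -> 'rV[R]_2).
Variables f rho : 'rV[R]_2 -> R^o.
Hypothesis AF : adapted_frame D x n b1 b2 f rho.
Let LS := af_surface AF.
Let oD := ls_open LS.
Let sx := ls_smooth LS.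
Let X1 w := 'D_(b1 w) x w.
Let X2 w := 'D_(b2 w) x w.
Let n1 w := 'D_(b1 w) n w.
Let n2 w := 'D_(b2 w) n w.
Let Y11 w := 'D_(b1 w) X1 w.
Let Y12 w := 'D_(b1 w) X2 w.
Let Y21 w := 'D_(b2 w) X1 w.
Let Y22 w := 'D_(b2 w) X2 w.

Let det w := b1 w 0 0 * b2 w 0 1 - b1 w 0 1 * b2 w 0 0.

(** Free of division, since [det_neq0] applies it under the assumption [det w = 0]. *)
Let cramer w (v : 'rV[R]_2) : det w *: v =
  (v 0 0 * b2 w 0 1 - v 0 1 * b2 w 0 0) *: b1 w + (b1 w 0 0 * v 0 1 - b1 w 0 1 * v 0 0) *: b2 w.
Proof.
by apply/rowP; apply: ord2P; rewrite !mxE /det; ring.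
Qed.

Let Dcomb w a b : D w -> 'D_(a *: b1 w + b *: b2 w) x w = a *: X1 w + b *: X2 w.
Proof.
move=> Dw; have dx := smooth_diff sx Dw.
exact: (etrans (deriveDv _ _ dx) (congr2 +%R (deriveZv _ _ dx) (deriveZv _ _ dx))).
Qed.

Let o11 w : D w -> dot4 (X1 w) (X1 w) = 1. Proof. exact: (af_11 AF). Qed.
Let o22 w : D w -> dot4 (X2 w) (X2 w) = 1. Proof. exact: (af_22 AF). Qed.
Let o12 w : D w -> dot4 (X1 w) (X2 w) = 0. Proof. exact: (af_12 AF). Qed.

Let comb_eq0 w a b : D w -> a *: X1 w + b *: X2 w = 0 -> a = 0 /\ b = 0.
Proof. by move=> Dw; exact: orthonormal_free (o11 Dw) (o22 Dw) (o12 Dw). Qed.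

Let det_neq0 w : D w -> det w != 0.
Proof.
move=> Dw; apply/eqP => d0.
have D0 : 'D_0 x w = 0 := etrans (congr1 (fun v => 'D_v x w) (esym (scale0r 0)))
   (etrans (deriveZv _ _ (smooth_diff sx Dw)) (scale0r _)).
have K (v : 'rV[R]_2) : v 0 0 * b2 w 0 1 - v 0 1 * b2 w 0 0 = 0.
  have E := cramer w v; rewrite d0 scale0r in E.
  exact: (comb_eq0 Dw (etrans (esym (Dcomb _ _ Dw)) (etrans (congr1 (fun v => 'D_v x w) (esym E)) D0))).1.
have b2_0 : b2 w = 0.
  apply/rowP; apply: ord2P; rewrite [RHS]mxE.
    by have := K (delta_mx 0 1); rewrite !mxE /= mul0r sub0r mul1r => /eqP; rewrite oppr_eq0 => /eqP.
  by have := K (delta_mx 0 0); rewrite !mxE /= mul0r subr0 mul1r.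
have X20 : X2 w = 0 := etrans (congr1 (fun v => 'D_v x w) b2_0) D0.
have := etrans (esym (o22 Dw)) (etrans (congr1 (fun p => dot4 p p) X20) (dot40l _)).
by move/eqP; rewrite oner_eq0.
Qed.

Let tangent_eq0 w p v : D w -> dot4 p (X1 w) = 0 -> dot4 p (X2 w) = 0 -> dot4 p ('D_v x w) = 0.
Proof.
move=> Dw p1 p2; have dx := smooth_diff sx Dw.
have E : det w *: 'D_v x w = _ *: X1 w + _ *: X2 w :=
  etrans (esym (deriveZv _ _ dx)) (etrans (congr1 (fun v => 'D_v x w) (cramer w v)) (Dcomb _ _ Dw)).
exact: (dot4_comb_eq0 (det_neq0 Dw) E p1 p2).
Qed.

Let complete w p q : D w -> dot4 p (X1 w) = dot4 q (X1 w) ->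
  dot4 p (X2 w) = dot4 q (X2 w) -> dot4 p (n w) = dot4 q (n w) ->
  dot4 p (horiz (x w)) = dot4 q (horiz (x w)) -> p = q.
Proof.
move=> Dw E1 E2 E3 E4; apply: subr0_eq.
have sw y : dot4 p y = dot4 q y -> dot4 (p - q) y = 0.
  by move=> E; rewrite dot4Dl dot4Nl E subrr.
apply: (frame_eq0 LS Dw) (sw _ E3) (sw _ E4) => i.
exact: (tangent_eq0 _ Dw (sw _ E1) (sw _ E2)).
Qed.

Let dir_X2 w v c : D w -> 'D_v x w = c *: X2 w -> v = c *: b2 w.
Proof.
move=> Dw E; apply: subr0_eq; apply/eqP; apply/negPn/negP => nz.
move/negP: (ls_immersion LS Dw nz); apply; apply/eqP.
have dx := smooth_diff sx Dw.
have E' : 'D_(v - c *: b2 w) x w = 'D_v x w - c *: X2 w.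
  apply: etrans (deriveDv _ _ dx) _; apply: (congr1 (fun p => 'D_v x w + p)).
  apply: etrans (congr1 (fun v => 'D_v x w) (esym (scaleNr _ _))) _.
  exact: etrans (deriveZv _ _ dx) (scaleNr _ _).
exact: (etrans E' (etrans (congr1 (fun p => p - c *: X2 w) E) (subrr _))).
Qed.

Let sb1 := af_b1 AF.
Let sb2 := af_b2 AF.
Let sX1 : smooth_on D X1. Proof. exact: (smooth_dir oD sx sb1). Qed.
Let sX2 : smooth_on D X2. Proof. exact: (smooth_dir oD sx sb2). Qed.

(** Applied to the immersion itself, [commutator] identifies the bracket in coordinates, because the
    differential of [x] is injective; the result is then applied to [F]. *)
Let comm (W : normedModType R)
   (symW : forall (F : 'rV[R]_2 -> W) i j w, smooth_on D F -> D w ->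
     'D_(delta_mx 0 i) ('D_(delta_mx 0 j) F) w = 'D_(delta_mx 0 j) ('D_(delta_mx 0 i) F) w)
   (F G1 G2 : 'rV[R]_2 -> W) w A B c : D w ->
  smooth_on D F -> (forall y, D y -> dderiv F y (b1 y) (G1 y)) ->
  (forall y, D y -> dderiv F y (b2 y) (G2 y)) ->
  dderiv G2 w (b1 w) A -> dderiv G1 w (b2 w) B ->
  Y12 w - Y21 w = c *: X2 w -> A - B = c *: G2 w.
Proof.
move=> Dw sF dF1 dF2 dA dB E.
have h12 := dderiv_smooth (b1 w) sb2 Dw; have h21 := dderiv_smooth (b2 w) sb1 Dw.
have Ex := commutator oD sx (fun i j w Dw => schwarz4 oD i j sx Dw) h12 h21 Dw
  (dderiv_smooth (b1 w) sX2 Dw) (dderiv_smooth (b2 w) sX1 Dw).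
have Ed := dir_X2 Dw (etrans (esym Ex) E).
have E1 y : D y -> G1 y = 'D_(b1 y) F y by move=> Dy; exact: (esym (dderiv_val (dF1 y Dy))).
have E2 y : D y -> G2 y = 'D_(b2 y) F y by move=> Dy; exact: (esym (dderiv_val (dF2 y Dy))).
have EF := commutator oD sF (fun i j w Dw => symW F i j w sF Dw) h12 h21 Dw
  (dderiv_on oD Dw E2 dA) (dderiv_on oD Dw E1 dB).
apply: etrans EF _; apply: etrans (congr1 (fun v => 'D_v F w) Ed) _.
apply: etrans (deriveZv _ _ (smooth_diff sF Dw)) _.
exact: (congr1 (fun p => c *: p) (esym (E2 w Dw))).
Qed.

Lemma frame_rotational : exists C r N s l a,
  rotational_data D b1 b2 (fun w => horiz (x w)) X1 X2 C r f rho N s l a.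
Proof.
have srho : smooth_on D rho.
  exact: (smooth_ext oD (fun w Dw => af_rho AF Dw) (smooth_dir oD (af_f AF) sb1)).
have sn1 : smooth_on D n1 by exact: (smooth_dir oD (ls_normal_smooth LS) sb1).
have sn2 : smooth_on D n2 by exact: (smooth_dir oD (ls_normal_smooth LS) sb2).
have df1 w : D w -> dderiv f w (b1 w) (rho w).
  by move=> Dw; exact: (dderiv_eq (dderiv_smooth (b1 w) (af_f AF) Dw) (af_rho AF Dw)).
have df2 w : D w -> dderiv f w (b2 w) 0.
  by move=> Dw; exact: (dderiv_eq (dderiv_smooth (b2 w) (af_f AF) Dw) (af_f2 AF Dw)).
do 6!eexists.
apply: (@rotational_structure R D b1 b2 (fun w => horiz (x w)) n X1 X2 n1 n2 Y11 Y12 Y21 Y22 f rho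
  oD (smooth_xi LS) (ls_normal_smooth LS) sX1 sX2 sn1 sn2 srho o11 o22 o12 (ls_unit LS)
  (fun w Dw => ls_normal LS (b1 w) Dw) (fun w Dw => ls_normal LS (b2 w) Dw)
  (fun w Dw => xi_unit LS Dw) (fun w Dw => etrans (dot4C _ _) (ls_normal_horiz LS Dw))
  (fun w Dw => etrans (dot4C _ _) (dx_xi LS (b1 w) Dw))
  (fun w Dw => etrans (dot4C _ _) (dx_xi LS (b2 w) Dw))
  (fun w Dw => horiz_vert (x w)) complete
  (fun w Dw => dderiv_xi LS (b1 w) Dw) (fun w Dw => dderiv_xi LS (b2 w) Dw)
  (fun w Dw => dderiv_n LS (b1 w) Dw) (fun w Dw => dderiv_n LS (b2 w) Dw)
  (fun w Dw => dderiv_smooth (b1 w) sX1 Dw) (fun w Dw => dderiv_smooth (b1 w) sX2 Dw)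
  (fun w Dw => dderiv_smooth (b2 w) sX1 Dw) (fun w Dw => dderiv_smooth (b2 w) sX2 Dw)
  (af_h12 AF) (af_h21 AF) (af_trace AF) (af_f_gt0 AF) (af_rho_gt0 AF) df1 df2
  (af_bc1 AF) (af_bc2 AF)
  (comm (fun F i j w sF Dw => schwarz4 oD i j sF Dw))
  (comm (fun F i j w sF Dw => schwarz oD i j sF Dw))).
Qed.

Lemma frame_span w (v : 'rV[R]_2) : D w -> exists c c', v = c *: b1 w + c' *: b2 w.
Proof.
move=> Dw; have E := congr1 (fun y => (det w)^-1 *: y) (cramer w v).
rewrite scalerA mulVf ?det_neq0// scale1r scalerDr !scalerA in E.
by do 2!eexists; exact: E.
Qed.

End Bridge.

(** * Functions of one variable *)

#[local] Opaque derive.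

Section OneVariable.
Variable R : realType.
Implicit Types f F U : R -> R.

Lemma dderiv_is_derive1 f (t d : R) : is_derive t 1 (f : R -> R) d ->
  dderiv (f : R^o -> R^o) t 1 d.
Proof. by case=> df fd; split=> //; exact/derivable1_diffP. Qed.

Lemma dderiv_continuous (f : R -> R) (t d : R) : dderiv (f : R^o -> R^o) t 1 d ->
  {for t, continuous f}.
Proof. by case=> df _; exact: differentiable_continuous. Qed.

Lemma exists_primitive f (c d : R) : 0 < d ->
  (forall t, `|c - t| < d -> {for t, continuous f}) ->
  exists U, forall t, `|c - t| < d / 2 -> dderiv (U : R^o -> R^o) t 1 (f t).
Proof.
(* The integral must start strictly to the left of the points considered and stay where [f] is
   continuous: 3/4 lies between 1/2 and 1. *)
move=> d0 cf; pose p := c - d * (3 / 4); pose q := c + d * (3 / 4).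
exists (fun t => \int[lebesgue_measure]_(y in `[p, t]) f y)%R => t.
rewrite ltr_norml => /andP[t1 t2]; apply: dderiv_is_derive1.
have tq : t < q by rewrite /q; lra.
have fi : lebesgue_measure.-integrable `[p, q] (EFin \o f).
  apply: continuous_compact_integrable; first exact: segment_compact.
  apply: continuous_in_subspaceT => y; rewrite inE /= in_itv /= => /andP[py yq].
  by apply: cf; rewrite /p in py; rewrite /q in yq; rewrite ltr_norml; lra.
have pt : p < t by rewrite /p; lra.
have ct : {for t, continuous f} by apply: cf; rewrite ltr_norml; lra.
have [dU Ut] := continuous_FTC1_closed tq fi pt ct.
exact: (DeriveDef dU (etrans (esym (derive1E _ _)) Ut)).
Qed.

Lemma oriented_integral_primitive f F (p q x y : R) :
  (forall t, p < t < q -> {for t, continuous f}) ->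
  (forall t, p < t < q -> dderiv (F : R^o -> R^o) t 1 (f t)) ->
  p < x < q -> p < y < q -> oriented_integral f x y = F y - F x.
Proof.
move=> cf dF.
have main a b : p < a < q -> p < b < q -> a < b ->
    Rintegral lebesgue_measure `[a, b] f = F b - F a.
  move=> /andP[pa aq] /andP[pb bq] ab.
  have cF t : p < t < q -> {for t, continuous F} by move=> /dF; exact: dderiv_continuous.
  have := @continuous_FTC2 _ f F a b ab; rewrite /Rintegral => -> //.
  - apply: continuous_in_subspaceT => t; rewrite inE /= in_itv /= => /andP[a_t t_b].
    by apply: cf; rewrite (lt_le_trans pa)// (le_lt_trans t_b).
  - split.
    + move=> t; rewrite in_itv /= => /andP[a_t t_b].
      apply/derivable1_diffP; have [] // := dF t _.
      by rewrite (lt_trans pa)// (lt_trans t_b).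
    + by apply: cvg_at_right_filter; apply: cF; rewrite pa.
    + by apply: cvg_at_left_filter; apply: cF; rewrite pb.
  - move=> t; rewrite in_itv /= => /andP[a_t t_b]; rewrite derive1E.
    by apply: dderiv_val (dF t _); rewrite (lt_trans pa)// (lt_trans t_b).
move=> xI yI; rewrite /oriented_integral; case: (ltgtP x y) => [xy|yx|->].
- exact: main.
- by rewrite main// opprB.
- by rewrite set_itv1 Rintegral_set1 subrr.
Qed.

Lemma open_oo (p q : R) : open [set t : R^o | p < t < q].
Proof.
have -> : [set t : R^o | p < t < q] = [set` `]p, q[%R] by apply/seteqP; split=> t; rewrite /= in_itv.
exact: (@interval_open R (BRight p) (BLeft q)).
Qed.

Lemma derive1_near f (g : R -> R) (p q u d : R) : p < u < q ->
  (forall t, p < t < q -> f t = g t) -> dderiv (f : R^o -> R^o) u 1 d -> derive1 g u = d.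
Proof.
move=> upq fg df; rewrite derive1E; apply: dderiv_val.
exact: (dderiv_on (@open_oo p q) upq fg df).
Qed.

End OneVariable.

(** * Constancy on balls and along segments *)

Section Ball.
Variables (R : realType) (n : nat).
Implicit Types c x v w : 'rV[R]_n.

Lemma ball_segment c d w v (h t : R) : ball c d w -> ball c d (w + h *: v) ->
  0 <= t <= h -> ball c d (w + t *: v).
Proof.
rewrite mx_norm_ball /ball_ /=; have [->|h0] := eqVneq h 0.
  move=> cw _ /andP[t0 t1]; have -> : t = 0 by apply/le_anti; rewrite t1.
  by rewrite scale0r addr0.
move=> cw cwh /andP[t0 th]; have hp : 0 < h by rewrite lt_neqAle eq_sym h0 (le_trans t0 th).
have -> : c - (w + t *: v) = (1 - t / h) *: (c - w) + (t / h) *: (c - (w + h *: v)).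
  by apply/rowP => i; rewrite !mxE; field.
have s0 : 0 <= t / h by apply: divr_ge0 => //; exact: ltW.
have s1 : 0 <= 1 - t / h by rewrite subr_ge0 ler_pdivrMr// mul1r.
apply: (le_lt_trans (ler_normD _ _)); rewrite 2!normrZ (ger0_norm s0) (ger0_norm s1).
have [m [m1 m2 m3]] : exists m, [/\ m < d, `|c - w| <= m & `|c - (w + h *: v)| <= m].
  exists (Num.max `|c - w| `|c - (w + h *: v)|); split.
  - by rewrite gt_max cw cwh.
  - by rewrite le_max lexx.
  - by rewrite le_max lexx orbT.
apply: le_lt_trans m1; have -> : m = (1 - t / h) * m + t / h * m by ring.
by apply: lerD; apply: ler_wpM2l.
Qed.

Lemma constant_along (F : 'rV[R]_n -> R^o) c d w v (h : R) :
  (forall y, ball c d y -> dderiv F y v 0) -> ball c d w -> ball c d (w + h *: v) ->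
  F (w + h *: v) = F w.
Proof.
wlog h0 : w h / 0 <= h => [wl|] dF cw cwh.
  have [h0|/ltW h0] := leP 0 h; first exact: wl.
  have e : w + h *: v + (- h) *: v = w by rewrite scaleNr addrK.
  by rewrite -[in RHS]e; apply/esym; apply: wl; rewrite ?oppr_ge0// e.
have [t t01] := @mean_value R _ F w v h h0 (fun t th => (dF _ (ball_segment cw cwh th)).1).
rewrite (dF _ (ball_segment cw cwh t01)).2 mulr0 => /eqP.
by rewrite subr_eq0 => /eqP.
Qed.

Lemma constant_on_ball (F : 'rV[R]_n -> R^o) c d x y :
  (forall w v, ball c d w -> dderiv F w v 0) -> ball c d x -> ball c d y -> F x = F y.
Proof.
move=> dF cx cy; have e : y = x + 1 *: (y - x) by rewrite scale1r addrC subrK.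
rewrite e in cy *; apply/esym; apply: constant_along cx cy => w; exact: dF.
Qed.

End Ball.

Section Line.
Variable R : realType.

Definition row2 (u v : R) : 'rV[R]_2 := \row_j (if j == 0 then u else v).

Lemma row2E u v t : row2 (u + t) v = row2 u v + t *: delta_mx 0 0.
Proof.
apply/rowP => -[[|[|i]] hi] //; rewrite !mxE ?eqxx /=.
  by rewrite mulr1.
by rewrite mulr0 addr0.
Qed.

Lemma row2E' u v t : row2 u (v + t) = row2 u v + t *: delta_mx 0 1.
Proof.
apply/rowP => -[[|[|i]] hi] //; rewrite !mxE ?eqxx /=.
  by rewrite mulr0 addr0.
by rewrite mulr1.
Qed.

Lemma row20 u v : row2 u v 0 0 = u. Proof. by rewrite mxE. Qed.
Lemma row21 u v : row2 u v 0 1 = v. Proof. by rewrite mxE. Qed.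

Lemma ball_row2 (c w : 'rV[R]_2) d : 0 < d ->
  ball c d w <-> `|c 0 0 - w 0 0| < d /\ `|c 0 1 - w 0 1| < d.
Proof.
move=> d0; split; first by case=> _ h; split; exact: h.
by move=> [h0 h1]; split=> // i j; rewrite ord1; case: j => -[|[|]]// hj;
  [move: h0|move: h1]; rewrite /ball /=; congr (`| c _ _ - w _ _| < d); exact: val_inj.
Qed.

Lemma dderiv_row2 (W : normedModType R) (H : 'rV[R]_2 -> W) u v d :
  dderiv H (row2 u v) (delta_mx 0 0) d -> dderiv (fun t : R^o => H (row2 t v)) u 1 d.
Proof.
move=> dH.
have e t : row2 0 v + t *: delta_mx 0 0 = row2 t v by rewrite -row2E add0r.
have dl := dderiv_line (row2 0 v) (delta_mx 0 0 : 'rV[R]_2) (u : R^o).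
have dl' : dderiv (fun t : R^o => row2 t v) u 1 (delta_mx 0 0 : 'rV[R]_2).
  exact: (dderiv_on openT I (fun t _ => e t) dl).
exact: (dderiv_comp dl' dH).
Qed.

Lemma smooth_line (E : set 'rV[R]_2) (H : 'rV[R]_2 -> R^o) (p q v : R) :
  smooth_on E H -> (forall u, p < u < q -> E (row2 u v)) ->
  smooth_on_line `]p, q[ (fun u => H (row2 u v)).
Proof.
pose de (f : 'rV[R]_2 -> R^o) : 'rV[R]_2 -> R^o := 'D_(delta_mx 0 0) f.
move=> sH EI k u; rewrite /= in_itv /= => uI.
have dk j t : p < t < q -> dderiv (fun t : R^o => iter j de H (row2 t v) : R^o) t 1
    (iter j.+1 de H (row2 t v)).
  move=> tI; apply: dderiv_row2; split=> //.
  have := sH (nseq j 0) _ (EI t tI).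
  have -> // : foldr (fun i g => 'D_(delta_mx 0 i) g) H (nseq j 0) = iter j de H.
  by elim: j => //= j ->.
have E' j t : p < t < q -> derive1n j (fun u => H (row2 u v)) t = iter j de H (row2 t v).
  elim: j t => [//|j IH] t tI; rewrite derive1nS.
  by apply: (derive1_near tI _ (dk j t tI)) => y yI; rewrite IH.
apply/derivable1_diffP.
suff [] : dderiv (derive1n k (fun u => H (row2 u v)) : R^o -> R^o) u 1
   (iter k.+1 de H (row2 u v)) by [].
by apply: dderiv_on (@open_oo R p q) uI _ (dk k u uI) => t tI; rewrite E'.
Qed.

End Line.

(** * The rotation axis *)

#[local] Transparent dot4 vert.

Section Euclid.
Variable R : realType.
Implicit Types x y z : 'rV[R]_3.

Lemma dot3E x y : dot x y = x 0 0 * y 0 0 + x 0 1 * y 0 1 + x 0 (1 + 1) * y 0 (1 + 1).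
Proof.
rewrite /dot !big_ord_recl big_ord0 addr0 addrA.
by congr (_ * _ + _ * _ + _ * _); congr (_ _ _); exact: val_inj.
Qed.

Lemma cross0 x y : cross x y 0 0 = x 0 1 * y 0 (1 + 1) - x 0 (1 + 1) * y 0 1.
Proof. by rewrite mxE; congr (_ * _ - _ * _); congr (_ _ _); exact: val_inj. Qed.
Lemma cross1 x y : cross x y 0 1 = x 0 (1 + 1) * y 0 0 - x 0 0 * y 0 (1 + 1).
Proof. by rewrite mxE; congr (_ * _ - _ * _); congr (_ _ _); exact: val_inj. Qed.
Lemma cross2 x y : cross x y 0 (1 + 1) = x 0 0 * y 0 1 - x 0 1 * y 0 0.
Proof. by rewrite mxE; congr (_ * _ - _ * _); congr (_ _ _); exact: val_inj. Qed.

Lemma ord3P (Q : 'I_3 -> Prop) : Q 0 -> Q 1 -> Q (1 + 1) -> forall i, Q i.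
Proof.
move=> q0 q1 q2 [[|[|[|i]]] hi] //; [move: q0|move: q1|move: q2];
  by congr Q; exact: val_inj.
Qed.

Lemma dot_cross_cross x y : dot (cross x y) (cross x y) = dot x x * dot y y - dot x y * dot x y.
Proof. by rewrite !dot3E cross0 cross1 cross2; ring. Qed.

Lemma dot_crossl x y : dot (cross x y) x = 0.
Proof. by rewrite !dot3E cross0 cross1 cross2; ring. Qed.

Lemma dot_crossr x y : dot (cross x y) y = 0.
Proof. by rewrite !dot3E cross0 cross1 cross2; ring. Qed.

Lemma cross_cross x y : cross y (cross x y) = dot y y *: x - dot y x *: y.
Proof.
apply/rowP; apply: ord3P; rewrite ?cross0 ?cross1 ?cross2 ![in RHS]mxE !dot3E ?cross0 ?cross1 ?cross2.
- ring.
- ring.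
- ring.
Qed.

(** The matrix [Q] with these rows satisfies [Q Q^T = 1], hence also [Q^T Q = 1], which is the
    expansion. *)
Lemma orthonormal_expansion (x y z p : 'rV[R]_3) : dot x x = 1 -> dot y y = 1 -> dot z z = 1 ->
  dot x y = 0 -> dot x z = 0 -> dot y z = 0 ->
  p = dot p x *: x + dot p y *: y + dot p z *: z.
Proof.
move=> xx yy zz xy xz yz.
pose Q : 'M[R]_3 := \matrix_(i, j) (if i == 0 then x 0 j else if i == 1 then y 0 j else z 0 j).
have dotQ (u v : 'rV[R]_3) : (u *m v^T) 0 0 = dot u v by rewrite mxE; apply: eq_bigr => k _; rewrite mxE.
have QQ : Q *m Q^T = 1%:M.
  have E i j : (Q *m Q^T) i j = dot (row i Q) (row j Q) by rewrite mxE; apply: eq_bigr => k _; rewrite !mxE.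
  have r0 : row 0 Q = x by apply/rowP => k; rewrite !mxE.
  have r1 : row 1 Q = y by apply/rowP => k; rewrite !mxE.
  have r2 : row (1 + 1) Q = z by apply/rowP => k; rewrite !mxE.
  apply/matrixP; apply: ord3P; apply: ord3P; rewrite E ?r0 ?r1 ?r2 ?xx ?yy ?zz ?xy ?xz ?yz ?mxE //=.
  - by rewrite dotC.
  - by rewrite dotC.
  - by rewrite dotC.
rewrite -[LHS]mulmx1 -(mulmx1C QQ) mulmxA; apply/rowP => j; rewrite !mxE.
rewrite !big_ord_recl big_ord0 addr0 addrA.
have E i : (p *m Q^T) 0 i = dot p (row i Q) by rewrite mxE; apply: eq_bigr => k _; rewrite !mxE.
have e1 : lift ord0 (ord0 : 'I_2) = 1 :> 'I_3 by exact: val_inj.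
have e2 : lift ord0 (lift ord0 (ord0 : 'I_1)) = 1 + 1 :> 'I_3 by exact: val_inj.
have r0 : row ord0 Q = x by apply/rowP => k; rewrite !mxE.
have r1 : row 1 Q = y by apply/rowP => k; rewrite !mxE.
have r2 : row (1 + 1) Q = z by apply/rowP => k; rewrite !mxE.
by rewrite !E e1 e2 r0 r1 r2 !mxE.
Qed.

Lemma dot4_horizontal (p q : R4 R) : dot4 q (vert R) = 0 -> dot4 p q = dot p.1 q.1.
Proof. by rewrite dot4_vert /dot4 => ->; rewrite mulr0 addr0. Qed.

Lemma fst_combination (p q y : R4 R) (t c c' d : R) :
  (t *: (c *: p + c' *: q + d *: y)).1 = (c * t) *: p.1 + (c' * t) *: q.1 + (d * t) *: y.1.
Proof.
by rewrite -[LHS]/(t *: (c *: p.1 + c' *: q.1 + d *: y.1)) !scalerDr !scalerA !(mulrC t).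
Qed.

Lemma horizontal_frame (c1 c3 : R4 R) : dot4 c1 c1 = 1 -> dot4 c3 c3 = 1 ->
  dot4 c3 c1 = 0 -> dot4 c1 (vert R) = 0 -> dot4 c3 (vert R) = 0 ->
  exists c2 : R4 R, [/\ dot4 c2 c2 = 1, dot4 c1 c2 = 0, dot4 c2 (vert R) = 0,
      cross c1.1 c2.1 = c3.1 &
    forall p : R4 R, dot4 p (vert R) = 0 -> dot4 p c3 = 0 -> p = dot4 p c1 *: c1 + dot4 p c2 *: c2].
Proof.
have hor (p : R4 R) : dot4 p (vert R) = 0 -> p = (p.1, 0).
  by rewrite dot4_vert; case: p => p t /= ->.
have d4 (p q : R4 R) := @dot4_horizontal p q.
move=> c11 c33 c31 c1v c3v; rewrite d4// in c11; rewrite d4// in c33; rewrite d4// in c31.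
(* This order of the factors makes the triple positively oriented, so that [c1 x c2] is [c3] and not
   its opposite. *)
pose y := cross c3.1 c1.1.
have yv : dot4 ((y, 0) : R4 R) (vert R) = 0 by exact: (dot4_vert (y, 0)).
pose c2 : R4 R := (y, 0).
exists c2.
have yy : dot y y = 1 by rewrite dot_cross_cross c11 c33 c31 mulr0 subr0 mulr1.
have y1 : dot c1.1 y = 0 by rewrite dotC dot_crossr.
have y3 : dot y c3.1 = 0 by rewrite dot_crossl.
have c22 : dot4 c2 c2 = 1 := etrans (d4 c2 c2 yv) yy.
have c12 : dot4 c1 c2 = 0 := etrans (d4 c1 c2 yv) y1.
split; [exact: c22 | exact: c12 | exact: yv | |].
  apply: etrans (cross_cross _ _) _.
  by rewrite c11 (dotC c1.1) c31 scale1r scale0r subr0.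
move=> p pv p3; have {}p3 := etrans (esym (d4 p _ c3v)) p3.
rewrite (d4 p c1 c1v) (d4 p c2 yv) (hor p pv) {2}(hor c1 c1v).
apply: (congr2 (fun (a : 'rV[R]_3) (b : R^o) => (a, b))); last first.
  by apply: esym; apply: etrans (congr2 +%R (mulr0 _) (mulr0 _)) (addr0 _).
apply: etrans (orthonormal_expansion p.1 c11 yy c33 y1 _ y3) _.
  by rewrite dotC.
by rewrite p3 scale0r addr0.
Qed.

Lemma PhiE (p : R4 R) (C1 C2 : 'rV[R]_3) (a theta : R -> R) (u0 u v h : R) :
  p.1 = (cos v / Num.sqrt (a u ^+ 2 + 1)) *: C1 + (sin v / Num.sqrt (a u ^+ 2 + 1)) *: C2
    + (a u / Num.sqrt (a u ^+ 2 + 1)) *: cross C1 C2 ->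
  dot4 p (vert R) = oriented_integral (fun t => cos (theta t)) u0 u + h ->
  p = vertical_translation h (Phi C1 C2 a theta u0 u v).
Proof. by rewrite dot4_vert; case: p => p t /= -> ->. Qed.

End Euclid.

(** * The adapted coordinates *)

#[local] Opaque derive dot4 horiz vert R4.

Section Directions.
Variables (R : realType) (V W : normedModType R).
Implicit Types (f : V -> W) (w u v : V).

Lemma dderiv_scale f w v d (c : R) : dderiv f w v d -> dderiv f w (c *: v) (c *: d).
Proof. by case=> df fd; split=> //; exact: etrans (deriveZv _ _ df) (congr1 _ fd). Qed.

Lemma dderiv_comb f w u v d d' (c c' : R) : dderiv f w u d -> dderiv f w v d' ->
  dderiv f w (c *: u + c' *: v) (c *: d + c' *: d').
Proof.
move=> hu hv; have [df] := hu; split=> //.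
apply: etrans (deriveDv _ _ df) _.
exact: (congr2 +%R (dderiv_val (dderiv_scale c hu)) (dderiv_val (dderiv_scale c' hv))).
Qed.

End Directions.

Lemma dderiv_real_comp (R : realType) (V W : normedModType R) (U : R^o -> W) (t : V -> R^o) w v
    (dt : R^o) c :
  dderiv t w v dt -> dderiv U (t w) 1 c -> dderiv (fun w => U (t w)) w v (dt *: c).
Proof.
move=> ht hU; have hU' : dderiv U (t w) dt (dt *: c).
  by rewrite -[X in dderiv _ _ X]mulr1; exact: (dderiv_scale dt hU).
exact: (dderiv_comp ht hU').
Qed.


Section Row2.
Variables (R : realType) (V : normedModType R).

Lemma row2_delta (p q : R) : row2 p q = p *: delta_mx 0 0 + q *: delta_mx 0 1.
Proof.
apply/rowP; apply: ord2P; rewrite !mxE ?eqxx /=.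
  by rewrite mulr1 mulr0 addr0.
by rewrite mulr0 mulr1 add0r.
Qed.

Lemma dderiv_pair (f g : V -> R^o) w v df dg : dderiv f w v df -> dderiv g w v dg ->
  dderiv (fun w => row2 (f w) (g w)) w v (row2 df dg).
Proof.
move=> hf hg.
have h := dderivD (dderivZ hf (dderiv_cst (delta_mx 0 0 : 'rV[R]_2) w v))
                  (dderivZ hg (dderiv_cst (delta_mx 0 1 : 'rV[R]_2) w v)).
have E : df *: delta_mx 0 0 + f w *: 0 + (dg *: delta_mx 0 1 + g w *: 0) = row2 df dg.
  by rewrite !scaler0 !addr0 -row2_delta.
exact: (dderiv_on openT I (fun y _ => esym (row2_delta (f y) (g y))) (dderiv_eq h E)).
Qed.

End Row2.

Lemma smooth_pair (R : realType) (D : set 'rV[R]_2) (f g : 'rV[R]_2 -> R^o) : open D ->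
  smooth_on D f -> smooth_on D g -> smooth_on D (fun w => row2 (f w) (g w)).
Proof.
move=> oD sf sg; apply/(smooth_coord oD) => j.
apply: (smooth_ext oD (f := fun w => (if j == 0 then f w else g w) : R^o)).
  by move=> w _; rewrite mxE.
by case: (j == 0).
Qed.

(** For a function such as a composite with a primitive, whose partial derivatives are known smooth
    functions while only differentiability of the function itself is at hand. *)
Lemma smooth_intro (R : realType) (W : normedModType R) n (D : set 'rV[R]_n) (f : 'rV[R]_n -> W)
    (df : 'I_n -> 'rV[R]_n -> W) : open D ->
  (forall w i, D w -> dderiv f w (delta_mx 0 i) (df i w)) ->
  (forall w, D w -> differentiable f w) ->
  (forall i, smooth_on D (df i)) -> smooth_on D f.
Proof.
move=> oD hf diff sdf; apply/smooth_onP; case=> [|k]; first by split.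
apply: (Ck_intro oD (df := df)) => //.
  by move=> w i Dw; exact: dderiv_val (hf w i Dw).
by move=> i; have /smooth_onP := sdf i; apply.
Qed.

Lemma sin_atan (R : realType) (x : R) : sin (atan x) = x * cos (atan x).
Proof.
rewrite -{2}[x]atanK /tan divfK// cos_atan invr_eq0 gt_eqF// sqrtr_gt0 ltr_pwDl// sqr_ge0//.
Qed.

(* The half-turn handles the half-plane [p < 0], where [atan (q / p)] is off by [pi]. *)
Lemma cos_sin_angle (R : realType) (p q p0 : R) : p * p + q * q = 1 -> 0 < p * p0 ->
  let t := atan (q / p) + (if 0 < p0 then 0 else pi) in cos t = p /\ sin t = q.
Proof.
move=> pq pp0 /=.
have p_neq0 : p != 0 by apply: contraTneq pp0 => ->; rewrite mul0r ltxx.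
have E : 1 + (q / p) ^+ 2 = (p^-1) ^+ 2.
  have -> : (p^-1) ^+ 2 = (p * p + q * q) * (p^-1) ^+ 2 by rewrite pq mul1r.
  by field.
have C : cos (atan (q / p)) = `|p| by rewrite cos_atan E sqrtr_sqr normfV invrK.
have S : sin (atan (q / p)) = q / p * `|p| by rewrite sin_atan C.
case: ifP => h.
  have p_gt0 : 0 < p by rewrite pmulr_lgt0 in pp0.
  by rewrite addr0 C S gtr0_norm// divfK.
have p_lt0 : p < 0.
  have : p0 <= 0 by rewrite leNgt h.
  rewrite le_eqVlt => /orP[/eqP p00|p00]; first by rewrite p00 mulr0 ltxx in pp0.
  by rewrite nmulr_lgt0 in pp0.
by rewrite cosDpi sinDpi C S ltr0_norm// opprK mulrN opprK divfK.
Qed.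

Section PairChart.
Variables (R : realType) (E : set 'rV[R]_2) (b1 b2 : 'rV[R]_2 -> 'rV[R]_2).
Variables u v p q : 'rV[R]_2 -> R^o.
Hypotheses (oE : open E) (sb1 : smooth_on E b1) (sb2 : smooth_on E b2).
Hypotheses (su : smooth_on E u) (sv : smooth_on E v) (sp : smooth_on E p) (sq : smooth_on E q).
Hypotheses (p_neq0 : forall w, E w -> p w != 0) (q_neq0 : forall w, E w -> q w != 0).
Hypotheses (du1 : forall w, E w -> dderiv u w (b1 w) (p w))
  (du2 : forall w, E w -> dderiv u w (b2 w) 0)
  (dv1 : forall w, E w -> dderiv v w (b1 w) 0)
  (dv2 : forall w, E w -> dderiv v w (b2 w) (q w)).
Let F w := row2 (u w) (v w).

(** In the frame the Jacobian of [(u, v)] is diagonal with entries [p], [q], so [b1 / p] and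
    [b2 / q] are the fields that [inverse_function] asks for. They become the coordinate fields of
    the new chart. *)
Lemma pair_chart w0 : E w0 -> exists (W : set 'rV[R]_2) (g : 'rV[R]_2 -> 'rV[R]_2) d,
  [/\ 0 < d, open W, W w0 & W `<=` E] /\
  [/\ forall w, W w -> ball (F w0) d (F w) /\ g (F w) = w,
      forall y, ball (F w0) d y -> W (g y) /\ F (g y) = y,
      smooth_on (ball (F w0) d) g,
      forall y, ball (F w0) d y -> dderiv g y (delta_mx 0 0) ((p (g y))^-1 *: b1 (g y)) &
      forall y, ball (F w0) d y -> dderiv g y (delta_mx 0 1) ((q (g y))^-1 *: b2 (g y))].
Proof.
move=> Ew0.
pose B (j : 'I_2) w : 'rV[R]_2 := if j == 0 then (p w)^-1 *: b1 w else (q w)^-1 *: b2 w.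
have sB j : smooth_on E (B j).
  rewrite /B; case: (j == 0); apply: (smoothZ oE) => //; exact: (smoothV oE).
have FB w j : E w -> 'D_(B j w) F w = delta_mx 0 j.
  move=> Ew; move: j; apply: ord2P.
    apply: etrans (dderiv_val (dderiv_scale (p w)^-1 (dderiv_pair (du1 Ew) (dv1 Ew)))) _.
    by rewrite row2_delta scale0r addr0 scalerA mulVf ?scale1r// p_neq0.
  apply: etrans (dderiv_val (dderiv_scale (q w)^-1 (dderiv_pair (du2 Ew) (dv2 Ew)))) _.
  by rewrite row2_delta scale0r add0r scalerA mulVf ?scale1r// q_neq0.
have [W [g [d [h [hF hg sg dg]]]]] := inverse_function oE (smooth_pair oE su sv) sB FB Ew0.
exists W, g, d; split; first exact: h.
split; [exact: hF | exact: hg | exact: sg | |].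
  by move=> y By; split; [exact: (smooth_diff sg By) | exact: (dg y 0 By)].
by move=> y By; split; [exact: (smooth_diff sg By) | exact: (dg y 1 By)].
Qed.

End PairChart.

(** * Construction of the local parametrization *)

Section Model.
Variable R : realType.
Variables (w0 : 'rV[R]_2) (e : R).
Let D : set 'rV[R]_2 := ball w0 e.
Variables (b1 b2 : 'rV[R]_2 -> 'rV[R]_2) (x X1 X2 C r : 'rV[R]_2 -> R4 R).
Variables f rho N s l a : 'rV[R]_2 -> R^o.
Hypothesis e_gt0 : 0 < e.
Hypothesis RD : rotational_data D b1 b2 (fun w => horiz (x w)) X1 X2 C r f rho N s l a.
Hypotheses (sx : smooth_on D x) (sX2 : smooth_on D X2).
Hypotheses (sb1 : smooth_on D b1) (sb2 : smooth_on D b2).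
Hypothesis span : forall w v, D w -> exists c c', v = c *: b1 w + c' *: b2 w.
Hypothesis dx1 : forall w, D w -> dderiv x w (b1 w) (X1 w).
Hypothesis dx2 : forall w, D w -> dderiv x w (b2 w) (X2 w).
Local Notation vt := (vert R).

Let oD : open D.
Proof. exact: ball_open. Qed.
Let Dw0 : D w0.
Proof. exact: ballxx. Qed.

(** The derivative of [C] vanishes along both frame fields, hence in every direction, and the ball
    [D] is convex. *)
Let C_const w : D w -> C w = C w0.
Proof.
move=> Dw; apply: dot4_ext => c.
apply: (constant_on_ball (F := fun w => dot4 (C w) c : R^o) (c := w0) (d := e)) => // y v Dy.
have [p [q ->]] := span v Dy.
apply: dderiv_eq (dderiv_dot4 (dderiv_comb p q (rd_dC1 RD Dy) (rd_dC2 RD Dy)) (dderiv_cst c y _)) _.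
by rewrite !scaler0 addr0 dot40l dot40r addr0.
Qed.

(** Taking [C1] to be the value of [r] at [w0] gives it angle 0 there, so nearby it lies in the
    half-plane where [atan] measures the angle. [C2] is chosen so that [cross C1 C2] is the constant
    axis [C]. *)
Lemma angle_function : exists (E : set 'rV[R]_2) (v mu : 'rV[R]_2 -> R^o) (C1 C2 : 'rV[R]_3),
  [/\ open E, E w0, E `<=` D & forall w, E w -> 0 < s w * s w0] /\
  [/\ smooth_on E v, smooth_on E mu, forall w, E w -> mu w != 0,
      forall w, E w -> dderiv v w (b1 w) 0 & forall w, E w -> dderiv v w (b2 w) (mu w)] /\
  [/\ dot C1 C1 = 1, dot C2 C2 = 1 & dot C1 C2 = 0] /\
  forall w, E w -> (x w).1 = (cos (v w) / Num.sqrt (a w ^+ 2 + 1)) *: C1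
    + (sin (v w) / Num.sqrt (a w ^+ 2 + 1)) *: C2 + (a w / Num.sqrt (a w ^+ 2 + 1)) *: cross C1 C2.
Proof.
pose c1 := r w0.
have [c2 [c22 c12 c2v cr expand]] := horizontal_frame (rd_rr RD Dw0) (rd_CC RD Dw0)
  (rd_Cr RD Dw0) (rd_rv RD Dw0) (rd_Cv RD Dw0).
pose al w : R^o := dot4 (r w) c1; pose be w : R^o := dot4 (r w) c2.
pose y1 w : R^o := dot4 (X2 w) c1; pose y2 w : R^o := dot4 (X2 w) c2.
have CC w p : D w -> dot4 (C w) p = 0 -> dot4 p (C w0) = 0.
  by move=> Dw; rewrite (C_const Dw) dot4C.
have rE w : D w -> r w = al w *: c1 + be w *: c2.
  by move=> Dw; exact: (expand (r w) (rd_rv RD Dw) (CC w (r w) Dw (rd_Cr RD Dw))).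
have X2E w : D w -> X2 w = y1 w *: c1 + y2 w *: c2.
  by move=> Dw; exact: (expand (X2 w) (rd_X2v RD Dw) (CC w (X2 w) Dw (rd_CX RD Dw))).
have lin p p1 p2 : dot4 (p1 *: c1 + p2 *: c2) p = p1 * dot4 p c1 + p2 * dot4 p c2 :> R.
  by rewrite dot4Dl !dot4Zl (dot4C c1) (dot4C c2).
have ab1 w : D w -> al w * al w + be w * be w = 1.
  move=> Dw; have := congr1 (fun p => dot4 p (r w)) (rE w Dw).
  by rewrite (rd_rr RD Dw) lin => <-.
have yy1 w : D w -> y1 w * y1 w + y2 w * y2 w = 1.
  move=> Dw; have := congr1 (fun p => dot4 p (X2 w)) (X2E w Dw).
  by rewrite (rd_XX RD Dw) lin => <-.
have ay w : D w -> al w * y1 w + be w * y2 w = 0.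
  move=> Dw; have := congr1 (fun p => dot4 p (X2 w)) (rE w Dw).
  by rewrite (rd_rX RD Dw) lin => <-.
pose q w : R^o := Num.sqrt (a w ^+ 2 + 1).
have a2_gt0 w : 0 < a w ^+ 2 + 1 by rewrite ltr_wpDl// sqr_ge0.
have q_gt0 w : 0 < q w by rewrite sqrtr_gt0.
(* The derivative along [X2] of the polar angle of [(al, be)], since [r] has derivative
   [q *: X2]. *)
pose mu w : R^o := q w * (al w * y2 w - be w * y1 w).
have sr := rd_smooth_r RD; have sc (c : R4 R) : smooth_on D (fun=> c) := smooth_cst oD c.
have sal : smooth_on D al by exact: (smooth_dot4 oD).
have sbe : smooth_on D be by exact: (smooth_dot4 oD).
have sy1 : smooth_on D y1 by exact: (smooth_dot4 oD).
have sy2 : smooth_on D y2 by exact: (smooth_dot4 oD).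
have sq : smooth_on D q.
  apply: (smooth_sqrt oD) => //; apply: (smoothD oD); last exact: smooth_cst.
  apply: (smooth_ext oD) (smoothM oD (rd_smooth_a RD) (rd_smooth_a RD)) => w _.
  by rewrite expr2.
have smu : smooth_on D mu.
  by apply: (smoothM oD) => //; apply: (smoothB oD); exact: (smoothM oD).
pose sn w : R^o := s w * s w0.
have ssn : smooth_on D sn.
  by apply: (smoothM oD); [exact: rd_smooth_s RD | exact: smooth_cst].
have pos_open (h : 'rV[R]_2 -> R^o) : smooth_on D h -> open [set w | D w /\ 0 < h w].
  move=> sh; have oP : open [set y : R^o | 0 < y] := @open_gt R 0.
  exact: (open_preimage_on oD (fun w Dw => differentiable_continuous (smooth_diff sh Dw)) oP).
(* The first condition makes [atan (be / al)] the angle of [r]; the second keeps the sign of [s]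
   constant, which fixes the branch of [theta]. *)
pose E : set 'rV[R]_2 := [set w | D w /\ 0 < al w] `&` [set w | D w /\ 0 < sn w].
have ED : E `<=` D by move=> w [[]].
have al_gt0 w : E w -> 0 < al w by move=> [[]].
have al0 w : E w -> al w != 0 by move=> Ew; rewrite gt_eqF// al_gt0.
have oE : open E by apply: openI; exact: pos_open.
pose v w : R^o := atan (be w / al w).
have d4 (p p' : R4 R) := @dot4_horizontal R p p'.
exists E, v, mu, c1.1, c2.1; split; [split|split; [split|split; [split|]]].
- exact: oE.
- split; split=> //; first by rewrite /al (rd_rr RD Dw0) ltr01.
  by rewrite /sn lt_neqAle eq_sym mulf_neq0 ?(rd_s_neq0 RD Dw0)//= -expr2 sqr_ge0.
- exact: ED.
- by move=> w [_ []].
- apply: (smooth_atan oE); apply: (smooth_div oE) => //.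
    exact: smooth_sub sbe.
  exact: smooth_sub sal.
- exact: smooth_sub smu.
- move=> w Ew; apply: mulf_neq0; first by rewrite gt_eqF.
  have Dw := ED _ Ew; have := ab1 w Dw; have := yy1 w Dw; have := ay w Dw.
  move: (al w) (be w) (y1 w) (y2 w) => A B Y Z h1 h2 h3; apply/eqP => h.
  (* Lagrange's identity for the orthogonal unit vectors [(A, B)] and [(Y, Z)]: their determinant
     has square 1. *)
  have : (A * A + B * B) * (Y * Y + Z * Z) = (A * Y + B * Z) ^+ 2 + (A * Z - B * Y) ^+ 2 by ring.
  by rewrite h1 h2 h3 h expr0n /= addr0 mul1r => /eqP; rewrite oner_eq0.
- move=> w Ew; have Dw := ED _ Ew.
  have dal := dderiv_dot4 (rd_dr1 RD Dw) (dderiv_cst c1 w (b1 w)).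
  have dbe := dderiv_dot4 (rd_dr1 RD Dw) (dderiv_cst c2 w (b1 w)).
  apply: dderiv_eq (dderiv_atan (dderivM dbe (dderivV (al0 w Ew) dal))) _.
  by rewrite !dot40l !dot40r !addr0 oppr0 !mul0r mulr0 addr0 mul0r.
- move=> w Ew; have Dw := ED _ Ew.
  have dal := dderiv_dot4 (rd_dr2 RD Dw) (dderiv_cst c1 w (b2 w)).
  have dbe := dderiv_dot4 (rd_dr2 RD Dw) (dderiv_cst c2 w (b2 w)).
  apply: dderiv_eq (dderiv_atan (dderivM dbe (dderivV (al0 w Ew) dal))) _.
  rewrite !dot40r !addr0 !dot4Zl -/(q w) -/(al w) -/(be w) -/(y1 w) -/(y2 w) /mu.
  have := ab1 w Dw; have := al0 w Ew.
  move: (al w) (be w) (y1 w) (y2 w) (q w) => A B Y Z Q A0 AB.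
  have -> : 1 + (B / A) ^+ 2 = (A ^+ 2)^-1.
    have -> : (A ^+ 2)^-1 = (A * A + B * B) * (A ^+ 2)^-1 by rewrite AB mul1r.
    by field.
  by field.
- exact: (etrans (esym (d4 c1 c1 (rd_rv RD Dw0))) (rd_rr RD Dw0)).
- exact: (etrans (esym (d4 c2 c2 c2v)) c22).
- exact: (etrans (esym (d4 c1 c2 c2v)) c12).
- move=> w Ew; have Dw := ED _ Ew.
  (* Here the reference sign is that of 1, so the half-turn correction is 0. *)
  have [cv sv] := cos_sin_angle (ab1 w Dw) (mulr_gt0 (al_gt0 w Ew) ltr01).
  rewrite ltr01 addr0 in cv sv.
  have E1 : (x w).1 = (horiz (x w)).1 by rewrite horizE.
  apply: etrans E1 _; apply: etrans (congr1 fst (rd_xi RD Dw)) _.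
  apply: etrans (congr1 (fun p : R4 R => ((Num.sqrt (a w ^+ 2 + 1))^-1 *: (p + a w *: C w)).1) (rE w Dw)) _.
  rewrite (C_const Dw) cr /v cv sv -/(q w).
  exact: fst_combination.
Qed.

Section Theta.
Variable E : set 'rV[R]_2.
Hypotheses (oE : open E) (ED : E `<=` D) (sE : forall w, E w -> 0 < s w * s w0).

(** The branch is chosen by the sign of [s] at the centre, so the half-turn is a constant and does
    not affect derivatives. *)
Definition theta w : R^o := atan (N w / s w) + (if 0 < s w0 then 0 else pi).

Lemma smooth_theta : smooth_on E theta.
Proof.
apply: (smoothD oE); last exact: smooth_cst.
apply: (smooth_atan oE); apply: (smooth_div oE).
- move=> w Ew; exact: (rd_s_neq0 RD (ED Ew)).
- exact: (smooth_sub ED (rd_smooth_N RD)).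
- exact: (smooth_sub ED (rd_smooth_s RD)).
Qed.

Lemma cos_sin_theta w : E w -> cos (theta w) = s w /\ sin (theta w) = N w.
Proof. by move=> Ew; apply: cos_sin_angle (sE Ew); exact: (rd_sN RD (ED Ew)). Qed.

Lemma dtheta w v ds dN : E w -> dderiv s w v ds -> dderiv N w v dN ->
  dderiv theta w v (dN * s w - N w * ds).
Proof.
move=> Ew hs hN; have Dw := ED Ew; have s0 := rd_s_neq0 RD Dw.
apply: dderiv_eq (dderivD (dderiv_atan (dderivM hN (dderivV s0 hs))) (dderiv_cst _ w v)) _.
have := rd_sN RD Dw; rewrite addr0; move: (s w) (N w) s0 => A B A0 AB.
have -> : 1 + (B / A) ^+ 2 = (A ^+ 2)^-1.
  have -> : (A ^+ 2)^-1 = (A * A + B * B) * (A ^+ 2)^-1 by rewrite AB mul1r.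
  by field.
by field.
Qed.

Lemma dtheta1 w : E w -> dderiv theta w (b1 w) (- l w).
Proof.
move=> Ew; have Dw := ED Ew.
apply: dderiv_eq (dtheta Ew (rd_ds1 RD Dw) (rd_dN1 RD Dw)) _.
have := rd_sN RD Dw; move: (s w) (N w) (l w) => A B L AB.
by transitivity (- L * (A * A + B * B)); [ring | rewrite AB mulr1].
Qed.

End Theta.


Let t w : R^o := dot4 (x w) vt.

Let dt1 w : D w -> dderiv t w (b1 w) (s w).
Proof.
move=> Dw; apply: dderiv_eq (dderiv_dot4 (dx1 Dw) (dderiv_cst vt w (b1 w))) _.
by rewrite dot40r addr0 (rd_s RD Dw).
Qed.

Let dt2 w : D w -> dderiv t w (b2 w) 0.
Proof.
move=> Dw; apply: dderiv_eq (dderiv_dot4 (dx2 Dw) (dderiv_cst vt w (b2 w))) _.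
by rewrite dot40r addr0 (rd_X2v RD Dw).
Qed.

Let st : smooth_on D t.
Proof. by apply: (smooth_dot4 oD) => //; exact: smooth_cst. Qed.

Section Arclength.
Variables (E : set 'rV[R]_2) (v mu : 'rV[R]_2 -> R^o).
Hypotheses (oE : open E) (Ew0 : E w0) (ED : E `<=` D).
Hypotheses (sv : smooth_on E v) (smu : smooth_on E mu) (mu_neq0 : forall w, E w -> mu w != 0).
Hypotheses (dv1 : forall w, E w -> dderiv v w (b1 w) 0)
  (dv2 : forall w, E w -> dderiv v w (b2 w) (mu w)).

(** In the chart [(t, v)] the function [s] is constant along the second coordinate, since
    [X2 s = 0]; thus [s = S (t)] nearby. With [U' = 1 / S], the function [U (t)] has derivative
    [s / s] along [X1] and 0 along [X2]. *)
Lemma arclength_function : exists (W : set 'rV[R]_2) (u : 'rV[R]_2 -> R^o),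
  [/\ open W, W w0 & W `<=` E] /\
  [/\ smooth_on W u, forall w, W w -> dderiv u w (b1 w) 1 &
      forall w, W w -> dderiv u w (b2 w) 0].
Proof.
have sE (U : normedModType R) (h : 'rV[R]_2 -> U) : smooth_on D h -> smooth_on E h.
  exact: smooth_sub ED.
have s0 w : D w -> s w != 0 := fun Dw => rd_s_neq0 RD Dw.
have [W [g [d [[d0 oW Ww0 WE] [hF hg sg dg1 dg2]]]]] := pair_chart oE (sE _ _ sb1) (sE _ _ sb2)
  (sE _ _ st) sv (sE _ _ (rd_smooth_s RD)) smu (fun w Ew => s0 w (ED Ew)) mu_neq0
  (fun w Ew => dt1 (ED Ew)) (fun w Ew => dt2 (ED Ew)) dv1 dv2 Ew0.
pose y0 := row2 (t w0) (v w0).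
pose H y : R^o := s (g y).
have dH1 y : ball y0 d y -> dderiv H y (delta_mx 0 0) ((s (g y))^-1 * (l (g y) * N (g y))).
  move=> By; have [Wg _] := hg y By; have Dg := ED (WE _ Wg).
  exact: (dderiv_comp (dg1 y By) (dderiv_scale _ (rd_ds1 RD Dg))).
have dH2 y : ball y0 d y -> dderiv H y (delta_mx 0 1) 0.
  move=> By; have [Wg _] := hg y By; have Dg := ED (WE _ Wg).
  apply: dderiv_eq (dderiv_comp (dg2 y By) (dderiv_scale _ (rd_ds2 RD Dg))) _.
  exact: scaler0.
(* [s] as a function of the height, read on the slice of constant [v] through the centre. *)
pose S (tau : R) : R := H (row2 tau (v w0)).
have Bt tau : `|t w0 - tau| < d -> ball y0 d (row2 tau (v w0)).
  by move=> h; apply/(ball_row2 _ _ d0); rewrite !row20 !row21 subrr normr0.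
have sS w : W w -> S (t w) = s w.
  move=> Ww; have [BF gF] := hF w Ww.
  have [Bt0 Bv0] := (ball_row2 _ _ d0).1 BF; rewrite !row20 in Bt0.
  have E1 : row2 (t w) (v w) = row2 (t w) (v w0) + (v w - v w0) *: delta_mx 0 1.
    by rewrite -row2E' addrC subrK.
  have := @constant_along R 2 H y0 d (row2 (t w) (v w0)) (delta_mx 0 1) (v w - v w0) dH2 (Bt _ Bt0).
  by rewrite -E1 => /(_ BF); rewrite /H gF => ->.
have dS tau : `|t w0 - tau| < d -> exists c, dderiv (S : R^o -> R^o) tau 1 c.
  by move=> h; eexists; exact: (dderiv_row2 (dH1 _ (Bt tau h))).
have S0 tau : `|t w0 - tau| < d -> S tau != 0.
  by move=> h; have [Wg _] := hg _ (Bt tau h); exact: (s0 _ (ED (WE _ Wg))).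
have [U dU] : exists U, forall tau, `|t w0 - tau| < d / 2 ->
    dderiv (U : R^o -> R^o) tau 1 (S tau)^-1.
  apply: exists_primitive => // tau h; have [c dc] := dS tau h.
  exact: (dderiv_continuous (dderivV (S0 tau h) dc)).
(* The primitive [U] is only available at half the radius. *)
pose W2 : set 'rV[R]_2 := W `&` t @^-1` ball (t w0) (d / 2).
have d2 : 0 < d / 2 by apply: divr_gt0.
have oW2 : open W2.
  exact: (open_preimage_on oW (fun w Ww => differentiable_continuous
    (smooth_diff st (ED (WE _ Ww)))) (ball_open (t w0) (d / 2))).
have W2W : W2 `<=` W by move=> w [].
have W2t w : W2 w -> `|t w0 - t w| < d / 2 by move=> [].
exists W2, (fun w => U (t w)).
have du w z dt : W2 w -> dderiv t w z dt -> dderiv (fun w => U (t w) : R^o) w z (dt / s w).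
  move=> Ww h; have := dderiv_real_comp h (dU _ (W2t w Ww)).
  by rewrite (sS _ (W2W _ Ww)).
split; [split|split].
- exact: oW2.
- by split=> //; exact: ballxx.
- by move=> w /W2W /WE.
- apply: (smooth_intro oW2 (df := fun i w => 'D_(delta_mx 0 i) t w / s w)).
  + move=> w i Ww; apply: (du _ _ _ Ww).
    exact: (dderiv_diff _ (smooth_diff st (ED (WE _ (W2W _ Ww))))).
  + by move=> w Ww; have [] := du w _ _ Ww (dt1 (ED (WE _ (W2W _ Ww)))).
  + move=> i; have W2D : W2 `<=` D by move=> w /W2W /WE /ED.
    apply: (smooth_div oW2).
    * by move=> w /W2D; exact: s0.
    * exact: (smooth_sub W2D (smooth_derive i st)).
    * exact: (smooth_sub W2D (rd_smooth_s RD)).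
- move=> w Ww; have Dw := ED (WE _ (W2W _ Ww)).
  by apply: dderiv_eq (du w _ _ Ww (dt1 Dw)) _; rewrite divff// s0.
- move=> w Ww; have Dw := ED (WE _ (W2W _ Ww)).
  by apply: dderiv_eq (du w _ _ Ww (dt2 Dw)) _; rewrite mul0r.
Qed.

End Arclength.

(** The left-hand side is four times the [X1] component of the biconservative equation. [a'], [s'],
    [l'], [p'] are the derivatives along [X1] of [a], [s], [l], [a s], kept in the shape in which
    the product rule delivers them. *)
Lemma profile_algebra (f0 rho0 l0 a0 s0 N0 : R) : l0 = 2 * f0 - a0 * s0 ->
  (l0 + f0) * rho0 + f0 * (N0 * s0) = 0 ->
  let a' := - (N0 * (1 + a0 * a0)) in let s' := l0 * N0 in
  let l' := 0 * f0 + 2 * rho0 - (a' * s0 + a0 * s') in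
  let p' := a' * s0 + a0 * s' in
  - 2 * f0 * (- 2 * rho0) + (a0 ^+ 2 + 1) *
    ((l' * l0 + l0 * l' - (p' * (a0 * s0) + a0 * s0 * p')) * (a0 ^+ 2 + 1)^-1
     + (l0 * l0 - a0 * s0 * (a0 * s0)) * (- (a' * a0 + a0 * a' + 0) / (a0 ^+ 2 + 1) ^+ 2)) = 0.
Proof.
move=> lE bc /=.
have a_neq0 : a0 ^+ 2 + 1 != 0 by rewrite gt_eqF// ltr_wpDl// sqr_ge0.
transitivity (4 * ((l0 + f0) * rho0 + f0 * (N0 * s0))); last by rewrite bc mulr0.
by rewrite lE; field.
Qed.

(** [pair_chart] is applied again, now to [(u, v)]. As [X1 u = 1], the first coordinate field is
    [X1] itself, so derivatives in [u] are derivatives along [X1] and the structure equations become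
    ordinary differential equations. *)
Lemma local_model : exists (C1 C2 : 'rV[R]_3) (a' th : R -> R) (u0 v0 h d : R)
    (W : set 'rV[R]_2) (F g : 'rV[R]_2 -> 'rV[R]_2),
  [/\ dot C1 C1 = 1, dot C2 C2 = 1 & dot C1 C2 = 0] /\
  [/\ 0 < d, open W, W w0, W `<=` D & F w0 = row2 u0 v0] /\
  [/\ smooth_on W F, smooth_on (ball (F w0) d) g,
      forall w, W w -> ball (F w0) d (F w) /\ g (F w) = w &
      forall y, ball (F w0) d y -> W (g y) /\ F (g y) = y] /\
  [/\ smooth_on_line `]u0 - d, u0 + d[ a', smooth_on_line `]u0 - d, u0 + d[ th &
    forall u : R, u0 - d < u < u0 + d ->
      let k := fun t => derive1 th t - a' t * cos (th t) in
      let g := fun t => (derive1 th t ^+ 2 - a' t ^+ 2 * cos (th t) ^+ 2) / (a' t ^+ 2 + 1) in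
      [/\ sin (th u) != 0, cos (th u) != 0, derive1 a' u + (a' u ^+ 2 + 1) * sin (th u) = 0
        & k u * derive1 k u + (a' u ^+ 2 + 1) * derive1 g u = 0]] /\
  forall u v : R, ball (F w0) d (row2 u v) ->
    x (g (row2 u v)) = vertical_translation h (Phi C1 C2 a' th u0 u v).
Proof.
have [E [v [mu [C1 [C2 [[oE Ew0 ED sE] [[sv smu mu0 dv1 dv2] [CC xE]]]]]]]] := angle_function.
have [W0 [u [[oW0 W0w0 W0E] [su du1 du2]]]] := arclength_function oE Ew0 ED sv smu mu0 dv1 dv2.
have W0D : W0 `<=` D by move=> w /W0E /ED.
have sub (U : normedModType R) (h : 'rV[R]_2 -> U) : smooth_on D h -> smooth_on W0 h.
  exact: smooth_sub W0D.
have [W [g [d [[d0 oW Ww0 WW0] [hF hg sg dg1 dg2]]]]] := pair_chart oW0 (sub _ _ sb1) (sub _ _ sb2)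
  su (smooth_sub W0E sv) (smooth_cst oW0 (1 : R^o)) (smooth_sub W0E smu)
  (fun _ _ => oner_neq0 _) (fun w h => mu0 w (W0E _ h)) du1 du2 (fun w h => dv1 w (W0E _ h))
  (fun w h => dv2 w (W0E _ h)) W0w0.
pose F w := row2 (u w) (v w).
pose B : set 'rV[R]_2 := ball (F w0) d.
have oB : open B by exact: ball_open.
(* The profile curve: the coordinate curve of [u] through the centre. *)
pose c t : 'rV[R]_2 := g (row2 t (v w0)).
have IB y : u w0 - d < y < u w0 + d -> B (row2 y (v w0)).
  move=> /andP[t1 t2]; apply/(ball_row2 _ _ d0).
  by rewrite !row20 !row21 subrr normr0 ltr_norml; split=> //; lra.
have BI y z : B (row2 y z) -> u w0 - d < y < u w0 + d.
  move=> /(ball_row2 _ _ d0)[]; rewrite !row20 ltr_norml => /andP[t1 t2] _; lra.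
have cW y : u w0 - d < y < u w0 + d -> W0 (c y).
  by move=> tI; apply: WW0; exact: (hg _ (IB y tI)).1.
have along (H h1 : 'rV[R]_2 -> R^o) : (forall w, W0 w -> dderiv H w (b1 w) (h1 w)) ->
    forall y, u w0 - d < y < u w0 + d -> dderiv (fun y : R^o => H (c y)) y 1 (h1 (c y)).
  move=> dH y tI; have dg := dg1 _ (IB y tI).
  have dg' : dderiv g (row2 y (v w0)) (delta_mx 0 0) (b1 (c y)).
    by apply: dderiv_eq dg _; rewrite invr1 scale1r.
  exact: (dderiv_row2 (dderiv_comp dg' (dH _ (cW y tI)))).
(* A function killed by [X2] depends on [u] alone, so it is determined by its values on the profile
   curve. *)
have indep (H : 'rV[R]_2 -> R^o) : (forall w, W0 w -> dderiv H w (b2 w) 0) ->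
    forall p z, B (row2 p z) -> H (g (row2 p z)) = H (c p).
  move=> dH p z Btz; have Bt := IB p (BI p z Btz).
  have E1 : row2 p z = row2 p (v w0) + (z - v w0) *: delta_mx 0 1.
    by rewrite -row2E' addrC subrK.
  rewrite E1 in Btz *.
  apply: (constant_along (F := H \o g)) Bt Btz => y By.
  have Wy := WW0 _ (hg y By).1.
  apply: dderiv_eq (dderiv_comp (dg2 y By) (dderiv_scale _ (dH _ Wy))) _.
  by rewrite scaler0.
have sline (H : 'rV[R]_2 -> R^o) : smooth_on W0 H ->
    smooth_on_line `]u w0 - d, u w0 + d[ (fun t => H (c t)).
  move=> sH; apply: (smooth_line (E := B) (H := H \o g)) => //.
  by apply: (smooth_comp oB _ sg sH) => y By; exact: WW0 _ (hg y By).1.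
have val (H h1 : 'rV[R]_2 -> R^o) : (forall w, W0 w -> dderiv H w (b1 w) (h1 w)) ->
    forall y, u w0 - d < y < u w0 + d -> derive1 (fun y => H (c y) : R) y = h1 (c y).
  by move=> dH y tI; exact: (derive1_near tI (fun _ _ => erefl) (along _ _ dH y tI)).
have da w : W0 w -> dderiv a w (b1 w) (- (N w * (1 + a w * a w))).
  by move=> h; exact: (rd_da1 RD (W0D _ h)).
have dth w : W0 w -> dderiv theta w (b1 w) (- l w).
  by move=> h; exact: (dtheta1 ED (W0E _ h)).
(* On all of [W0] the angle [theta] recovers both vertical components. *)
have cs w : W0 w -> cos (theta w) = s w /\ sin (theta w) = N w.
  by move=> h; exact: (cos_sin_theta ED sE (W0E _ h)).
have I0 : u w0 - d < u w0 < u w0 + d by lra.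
exists C1, C2, (fun t => a (c t)), (fun t => theta (c t)), (u w0), (v w0), (t w0), d, W, F, g.
split; [exact: CC | split; [by split=> // w /WW0 /W0D |split; [split|split; [split|]]]].
- by apply: (smooth_pair oW); [exact: smooth_sub su | exact: smooth_sub (smooth_sub W0E sv)].
- exact: sg.
- exact: hF.
- exact: hg.
- exact: (sline _ (sub _ _ (rd_smooth_a RD))).
- exact: (sline _ (smooth_sub W0E (smooth_theta oE ED))).
- move=> z zI k gg; have Wz := cW z zI; have Dz := W0D _ Wz.
  have [cz sz] := cs _ Wz; rewrite cz sz; split.
  + exact: (rd_N_neq0 RD Dz).
  + exact: (rd_s_neq0 RD Dz).
  + rewrite (val _ _ da z zI); move: (N _) (a _) => N' a'; ring.
  have lE y : u w0 - d < y < u w0 + d -> derive1 (fun t => theta (c t) : R) y = - (2 * f (c y) - a (c y) * s (c y)).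
    by move=> yI; rewrite (val _ _ dth y yI) (rd_l RD (W0D _ (cW y yI))).
  (* With [theta' = - l] and [l = 2 f - a s], the first factor of the differential equation is
     [- 2 f]. *)
  have kE y : u w0 - d < y < u w0 + d -> - 2 * f (c y) = k y.
    by move=> yI; rewrite /k lE// (cs _ (cW y yI)).1; move: (f _) (a _) (s _) => *; ring.
  pose K w : R^o := - 2 * f w.
  have dK w : W0 w -> dderiv K w (b1 w) (- 2 * rho w).
    move=> h; apply: dderiv_eq (dderivM (dderiv_cst (- 2 : R^o) w (b1 w)) (rd_df RD (W0D _ h))) _.
    by rewrite mul0r add0r.
  have k' : derive1 k z = - 2 * rho (c z) := derive1_near zI kE (along _ _ dK z zI).
  pose L w : R^o := 2 * f w - a w * s w.
  (* The quotient in the second differential equation, written on the surface through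
     [(theta')^2 = l^2] and [cos theta = s]. *)
  pose G w : R^o := (L w * L w - a w * s w * (a w * s w)) * (a w ^+ 2 + 1)^-1.
  have gE y : u w0 - d < y < u w0 + d -> G (c y) = gg y.
    by move=> yI; rewrite /gg lE// (cs _ (cW y yI)).1 /G /L; move: (f _) (a _) (s _) => *; congr (_ / _); ring.
  have a2_neq0 w : a w ^+ 2 + 1 != 0 by rewrite gt_eqF// ltr_wpDl// sqr_ge0.
  have dG w := fun h : W0 w =>
    let da := da w h in let ds := rd_ds1 RD (W0D _ h) in let das := dderivM da ds in
    let dL := dderivB (dderivM (dderiv_cst (2 : R^o) w (b1 w)) (rd_df RD (W0D _ h))) das in
    dderivM (dderivB (dderivM dL dL) (dderivM das das))
      (dderivV (f := fun w => a w ^+ 2 + 1) (a2_neq0 w)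
        (dderivD (dderivM da da) (dderiv_cst (1 : R^o) w (b1 w)))).
  have g' := derive1_near zI gE (along G _ dG z zI).
  rewrite -(kE z zI) k' g'.
  rewrite /L -(rd_l RD Dz).
  exact: (profile_algebra (rd_l RD Dz) (rd_bc RD Dz)).
- move=> p z Bp; have pI := BI _ _ Bp; have [Wg Fg] := hg _ Bp.
  have vz : v (g (row2 p z)) = z.
    by have := congr1 (fun y : 'rV[R]_2 => y 0 1) Fg; rewrite !row21.
  apply: PhiE.
    have := xE _ (W0E _ (WW0 _ Wg)); rewrite vz (indep a) // => w Ww.
    exact: (rd_da2 RD (W0D _ Ww)).
  have tE : t (g (row2 p z)) = t (c p) := indep t (fun w Ww => dt2 (W0D _ Ww)) p z Bp.
  apply: etrans tE _.
  have c0 : c (u w0) = w0 by exact: (hF _ Ww0).2.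
  have dT y : u w0 - d < y < u w0 + d -> dderiv (fun y : R^o => t (c y)) y 1 (cos (theta (c y)) : R^o).
    move=> yI; apply: dderiv_eq (along t s (fun w Ww => dt1 (W0D _ Ww)) y yI) _.
    by rewrite (cs _ (cW y yI)).1.
  have ccos y : u w0 - d < y < u w0 + d -> {for y, continuous (fun t => cos (theta (c t)) : R)}.
    move=> yI; have ct := dderiv_continuous (along theta _ dth y yI).
    exact: (continuous_comp ct (@continuous_cos R _)).
  rewrite (oriented_integral_primitive ccos dT I0 pI) c0 subrK.
  by [].
Qed.
End Model.

(** * Charts of the surface *)

Section RefineChart.
Variables (R : realType) (S : surface R) (c0 : chart R S) (W B : set 'rV[R]_2).
Variables F g : 'rV[R]_2 -> 'rV[R]_2.
Hypotheses (c0_atlas : atlas c0) (oW : open W) (oB : open B).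
Hypothesis W_img : W `<=` chart_img c0.
Hypotheses (sF : smooth_on W F) (sg : smooth_on B g).
Hypothesis WF : forall w, W w -> B (F w) /\ g (F w) = w.
Hypothesis Bg : forall y, B y -> W (g y) /\ F (g y) = y.

Let smooth_continuous (D : set 'rV[R]_2) (f : 'rV[R]_2 -> 'rV[R]_2) w :
  smooth_on D f -> D w -> {for w, continuous f}.
Proof. by move=> sf Dw; exact: (differentiable_continuous (smooth_diff sf Dw)). Qed.

Let dom : set S := chart_dom c0 `&` Defs.coord c0 @^-1` W.

Let dom_open : open dom.
Proof.
by apply: open_preimage_on oW; [exact: chart_dom_open | exact: Defs.coord_continuous].
Qed.

Let coordF : S -> 'rV[R]_2 := F \o Defs.coord c0.
Let paramg : 'rV[R]_2 -> S := param c0 \o g.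

Let coordF_img p : dom p -> B (coordF p).
Proof. by move=> [_ Wp]; exact: (WF Wp).1. Qed.

Let paramg_dom w : B w -> dom (paramg w).
Proof.
move=> Bw; have [Wg _] := Bg Bw; split; first exact: param_dom (W_img Wg).
by rewrite /preimage /= /paramg /= paramK//; exact: W_img.
Qed.

Let coordFK p : dom p -> paramg (coordF p) = p.
Proof. by move=> [dp Wp]; rewrite /paramg /coordF /= (WF Wp).2 coordK. Qed.

Let paramgK w : B w -> coordF (paramg w) = w.
Proof.
move=> Bw; have [Wg Fg] := Bg Bw; rewrite /paramg /coordF /= paramK//.
exact: W_img.
Qed.

Let coordF_continuous p : dom p -> {for p, continuous coordF}.
Proof.
move=> [dp Wp]; apply: continuous_comp; first exact: Defs.coord_continuous.
exact: smooth_continuous sF Wp.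
Qed.

Let paramg_continuous w : B w -> {for w, continuous paramg}.
Proof.
move=> Bw; have [Wg _] := Bg Bw; apply: continuous_comp; first exact: smooth_continuous sg Bw.
exact: param_continuous (W_img Wg).
Qed.

(** The chart [c0] followed by the diffeomorphism [F], on the part of its domain where [F] is
    invertible. *)
Definition refined_chart : chart R S := Chart dom_open oB coordF_img paramg_dom coordFK paramgK
  coordF_continuous paramg_continuous.

(** Its transition maps are those of [c0] composed with [F] or [g], hence smooth. *)
Lemma refined_chart_maximal : maximal_atlas refined_chart.
Proof.
move=> d d_atlas; split.
  apply: (smooth_comp (g := g) (f := Defs.coord d \o param c0) _ _ _ (atlas_smooth c0_atlas d_atlas)).
  - exact: (open_preimage_on oB paramg_continuous (chart_dom_open d)).
  - by move=> w [Bw dw]; split; [exact: W_img (Bg Bw).1 | exact: dw].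
  - by apply: smooth_sub sg => w [].
apply: (smooth_comp (g := Defs.coord c0 \o param d) (f := F) _ _ _ sF).
- exact: (open_preimage_on (@chart_img_open _ _ d) (@param_continuous _ _ d) dom_open).
- by move=> w [_ [_ Ww]]; exact: Ww.
- apply: smooth_sub (atlas_smooth d_atlas c0_atlas) => w [dw [cw _]].
  by split.
Qed.

End RefineChart.

Theorem theorem3p4 (R : realType) (S : surface R) (phi eta : S -> R4 R)
  (phi_immersion : immersion_in_S2xR phi)
  (eta_normal : unit_normal_field phi eta)
  (phi_biconservative : biconservative phi)
  (f_gt0 : everywhere (fun (x : 'rV[R]_2 -> S) w =>
     0 < mean_curvature (phi \o x) (eta \o x) w))
  (grad_f_neq0 : everywhere (fun (x : 'rV[R]_2 -> S) w =>
     gradient (phi \o x) (mean_curvature (phi \o x) (eta \o x)) w != 0))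
  (grad_f_principal : everywhere (fun (x : 'rV[R]_2 -> S) w =>
     principal_direction (phi \o x) (eta \o x) w
       (gradient (phi \o x) (mean_curvature (phi \o x) (eta \o x)) w))) :
  forall p : S,
  exists (C1 C2 : 'rV[R]_3) (a theta : R -> R) (u0 h u1 u2 v1 v2 : R)
         (c : chart R S),
    [/\ dot C1 C1 = 1, dot C2 C2 = 1 & dot C1 C2 = 0] /\
    u1 < u0 < u2 /\
    smooth_on_line `]u1, u2[ a /\
    smooth_on_line `]u1, u2[ theta /\
    (forall u : R, u1 < u < u2 ->
      let k := fun t => derive1 theta t - a t * cos (theta t) in
      let g := fun t => (derive1 theta t ^+ 2 - a t ^+ 2 * cos (theta t) ^+ 2)
                        / (a t ^+ 2 + 1) in
      [/\ sin (theta u) != 0,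
          cos (theta u) != 0,
          derive1 a u + (a u ^+ 2 + 1) * sin (theta u) = 0
        & k u * derive1 k u + (a u ^+ 2 + 1) * derive1 g u = 0]) /\
    maximal_atlas c /\
    chart_dom c p /\
    chart_img c = [set w : 'rV[R]_2 | u1 < w 0 0 < u2 /\ v1 < w 0 1 < v2] /\
    (forall u v : R, u1 < u < u2 -> v1 < v < v2 ->
      phi (param c (\row_j (if j == 0 then u else v)))
      = vertical_translation h (Phi C1 C2 a theta u0 u v)).
Proof.
move=> p.
have [c0 c0A c0p] := atlas_cover p.
pose w0 := Defs.coord c0 p.
have img0 : chart_img c0 w0 := coord_img c0p.
(* A ball inside the chart provides the convex domain on which vanishing derivatives imply
   constancy. *)
have [e e0 De] : exists2 e : R, 0 < e & ball w0 e `<=` chart_img c0.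
  by have /nbhs_ballP[e /= e0 eD] := open_nbhs_nbhs (conj (@chart_img_open _ _ c0) img0); exists e.
have [phi_on phi_smooth phi_imm] := phi_immersion.
have [eta_smooth eta_unit eta_hor eta_perp] := eta_normal.
pose x := phi \o param c0; pose n := eta \o param c0.
have LS : local_surface (ball w0 e) x n.
  split.
  - exact: ball_open.
  - exact: smooth_sub De (phi_smooth c0 c0A).
  - exact: smooth_sub De (eta_smooth c0 c0A).
  - by move=> w _; exact: (etrans (esym (dot_fst _ _)) (phi_on _)).
  - by move=> w b Dw; exact: phi_imm c0 c0A w (De w Dw) b.
  - by move=> w _; exact: eta_unit.
  - by move=> w _; exact: (etrans (esym (dot_fst _ _)) (eta_hor _)).
  - by move=> w b Dw; exact: eta_perp c0 c0A w (De w Dw) b.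
have [b1 [b2 [rho AF]]] := adapted_frame_exists LS
  (fun w Dw => f_gt0 c0 c0A w (De w Dw)) (fun w Dw => grad_f_neq0 c0 c0A w (De w Dw))
  (fun w Dw => grad_f_principal c0 c0A w (De w Dw))
  (fun w Dw => phi_biconservative c0 c0A w (De w Dw)).
have [C [r [N [s [l [a0 RD]]]]]] := frame_rotational AF.
have oD := ls_open LS; have sx := ls_smooth LS.
have sX2 := smooth_dir oD sx (af_b2 AF).
have [C1 [C2 [a [th [u0 [v0 [h [d [W [F [g [CC [[d0 oW Ww0 WD Fw0] [[sF sg hF hg] [[sa sth ode] xE]]]]]]]]]]]]]]] :=
  local_model e0 RD sx sX2 (af_b1 AF) (af_b2 AF) (fun w v Dw => frame_span AF v Dw)
    (fun w Dw => dderiv_x LS (b1 w) Dw) (fun w Dw => dderiv_x LS (b2 w) Dw).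
pose B : set 'rV[R]_2 := ball (F w0) d.
have oB : open B by exact: ball_open.
pose c := refined_chart oW oB (fun w Ww => De w (WD w Ww)) sF sg hF hg.
(* Row vectors carry the sup norm, so this ball is a square, which is the product of intervals
   required of the chart image. *)
have BE (y : 'rV[R]_2) : B y <-> u0 - d < y 0 0 < u0 + d /\ v0 - d < y 0 1 < v0 + d.
  apply: iff_trans (ball_row2 _ _ d0) _; rewrite Fw0 row20 row21 !ltr_norml.
  by split=> -[/andP[? ?] /andP[? ?]]; split; apply/andP; split; lra.
exists C1, C2, a, th, u0, h, (u0 - d), (u0 + d), (v0 - d), (v0 + d), c.
split; first exact: CC.
split; first by apply/andP; split; lra.
split; first exact: sa.
split; first exact: sth.
split; first exact: ode.
split; first exact: refined_chart_maximal.
split; first by split; [exact: c0p | exact: Ww0].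
split; first by apply/seteqP; split=> y /BE.
move=> u v uI vI; apply: xE; apply/BE; rewrite row20 row21.
by split.
Qed.
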